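(* Let $f(u)=u-u^q$ with $q\ge3$ an odd integer, let $g\in C^1(\mathbb{R})$ be globally Lipschitz, and let $\{u_h^n\}_{n=0}^N$ be the solution of the fully discrete finite element scheme described in the context. Suppose the mesh assumption given in the context holds. Then there is a constant $C>0$, independent of $h$ and $\tau$, such that $$\sup_{0\le n\le N}\mathbb{E}\bigl[\|\nabla u_h^n\|_{L^2}^2\bigr]+\frac14\sum_{n=0}^{N-1}\mathbb{E}\bigl[\|\nabla(u_h^{n+1}-u_h^n)\|_{L^2}^2\bigr]+\tau\sum_{n=0}^{N-1}\mathbb{E}\bigl[\|\Delta_hu_h^{n+1}\|_{L^2}^2\bigr]\le C,$$ where $\Delta_h:V_h\to V_h$ is the discrete Laplace operator defined by $(\Delta_hv_h,w_h)=-(\nabla v_h,\nabla w_h)$ for all $w_h\in V_h$.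
   Context: **Setting.** $\mathcal{D}\subset\mathbb{R}^d$ ($d=1,2,3$) is a bounded domain, $T>0$, $(\Omega,\mathcal{F},\{\mathcal{F}_t\}_{t\ge0},\mathbb{P})$ is a filtered probability space carrying a standard real-valued Wiener process $W$, $\mathbb{E}$ is expectation, $(\cdot,\cdot)$ is the $L^2(\mathcal{D})$ inner product, and $\|\cdot\|_{L^2}=\|\cdot\|_{L^2(\mathcal{D})}$. The scheme approximates the SPDE $du=[\Delta u+f(u)]dt+g(u)dW(t)$ with $\partial u/\partial\nu=0$ on $\partial\mathcal{D}$ and $u(\cdot,0)=u_0$, where $f(u)=u-u^q$, $q\ge3$ odd, $g\in C^1(\mathbb{R})$ satisfies $|g(a)-g(b)|\le\kappa_1|a-b|$ for all $a,b\in\mathbb{R}$ and some $\kappa_1>0$, and $u_0$ is a sufficiently smooth initial function. **Mesh.** $t_n=n\tau$, $n=0,\dots,N$, is a uniform partition of $[0,T]$ ($\tau=T/N$). $\mathcal{T}_h$ is a conforming simplicial triangulation of $\mathcal{D}$ of mesh size $h$. Mesh assumption (for $d\ge2$): for every edge $E$ of the triangulation, $$\frac{1}{d(d-1)}\sum_{K\supset E}|\kappa_E^K|\cot\theta_E^K\ge0,$$ where the sum is over simplices $K\in\mathcal{T}_h$ containing $E$; if $a_1,\dots,a_{d+1}$ are the vertices of $K$, $E$ joins $a_i$ and $a_j$, and $F_i$ denotes the $(d-1)$-dimensional face of $K$ opposite $a_i$, then $\theta_E^K$ is the angle between $F_i$ and $F_j$, $\kappa_E^K=F_i\cap F_j$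 is the $(d-2)$-dimensional simplex opposite to $E$, and $|\kappa_E^K|$ is its $(d-2)$-dimensional measure. **Scheme.** $V_h=\{v_h\in H^1(\mathcal{D}):v_h|_K\in\mathcal{P}_1(K)\ \forall K\in\mathcal{T}_h\}$. $I_h:C(\overline{\mathcal{D}})\to V_h$ is the nodal interpolation $I_hv=\sum_iv(a_i)\varphi_i$, with $\varphi_i$ the nodal basis function at vertex $a_i$. $P_h:L^2(\mathcal{D})\to V_h$ is the $L^2$-projection; it satisfies the standard estimates $\|w-P_hw\|_{L^2}+h\|\nabla(w-P_hw)\|_{L^2}\le Ch^{\min\{2,s\}}\|w\|_{H^s}$ for $w\in H^s(\mathcal{D})$ and $\|w-P_hw\|_{L^\infty}\le Ch^{2-d/2}\|w\|_{H^2}$. The discrete solution is an $\mathcal{F}_{t_n}$-adapted $V_h$-valued process $\{u_h^n\}$ with $u_h^0=P_hu_0$ such that, $\mathbb{P}$-almost surely, for $n=0,\dots,N-1$, $$(u_h^{n+1},v_h)+\tau(\nabla u_h^{n+1},\nabla v_h)=(u_h^n,v_h)+\tau(I_hf^{n+1},v_h)+(g(u_h^n),v_h)\,\bar\Delta W_{n+1}\quad\forall v_h\in V_h,$$ where $f^{n+1}=u_h^{n+1}-(u_h^{n+1})^q$ and $\bar\Delta W_{n+1}=W(t_{n+1})-W(t_n)$. *)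

(* Defs.v *)
From HB Require Import structures.
From mathcomp Require Import all_boot all_order all_algebra.
From mathcomp Require Import all_classical all_reals all_analysis.

Set Implicit Arguments.
Unset Strict Implicit.
Unset Printing Implicit Defensive.
Import Order.TTheory GRing.Theory Num.Theory.
Import numFieldNormedType.Exports.

Local Open Scope classical_set_scope.
Local Open Scope ring_scope.

Definition rV_display : measure_display.
Proof. exact: default_measure_display. Qed.

(* Borel sigma-algebra of R^d, generated by the coordinate maps. *)
Section measurable_rV.
Context {R : realType} {d : nat}.

Let coor (i : 'I_d) (x : 'rV[R]_d) : measurableTypeR R := x ord0 i.

Let rV_set0 : g_sigma_preimage coor set0.
Proof. exact: sigma_algebra0. Qed.

Let rV_setC A : g_sigma_preimage coor A -> g_sigma_preimage coor (~` A).
Proof. exact: sigma_algebraC. Qed.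

Let rV_bigcup (F : (set 'rV[R]_d)^nat) :
  (forall k, g_sigma_preimage coor (F k)) ->
  g_sigma_preimage coor (\bigcup_k F k).
Proof. exact: sigma_algebra_bigcup. Qed.

HB.instance Definition _ := @isMeasurable.Build rV_display
  'rV[R]_d (g_sigma_preimage coor) rV_set0 rV_setC rV_bigcup.

Lemma measurable_coor (i : 'I_d) :
  measurable_fun setT (fun x : 'rV[R]_d => x ord0 i : measurableTypeR R).
Proof.
move=> _ Y mY; rewrite setTI; apply: sub_sigma_algebra => /=.
rewrite -bigcup_seq/=; exists i => /=; first by rewrite mem_index_enum.
by exists Y => //; rewrite setTI.
Qed.

Lemma measurable_fun_rV (disp : measure_display) (T : measurableType disp)
    (f : T -> 'rV[R]_d) :
  (forall i, measurable_fun setT (fun t => f t ord0 i : measurableTypeR R)) ->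
  measurable_fun setT f.
Proof.
move=> mf _ A mA; rewrite setTI.
pose G := [set B : set 'rV[R]_d | measurable (f @^-1` B)].
suff : measurable `<=` G by exact.
apply: smallest_sub.
  split; rewrite /G/=.
  - by rewrite preimage_set0.
  - by move=> B mB; rewrite setTD preimage_setC; exact: measurableC.
  - by move=> B mB; rewrite preimage_bigcup; exact: bigcup_measurable.
rewrite -bigcup_seq => B [i /= _] [C mC <-]; rewrite /G/= setTI.
by have := mf i measurableT C mC; rewrite setTI.
Qed.

End measurable_rV.

Section lebesgue_rV_step.
Context {R : realType} {d : nat}.
Variable mu : {sigma_finite_measure set 'rV[R]_d -> \bar R}.

Definition consrV (p : measurableTypeR R * 'rV[R]_d) : 'rV[R]_d.+1 :=
  row_mx (p.1 : R)%:M p.2.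

Let splitrV (x : 'rV[R]_d.+1) : measurableTypeR R * 'rV[R]_d :=
  (x ord0 ord0, rsubmx (x : 'rV[R]_(1 + d))).

Let consrVK : cancel consrV splitrV.
Proof.
move=> [a v]; rewrite /consrV /splitrV row_mxKr; congr pair.
rewrite (_ : (ord0 : 'I_d.+1) = lshift d (ord0 : 'I_1)); last exact: val_inj.
by rewrite [LHS](row_mxEl a%:M v) mxE eqxx.
Qed.

Lemma measurable_consrV : measurable_fun setT consrV.
Proof.
apply: measurable_fun_rV => i; case: (splitP (i : 'I_(1 + d))) => [j ij|j ij].
  rewrite (_ : (fun _ => _) = fst) ?measurable_fst//; apply/funext => -[a v].
  have -> : i = lshift d j by apply: val_inj.
  by rewrite /consrV [LHS](row_mxEl a%:M v) !ord1 mxE eqxx.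
rewrite (_ : (fun _ => _) = (fun x : 'rV[R]_d => x ord0 j) \o snd).
  by apply: measurableT_comp => //; exact: measurable_coor.
apply/funext => -[a v] /=.
have -> : i = rshift 1 j by apply: val_inj.
by rewrite /consrV [LHS](row_mxEr a%:M v).
Qed.

Let measurable_splitrV : measurable_fun setT splitrV.
Proof.
apply/measurable_fun_pairP; split; first exact: measurable_coor.
apply: measurable_fun_rV => i.
rewrite (_ : (fun _ => _) = (fun x : 'rV[R]_d.+1 => x ord0 (rshift 1 i))).
  exact: measurable_coor.
by apply/funext => x; rewrite /= mxE.
Qed.

Definition lebesgue_rV_step : set 'rV[R]_d.+1 -> \bar R :=
  pushforward (lebesgue_measure \x mu)%E consrV.

Let step0 : lebesgue_rV_step set0 = 0%E.
Proof. by rewrite /lebesgue_rV_step /pushforward preimage_set0 measure0. Qed.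

Let step_ge0 A : (0 <= lebesgue_rV_step A)%E.
Proof. by rewrite /lebesgue_rV_step /pushforward; exact: measure_ge0. Qed.

Let step_sigma_additive : semi_sigma_additive lebesgue_rV_step.
Proof.
move=> F mF tF mUF; rewrite /lebesgue_rV_step /pushforward preimage_bigcup.
have mc A : measurable A -> measurable (consrV @^-1` A).
  by move=> mA; rewrite -[X in measurable X]setTI; exact: measurable_consrV.
apply: measure_semi_sigma_additive.
- by move=> n; exact: mc.
- apply/trivIsetP => /= i j _ _ ij; rewrite -preimage_setI.
  by move/trivIsetP : tF => /(_ _ _ _ _ ij) ->//; rewrite preimage_set0.
- by rewrite -preimage_bigcup; exact: mc.
Qed.

HB.instance Definition _ := isMeasure.Build _ _ _ lebesgue_rV_step
  step0 step_ge0 step_sigma_additive.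

Let step_sigma_finite : sigma_finite setT lebesgue_rV_step.
Proof.
have /sigma_finiteP[F [TF ndF Foo]] :=
  @sigma_finiteT _ _ _ (@lebesgue_measure R).
have /sigma_finiteP[G [TG ndG Goo]] := sigma_finiteT mu.
exists (fun n => splitrV @^-1` (F n `*` G n)).
  apply/esym/seteqP; split => // x _.
  have [n _ Fn] : (\bigcup_n F n) (splitrV x).1 by rewrite -TF.
  have [k _ Gk] : (\bigcup_n G n) (splitrV x).2 by rewrite -TG.
  exists (maxn n k) => //; split => /=.
  - by move: Fn; exact/subsetPset/ndF/leq_maxl.
  - by move: Gk; exact/subsetPset/ndG/leq_maxr.
move=> n; have [mF Fn] := Foo n; have [mG Gn] := Goo n; split.
  rewrite -[X in measurable X]setTI; apply: measurable_splitrV => //.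
  exact: measurableX.
rewrite /lebesgue_rV_step /pushforward -comp_preimage.
rewrite (_ : splitrV \o consrV = id); last first.
  by apply/funext => p /=; rewrite consrVK.
by rewrite preimage_id product_measure1E// lte_mul_pinfty// ge0_fin_numE.
Qed.

HB.instance Definition _ := Measure_isSigmaFinite.Build _ _ _ lebesgue_rV_step
  step_sigma_finite.

End lebesgue_rV_step.

(* Lebesgue measure of R^d as an iterated product; Dirac mass for d = 0. *)
Fixpoint lebesgue_rV (R : realType) (d : nat) :
    {sigma_finite_measure set 'rV[R]_d -> \bar R} :=
  match d with
  | 0 => \d_(0 : 'rV[R]_0)
  | d'.+1 => lebesgue_rV_step (lebesgue_rV R d')
  end.

Section euclidean.
Context {R : realType} {d : nat}.

(* The library norm on row vectors is the sup norm, which gives the same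
   topology but not the lengths and angles needed here. *)
Definition dotv (u v : 'rV[R]_d) : R := \sum_i u ord0 i * v ord0 i.

Definition enorm (u : 'rV[R]_d) : R := Num.sqrt (dotv u u).

End euclidean.

Section sobolev.
Context {R : realType} {d : nat}.
Variable D : set 'rV[R]_d.
Implicit Types (v w phi : 'rV[R]_d -> R) (i : 'I_d) (k s : nat).

Definition bounded_domain : Prop :=
  [/\ open D, connected D, D !=set0 & bounded_set D].

Definition L2 v : Prop :=
  measurable_fun D (v : 'rV[R]_d -> measurableTypeR R) /\
  (\int[lebesgue_rV R d]_(x in D) ((v x) ^+ 2)%:E < +oo)%E.

Definition ip v w : R := (\int[lebesgue_rV R d]_(x in D) (v x * w x))%R.

Definition normL2 v : R := Num.sqrt (ip v v).

(* v \_ D is v extended by zero, so this is the essential supremum over D *)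
Definition normLinf v : \bar R := 'N[lebesgue_rV R d]_+oo[(EFin \o v) \_ D].

Definition partial i phi : 'rV[R]_d -> R :=
  fun x => 'D_(delta_mx ord0 i) (phi : 'rV[R]_d -> R^o) x.

Fixpoint Ck k phi : Prop :=
  continuous phi /\
  match k with
  | 0 => True
  | k'.+1 => forall i,
      (forall x, derivable (phi : 'rV[R]_d -> R^o) x (delta_mx ord0 i)) /\
      Ck k' (partial i phi)
  end.

Definition tsupport phi : set 'rV[R]_d := closure [set x | phi x != 0].

Definition test_function phi : Prop :=
  [/\ forall k, Ck k phi, compact (tsupport phi) & tsupport phi `<=` D].

Definition weak_partial i v w : Prop :=
  L2 w /\ forall phi, test_function phi -> ip v (partial i phi) = - ip w phi.

(* a chosen representative of the (a.e. unique) weak derivative *)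
Definition wpartial i v : 'rV[R]_d -> R :=
  xget (fun=> 0) [set w | weak_partial i v w].

Fixpoint Hs s v : Prop :=
  L2 v /\
  match s with
  | 0 => True
  | s'.+1 => forall i, exists w, weak_partial i v w /\ Hs s' w
  end.

(* Sums over all words of length at most s in the partial derivatives, so a
   mixed derivative is counted once for each ordering: this norm is equivalent
   to the one indexed by multi-indices, with constants depending on d and s. *)
Fixpoint normHs_sq s v : R :=
  ip v v + match s with
           | 0 => 0
           | s'.+1 => \sum_i normHs_sq s' (wpartial i v)
           end.

Definition normHs s v : R := Num.sqrt (normHs_sq s v).

Definition ip_grad v w : R := \sum_i ip (wpartial i v) (wpartial i w).

Definition normL2_grad v : R := Num.sqrt (ip_grad v v).

End sobolev.

(* A simplicial complex with labelled vertices: a simplex is given by the set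
   of the labels of its vertices. *)
Record mesh (R : realType) (d : nat) := Mesh {
  nb_nodes : nat;
  node : 'I_nb_nodes -> 'rV[R]_d;
  cells : {set {set 'I_nb_nodes}} }.

Section mesh_geometry.
Context {R : realType} {d : nat}.
Variable M : mesh R d.
Local Notation idx := 'I_(nb_nodes M).
Implicit Types (S K : {set idx}) (i j k : idx).

Definition aff S : set 'rV[R]_d := [set x | exists c : idx -> R,
  \sum_(k in S) c k = 1 /\ x = \sum_(k in S) c k *: node k].

Definition simplex S : set 'rV[R]_d := [set x | exists c : idx -> R,
  [/\ forall k, k \in S -> 0 <= c k, \sum_(k in S) c k = 1 &
      x = \sum_(k in S) c k *: node k]].

Definition affinely_independent S : Prop := forall c : idx -> R,
  \sum_(k in S) c k = 0 -> \sum_(k in S) c k *: node k = 0 ->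
  forall k, k \in S -> c k = 0.

(* Conforming simplicial triangulation of D. Taking D to be the interior of
   the union of the closed simplices (so that this union is the closure of D)
   makes D a polytopal domain without cracks. *)
Definition triangulation (D : set 'rV[R]_d) : Prop :=
  [/\ forall K, K \in cells M -> #|K| = d.+1 /\ affinely_independent K,
      forall k, exists2 K, K \in cells M & k \in K,
      forall K K', K \in cells M -> K' \in cells M ->
        simplex K `&` simplex K' = simplex (K :&: K'),
      closure D = \bigcup_(K in [set` cells M]) simplex K &
      D = interior (\bigcup_(K in [set` cells M]) simplex K)].

Definition mesh_size : R := sup [set r | exists K x y,
  [/\ K \in cells M, simplex K x, simplex K y & r = enorm (x - y)]].

(* k-dimensional measure of the simplex with vertex set S, where #|S| = k + 1:
   square root of the Gram determinant of its edges at one vertex, over k!. *)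
Definition simplex_measure S : R :=
  let a := nth 0 [seq node k | k <- enum S] in
  Num.sqrt (\det (\matrix_(k < #|S|.-1, l < #|S|.-1)
                    dotv (a k.+1 - a 0%N) (a l.+1 - a 0%N))) / (#|S|.-1)`!%:R.

(* kappa_E^K = F_i :&: F_j, the face of K opposite to the edge E = a_i a_j *)
Definition opp_face K i j : {set idx} := K :\: [set i; j].

(* The vector from the foot to a_j of the perpendicular dropped from a_j to
   the affine hull of kappa_E^K. It lies in the face F_i, is orthogonal to
   kappa_E^K, and points into F_i. *)
Definition altitude K i j : 'rV[R]_d := xget 0 [set p |
  aff (opp_face K i j) (node j - p) /\
  forall k l, k \in opp_face K i j -> l \in opp_face K i j ->
    dotv p (node k - node l) = 0].

(* theta_E^K, the angle between the faces F_i and F_j along kappa_E^K *)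
Definition dihedral_angle K i j : R :=
  let p := altitude K i j in let q := altitude K j i in
  acos (dotv p q / (enorm p * enorm q)).

Definition cot (x : R) : R := cos x / sin x.

(* The sum is empty unless i and j are the end points of an edge. *)
Definition mesh_assumption : Prop := (2 <= d)%N -> forall i j, i != j ->
  0 <= (d * d.-1)%:R^-1 *
       \sum_(K in cells M | [set i; j] \subset K)
          simplex_measure (opp_face K i j) * cot (dihedral_angle K i j).

End mesh_geometry.

Section finite_elements.
Context {R : realType} {d : nat}.
Variables (D : set 'rV[R]_d) (M : mesh R d).
Implicit Types (v w : 'rV[R]_d -> R).

(* Functions are genuine functions, affine on each closed simplex, hence
   continuous on the closure of D; their values elsewhere are irrelevant. *)
Definition Vh v : Prop :=
  Hs D 1 v /\
  forall K, K \in cells M -> exists (b : 'rV[R]_d) (c : R),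
    forall x, simplex K x -> v x = dotv b x + c.

Definition nodal_basis (i : 'I_(nb_nodes M)) : 'rV[R]_d -> R :=
  xget (fun=> 0) [set v | Vh v /\ forall j, v (node j) = (i == j)%:R].

Definition interpolant v : 'rV[R]_d -> R :=
  fun x => \sum_i v (node i) * nodal_basis i x.

Definition L2_projection v : 'rV[R]_d -> R :=
  xget (fun=> 0) [set p | Vh p /\ forall z, Vh z -> ip D p z = ip D v z].

Definition discrete_laplacian v : 'rV[R]_d -> R :=
  xget (fun=> 0) [set w | Vh w /\
    forall z, Vh z -> ip D w z = - ip_grad D v z].

End finite_elements.

Section standard_estimates.
Context {R : realType} {d : nat}.
Variables (D : set 'rV[R]_d) (I : Type) (Th : I -> mesh R d).

(* The standard estimates for P_h, uniform along the family of meshes; the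
   order s ranges over the positive integers. *)
Definition L2_projection_estimates : Prop :=
  (forall s : nat, (0 < s)%N -> exists C : R, 0 < C /\
     forall (i : I) (w : 'rV[R]_d -> R), Hs D s w ->
       let h := mesh_size (Th i) in
       let e := fun x => w x - L2_projection D (Th i) w x in
       normL2 D e + h * normL2_grad D e <= C * h ^+ (minn 2 s) * normHs D s w)
  /\
  (exists C : R, 0 < C /\
     forall (i : I) (w : 'rV[R]_d -> R), Hs D 2 w ->
       let h := mesh_size (Th i) in
       let e := fun x => w x - L2_projection D (Th i) w x in
       (normLinf D e <= (C * h `^ (2 - d%:R / 2) * normHs D 2 w)%:E)%E).

End standard_estimates.

Section stochastic_basis.
Context {R : realType} {disp : measure_display} {Omega : measurableType disp}.
Variable P : probability Omega R.
Implicit Types (F : R -> set (set Omega)) (G : set (set Omega)).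

(* the sigma-algebras F t are indexed by t >= 0 *)
Definition filtration F : Prop :=
  [/\ forall t, 0 <= t -> sigma_algebra setT (F t),
      forall t, 0 <= t -> F t `<=` measurable &
      forall s t, 0 <= s -> s <= t -> F s `<=` F t].

Definition measurable_wrt G (X : Omega -> R) : Prop :=
  forall B : set (measurableTypeR R), measurable B -> G (X @^-1` B).

(* Standard real-valued Wiener process relative to the filtration F; the second
   argument of normal_prob is the standard deviation. *)
Definition wiener_process F (W : R -> Omega -> R) : Prop :=
  [/\ forall t, 0 <= t -> measurable_wrt (F t) (W t),
      {ae P, forall w, W 0 w = 0},
      forall s t, 0 <= s -> s < t ->
        let dW : Omega -> R := fun w => W t w - W s w in
        forall B : set (measurableTypeR R), measurable B ->
          P (dW @^-1` B) = normal_prob 0 (Num.sqrt (t - s)) B,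
      forall s t, 0 <= s -> s < t ->
        let dW : Omega -> R := fun w => W t w - W s w in
        forall (A : set Omega) (B : set (measurableTypeR R)),
          F s A -> measurable B ->
          P (A `&` (dW @^-1` B)) = (P A * P (dW @^-1` B))%E &
      {ae P, forall w,
        {within [set t : R | 0 <= t], continuous (fun t => W t w)}}].

End stochastic_basis.

Section scheme.
Context {R : realType} {d : nat} {disp : measure_display}
  {Omega : measurableType disp}.
Variables (P : probability Omega R) (F : R -> set (set Omega))
  (W : R -> Omega -> R).
Variables (D : set 'rV[R]_d) (T : R) (q : nat) (g : R -> R)
  (u0 : 'rV[R]_d -> R) (M : mesh R d) (N : nat).

Let tau : R := T / N%:R.
Let t_ (n : nat) : R := n%:R * tau.

(* Only u n for n <= N matters. Adaptedness of a V_h-valued process is stated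
   through point evaluations, which generate the Borel sets of V_h. *)
Definition fem_solution (u : nat -> Omega -> 'rV[R]_d -> R) : Prop :=
  [/\ forall n w, (n <= N)%N -> Vh D M (u n w),
      forall n x, (n <= N)%N -> closure D x ->
        measurable_wrt (F (t_ n)) (fun w => u n w x),
      forall w x, closure D x -> u 0%N w x = L2_projection D M u0 x &
      {ae P, forall w, forall n, (n < N)%N -> forall v, Vh D M v ->
        let fn1 := interpolant D M (fun x => u n.+1 w x - u n.+1 w x ^+ q) in
        ip D (u n.+1 w) v + tau * ip_grad D (u n.+1 w) v =
        ip D (u n w) v + tau * ip D fn1 v
        + ip D (fun x => g (u n w x)) v * (W (t_ n.+1) w - W (t_ n) w)}].

End scheme.

(* Main.v *)
(** A function of V_h is determined by its nodal values, so testing the scheme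
  with all of V_h gives the nodal identity
    u' = u + tau Delta_h u' + tau f(u') + (P_h g(u)) dW.
  Pair it with u' in the inner product B = a + L, where a is the stiffness form
  and L the lumped mass form. The term a(I_h u'^q, u') is nonnegative because
  the off-diagonal entries of the stiffness matrix, which are minus the
  cotangent sums of the mesh assumption, are nonpositive. As L is equivalent to
  the L^2 inner product with constants depending only on d, the remaining
  lower order terms are absorbed by |Delta_h u'|^2 and by the superlinear
  damping - u^(q+1), whatever the size of tau. With E(v) = B(v, v) this leaves
    E(u') + E(u' - u) / 2 + (tau / 2) |Delta_h u'|^2
      <= E(u) + C tau + 2 B(P_h g(u), u) dW + 2 E(P_h g(u)) dW^2,
  and E(P_h g(u)) <= C (1 + E(u)) by the H^1-stability of P_h, contained in its
  approximation estimate for s = 1, and by the chain rule for g(u). Expectation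
  removes the term in dW; conclude by the discrete Gronwall lemma. *)
Require Import Defs.
From HB Require Import structures.
From mathcomp Require Import all_boot all_order all_algebra.
From mathcomp Require Import fingroup perm.
From mathcomp Require Import all_classical all_reals all_analysis.
From mathcomp Require Import measurable_realfun.
From mathcomp Require Import ring lra zify.

Set Implicit Arguments.
Unset Strict Implicit.
Unset Printing Implicit Defensive.
Import Order.TTheory GRing.Theory Num.Theory.
Import numFieldNormedType.Exports.

Local Open Scope classical_set_scope.
Local Open Scope ring_scope.


(** * Lebesgue measure on R^d under affine maps *)

(** Mass lumping turns the product of [I_h u'^q] with [u'] into a sum over vertices, so the damping
    reduces to a polynomial inequality in one real variable ([pot_bound]). In the noise term B(z,
    u') dW, with z = P_h g(u), only B(z, u) is known before the increment; the remainder B(z, u' -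
    u) dW is absorbed at the price of half of E(u' - u). Three foundations shape the file. Elements
    of V_h carry weak derivatives, so hat functions and g(u) have to be shown weakly differentiable,
    by difference quotients, and weak derivatives unique, by bump functions. The measure
    [lebesgue_rV] is an iterated product, so its behaviour under translations and linear maps,
    needed for difference quotients and for volumes of simplices, comes from slicing and an LUP
    decomposition. Projections and discrete Laplacians are chosen by [xget], so they are shown to
    exist, and measurability in the sample point is read off formulas in the nodal values.
    Expectations are handled as extended real integrals of nonnegative functions; signed terms are
    split and moved across the inequality before integrating. *)

Section measurable_rV_ops.
Context {R : realType} {d : nat}.
Implicit Types (A B D : set 'rV[R]_d).

Lemma measurable_funT_preimage (disp : measure_display) (T : measurableType disp)
    (disp' : measure_display) (T' : measurableType disp') (f : T -> T')
    (Y : set T') :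
  measurable_fun setT f -> measurable Y -> measurable (f @^-1` Y).
Proof. by move=> mf mY; rewrite -[X in measurable X]setTI; exact: mf. Qed.

Definition rbox (a b : 'rV[R]_d) : set 'rV[R]_d :=
  [set x | forall i, a ord0 i < x ord0 i < b ord0 i].

Lemma measurable_rbox a b : measurable (rbox a b).
Proof.
rewrite (_ : rbox a b = \bigcap_(i in [set` enum 'I_d])
  ((fun x : 'rV[R]_d => x ord0 i : measurableTypeR R) @^-1` `]a ord0 i, b ord0 i[%classic)).
  apply: fin_bigcap_measurable => // i _; apply: measurable_funT_preimage.
    exact: measurable_coor.
  exact: measurable_itv.
apply/seteqP; split => x /= H i.
  by move=> _ /=; rewrite in_itv/=; exact: H.
by have := H i; rewrite /= mem_enum in_itv/=; apply.
Qed.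

Lemma rV_open_box D x : open D -> D x -> exists e : R, 0 < e /\
  forall y : 'rV[R]_d, (forall i, `|x ord0 i - y ord0 i| < e) -> D y.
Proof.
move=> oD Dx; have [e /= e0 be] := (@nbhs_ballP _ _ x D).1 (open_nbhs_nbhs (conj oD Dx)).
exists e; split=> // y H; apply: be; rewrite /ball/= /mx_ball; split => // i j.
by rewrite !ord1; exact: H.
Qed.

Definition cbox (a b : 'rV[R]_d) : set 'rV[R]_d :=
  [set x | forall i, a ord0 i <= x ord0 i <= b ord0 i].

(** The half side of a box equals the step of the grid, so neighbouring boxes overlap and the open
    ones still cover the grid hyperplanes. *)
Definition grid_lo (p : nat * 'rV[int]_d) : 'rV[R]_d :=
  \row_i (((p.2 ord0 i)%:~R - 1) / (p.1.+1%:R)).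

Definition grid_hi (p : nat * 'rV[int]_d) : 'rV[R]_d :=
  \row_i (((p.2 ord0 i)%:~R + 1) / (p.1.+1%:R)).

(** The index type is countable, which makes open sets measurable. The closed box is asked to lie in
    [D], because the [bump] carried by it must be a test function on [D]. *)
Lemma open_bigcup_grid D : open D -> 
  D = \bigcup_(p in [set p | cbox (grid_lo p) (grid_hi p) `<=` D]) rbox (grid_lo p) (grid_hi p).
Proof.
move=> oD; apply/seteqP; split => [x Dx|x [p /=]]; last first.
  by move=> + bx; apply => i; have /andP[? ?] := bx i; rewrite !ltW.
have [e [e0 De]] := rV_open_box oD Dx.
have [n ne] : exists n : nat, 2 / n.+1%:R < e.
  have [n Hn] : exists n : nat, 2 / e < n%:R.
    by exists (Num.truncn (2 / e)).+1; rewrite truncnS_gt.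
  exists n; rewrite ltr_pdivrMr// mulrC -ltr_pdivrMr//.
  by rewrite (lt_trans Hn)// ltr_nat.
pose z : 'rV[int]_d := \row_i Num.floor (x ord0 i * n.+1%:R).
have zP i : (((z ord0 i)%:~R - 1) / (n.+1%:R)) < x ord0 i < (((z ord0 i)%:~R + 1) / (n.+1%:R)).
  have n0 : 0 < n.+1%:R :> R by [].
  rewrite ltr_pdivrMr// ltr_pdivlMr// mxE; apply/andP; split.
    by rewrite (lt_le_trans _ (Num.Theory.floor_le _))// ltrBlDr ltrDl.
  by have := floorD1_gt (x ord0 i * n.+1%:R); rewrite intrD.
exists (n, z); last by move=> i; have := zP i; rewrite !mxE.
move=> y yb; apply: De => i; move: (zP i) (yb i); rewrite !mxE/=.
set a := (_ - 1) / _; set b := (_ + 1) / _.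
have ba : b - a = 2 / n.+1%:R by rewrite /b /a -mulrBl; congr (_ / _); ring.
rewrite -ba in ne; move: a b ne {ba} => a b ne.
by move=> /andP[? ?] /andP[? ?]; rewrite ltr_norml; apply/andP; split; lra.
Qed.

Lemma measurable_open D : open D -> measurable D.
Proof.
move=> oD; rewrite (open_bigcup_grid oD) bigcup_mkcond.
apply: countable_bigcupT_measurable => // p.
by case: ifP => _; [exact: measurable_rbox|exact: measurable0].
Qed.

Lemma measurable_fun_continuous_rV (f : 'rV[R]_d -> R) : continuous f ->
  measurable_fun setT (f : 'rV[R]_d -> measurableTypeR R).
Proof.
move=> /continuousP cf; apply: (measurability _ (RGenOpens.measurableE R)).
move=> _ [_ [a [b ->] <-]]; rewrite setTI; apply: measurable_open.
exact/cf/interval_open.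
Qed.

End measurable_rV_ops.

Section scaling_maps.
Context {R : realType}.

(** [c] is the inverse of the absolute Jacobian. Stated with preimages, the property composes
    without any mention of injectivity. *)
Definition scales_rV d (phi : 'rV[R]_d -> 'rV[R]_d) (c : R) : Prop :=
  measurable_fun setT phi /\ forall A, measurable A ->
    lebesgue_rV R d (phi @^-1` A) = (c%:E * lebesgue_rV R d A)%E.

Lemma scales_rV_comp d (phi psi : 'rV[R]_d -> 'rV[R]_d) c c' :
  scales_rV phi c -> scales_rV psi c' -> scales_rV (phi \o psi) (c' * c).
Proof.
move=> [mphi sphi] [mpsi spsi]; split; first exact: measurableT_comp.
move=> A mA; rewrite comp_preimage spsi; last exact: measurable_funT_preimage.
by rewrite sphi// muleA EFinM.
Qed.

Lemma lebesgue_measure_translate (b : R) (A : set R) :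
  measurable (A : set (measurableTypeR R)) ->
  lebesgue_measure ((fun x => x + b) @^-1` A) = lebesgue_measure A.
Proof.
move=> mA.
have mt : measurable_fun setT ((fun x => x + b) : measurableTypeR R -> measurableTypeR R).
  exact: measurable_funD.
pose m := pushforward lebesgue_measure ((fun x => x + b) : measurableTypeR R -> measurableTypeR R).
rewrite -[LHS]/(m A).
apply/esym; apply: (@lebesgue_measure_unique _ [the measure _ _ of m]) => //= _ [[u v]] _ <-.
rewrite /m /pushforward/= (_ : _ @^-1` _ = `](u - b), (v - b)]%classic).
  by rewrite !lebesgue_measure_itv/= !lte_fin ltrD2r; case: ifP => // _; rewrite -!EFinD opprB addrA subrK.
by apply/seteqP; split => x /=; rewrite !in_itv/= ltrBlDr lerBrDr.
Qed.

Lemma lebesgue_measure_dilate_gt0 (a : R) (A : set R) : 0 < a ->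
  measurable (A : set (measurableTypeR R)) ->
  (a%:E * lebesgue_measure ((fun x => a * x)%R @^-1` A))%E = lebesgue_measure A.
Proof.
move=> a0 mA.
have mt : measurable_fun setT ((fun x => a * x) : measurableTypeR R -> measurableTypeR R).
  exact: measurable_funM.
apply/esym; apply: (@lebesgue_measure_unique _ (mscale (NngNum (ltW a0)) (pushforward
  lebesgue_measure ((fun x => a * x) : measurableTypeR R -> measurableTypeR R)))) => //= _ [[u v]] _ <-.
rewrite /mscale/= /pushforward/= (_ : _ @^-1` _ = `](u / a), (v / a)]%classic).
  rewrite !lebesgue_measure_itv/= !lte_fin ltr_pM2r ?invr_gt0//; case: ifP => // _; last by rewrite mule0.
  by rewrite -!EFinD -EFinM; congr EFin; field; rewrite gt_eqF.
by apply/seteqP; split => x /=; rewrite !in_itv/= ltr_pdivrMr// ler_pdivlMr// mulrC.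
Qed.

Lemma lebesgue_measure_affine (a b : R) (A : set R) : a != 0 ->
  measurable (A : set (measurableTypeR R)) ->
  lebesgue_measure ((fun x => a * x + b) @^-1` A) = (`|a|^-1%:E * lebesgue_measure A)%E.
Proof.
move=> a0 mA.
have pos (c : R) (B : set R) : 0 < c -> measurable (B : set (measurableTypeR R)) ->
    lebesgue_measure ((fun x => c * x) @^-1` B) = (c^-1%:E * lebesgue_measure B)%E.
  move=> c0 mB; rewrite -(lebesgue_measure_dilate_gt0 c0 mB) muleA -EFinM mulVf ?gt_eqF//.
  by rewrite mul1e.
have mb : measurable ((fun x => x + b) @^-1` A : set (measurableTypeR R)).
  apply: (@measurable_funT_preimage _ (measurableTypeR R) _ (measurableTypeR R) (fun x : R => x + b)) => //.
  exact: measurable_funD.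
rewrite -(lebesgue_measure_translate b mA).
have [apos|] := ltP 0 a.
  by rewrite gtr0_norm//; exact: (pos _ ((fun x => x + b) @^-1` A)).
rewrite le_eqVlt (negbTE a0)/= => aneg.
rewrite ltr0_norm// -pos ?oppr_gt0//.
rewrite -[RHS]lebesgue_measureN.
  congr (lebesgue_measure _); apply/seteqP; split => x /=; by rewrite mulrNN.
apply: (@measurable_funT_preimage _ (measurableTypeR R) _ (measurableTypeR R) (fun x : R => - a * x)) => //.
exact: measurable_funM.
Qed.

Lemma lebesgue_rVS_fiber1 d (A : set 'rV[R]_d.+1) : measurable A ->
  lebesgue_rV R d.+1 A =
  (\int[@lebesgue_measure R]_x lebesgue_rV R d [set y | A (consrV (x, y))])%E.
Proof.
move=> mA; apply: eq_integral => x _ /=; congr (lebesgue_rV R d _).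
by apply/seteqP; split => y /=; rewrite /xsection/= inE.
Qed.

Lemma lebesgue_rVS_fiber2 d (A : set 'rV[R]_d.+1) : measurable A ->
  lebesgue_rV R d.+1 A =
  (\int[lebesgue_rV R d]_y (@lebesgue_measure R) [set x | A (consrV (x, y))])%E.
Proof.
move=> mA; have mB : measurable (@consrV R d @^-1` A).
  by apply: measurable_funT_preimage => //; exact: measurable_consrV.
transitivity ((lebesgue_measure \x^ lebesgue_rV R d)%E (@consrV R d @^-1` A)).
  by rewrite /= /lebesgue_rV_step /pushforward; apply: product_measure_unique => //= *; rewrite product_measure2E.
apply: eq_integral => y _ /=; congr (lebesgue_measure _).
by apply/seteqP; split => x /=; rewrite /ysection/= inE.
Qed.

Lemma measurable_consrV_fiber1 d (A : set 'rV[R]_d.+1) (x : R) : measurable A ->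
  measurable [set y | A (consrV (x, y))].
Proof.
move=> mA; have mB : measurable (@consrV R d @^-1` A).
  by apply: measurable_funT_preimage => //; exact: measurable_consrV.
rewrite (_ : [set y | _] = xsection (@consrV R d @^-1` A) x); first exact: measurable_xsection.
by apply/seteqP; split => y /=; rewrite /xsection/= inE.
Qed.

Lemma measurable_consrV_fiber2 d (A : set 'rV[R]_d.+1) y : measurable A ->
  measurable ([set x | A (consrV (x, y))] : set (measurableTypeR R)).
Proof.
move=> mA; have mB : measurable (@consrV R d @^-1` A).
  by apply: measurable_funT_preimage => //; exact: measurable_consrV.
rewrite (_ : [set x | _] = ysection (@consrV R d @^-1` A) y); first exact: measurable_ysection.
by apply/seteqP; split => x /=; rewrite /ysection/= inE.
Qed.

Lemma ge0_integral_scales d (phi : 'rV[R]_d -> 'rV[R]_d) c (f : 'rV[R]_d -> \bar R) :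
  0 <= c -> scales_rV phi c -> measurable_fun setT f -> (forall x, 0 <= f x)%E ->
  (\int[lebesgue_rV R d]_x f (phi x) = c%:E * \int[lebesgue_rV R d]_x f x)%E.
Proof.
move=> c0 [mphi sphi] mf f0.
rewrite -[LHS]/(\int[lebesgue_rV R d]_(x in phi @^-1` setT) (f \o phi) x)%E.
rewrite -ge0_integral_pushforward//.
rewrite -(@ge0_integral_mscale _ _ _ (lebesgue_rV R d) setT measurableT (NngNum c0))//.
apply: eq_measure_integral => A mA _; rewrite /mscale/= /pushforward; exact: sphi.
Qed.

Definition rV_tail d (x : 'rV[R]_d.+1) : 'rV[R]_d := rsubmx (x : 'rV[R]_(1 + d)).

Lemma consrV_eta d (x : 'rV[R]_d.+1) : x = consrV (x ord0 ord0, rV_tail x).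
Proof.
rewrite /consrV/=.
rewrite (_ : (x ord0 ord0)%:M = lsubmx (x : 'rV[R]_(1 + d))).
  by rewrite /rV_tail hsubmxK.
apply/matrixP => i j; rewrite !ord1 !mxE eqxx mulr1n; congr (x _ _); exact: val_inj.
Qed.

Lemma consrV0 d (a : R) (v : 'rV[R]_d) : consrV (a, v) ord0 ord0 = a.
Proof.
rewrite /consrV/= (_ : (ord0 : 'I_d.+1) = lshift d (ord0 : 'I_1)); last exact: val_inj.
by rewrite [LHS](row_mxEl a%:M v) mxE eqxx.
Qed.

Lemma consrV_tail d (a : R) (v : 'rV[R]_d) : rV_tail (consrV (a, v)) = v.
Proof. by rewrite /rV_tail /consrV row_mxKr. Qed.

Lemma measurable_rV_tail d : measurable_fun setT (@rV_tail d).
Proof.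
apply: measurable_fun_rV => i.
rewrite (_ : (fun _ => _) = (fun x : 'rV[R]_d.+1 => x ord0 (rshift 1 i))); first exact: measurable_coor.
by apply/funext => x; rewrite /rV_tail mxE.
Qed.

(** Slice at a fixed tail: there the first coordinate undergoes a one-dimensional affine map, and
    what remains is the change of variable [psi] on the tail. *)
Lemma scales_rVS_lower d (psi : 'rV[R]_d -> 'rV[R]_d) (f : 'rV[R]_d -> R) c s :
  0 <= c -> s != 0 -> measurable_fun setT (f : _ -> measurableTypeR R) -> scales_rV psi c ->
  scales_rV (fun x => consrV (s * x ord0 ord0 + f (rV_tail x), psi (rV_tail x))) (c * `|s|^-1).
Proof.
move=> c0 s0 mf spsi; have [mpsi _] := spsi.
have mPhi : measurable_fun setT (fun x : 'rV[R]_d.+1 => consrV (s * x ord0 ord0 + f (rV_tail x), psi (rV_tail x))).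
  apply: measurableT_comp; first exact: measurable_consrV.
  apply/measurable_fun_pairP; split => /=.
    apply: measurable_funD.
      by apply: measurable_funM => //; exact: measurable_coor.
    by apply: measurableT_comp => //; exact: measurable_rV_tail.
  exact: (measurableT_comp mpsi (@measurable_rV_tail d)).
split=> // A mA; rewrite lebesgue_rVS_fiber2; last exact: measurable_funT_preimage.
pose G y := (@lebesgue_measure R) [set x | A (consrV (x, y))].
rewrite [LHS](_ : _ = \int[lebesgue_rV R d]_y (`|s|^-1%:E * G (psi y)))%E; last first.
  apply: eq_integral => y _; rewrite -(@lebesgue_measure_affine s (f y))//; last exact: measurable_consrV_fiber2.
  by congr (lebesgue_measure _); apply/seteqP; split => x /=; rewrite consrV0 consrV_tail.
have mG : measurable_fun setT G.
  rewrite (_ : G = lebesgue_measure \o ysection (@consrV R d @^-1` A)).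
    apply: measurable_fun_ysection; apply: measurable_funT_preimage => //; exact: measurable_consrV.
  apply/funext => y /=; congr (lebesgue_measure _).
  by apply/seteqP; split => x /=; rewrite /ysection/= inE.
rewrite ge0_integralZl_EFin//=; last by apply: measurableT_comp.
rewrite (ge0_integral_scales c0 spsi)// -lebesgue_rVS_fiber2// muleA -EFinM mulrC//.
Qed.

(** The mirror case: the map on the tail depends on the first coordinate, so the slices are taken at
    a fixed first coordinate. A factor [c] common to all [chi x] can leave the outer integral. *)
Lemma scales_rVS_upper d (chi : R -> 'rV[R]_d -> 'rV[R]_d) c s b :
  0 <= c -> s != 0 ->
  measurable_fun setT (fun p : measurableTypeR R * 'rV[R]_d => chi p.1 p.2) ->
  (forall x, scales_rV (chi x) c) ->
  scales_rV (fun x => consrV (s * x ord0 ord0 + b, chi (x ord0 ord0) (rV_tail x))) (c * `|s|^-1).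
Proof.
move=> c0 s0 mchi schi.
have mPhi : measurable_fun setT (fun x : 'rV[R]_d.+1 => consrV (s * x ord0 ord0 + b, chi (x ord0 ord0) (rV_tail x))).
  apply: measurableT_comp; first exact: measurable_consrV.
  apply/measurable_fun_pairP; split => /=.
    apply: measurable_funD => //; apply: measurable_funM => //; exact: measurable_coor.
  have mp : measurable_fun setT (fun x : 'rV[R]_d.+1 => (x ord0 ord0 : measurableTypeR R, rV_tail x)).
    apply/measurable_fun_pairP; split => /=; [exact: measurable_coor|exact: measurable_rV_tail].
  exact: (measurableT_comp mchi mp).
split=> // A mA; rewrite lebesgue_rVS_fiber1; last exact: measurable_funT_preimage.
pose G x := lebesgue_rV R d [set y | A (consrV (x, y))].
rewrite [LHS](_ : _ = \int[@lebesgue_measure R]_x (c%:E * G (s * x + b)%R))%E; last first.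
  apply: eq_integral => x _; rewrite -(schi x).2; last exact: measurable_consrV_fiber1.
  by congr (lebesgue_rV _ _ _); apply/seteqP; split => y /=; rewrite consrV0 consrV_tail.
have mG : measurable_fun (setT : set (measurableTypeR R)) G.
  rewrite (_ : G = lebesgue_rV R d \o xsection (@consrV R d @^-1` A)).
    apply: measurable_fun_xsection; apply: measurable_funT_preimage => //; exact: measurable_consrV.
  apply/funext => x /=; congr (lebesgue_rV _ _ _).
  by apply/seteqP; split => y /=; rewrite /xsection/= inE.
have mt : measurable_fun setT ((fun x => s * x + b) : measurableTypeR R -> measurableTypeR R).
  by apply: measurable_funD => //; exact: measurable_funM.
have G0 x : (0 <= G x)%E by [].
rewrite ge0_integralZl_EFin//=; last exact: (measurableT_comp mG mt).
rewrite EFinM -muleA; congr (_ * _)%E.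
rewrite -[LHS]/(\int[lebesgue_measure]_(x in ((fun x => s * x + b)%R : measurableTypeR R -> measurableTypeR R) @^-1` setT) (G \o (fun x => s * x + b)%R) x)%E.
rewrite -(ge0_integral_pushforward mt)//.
have s1 : 0 <= `|s|^-1 by rewrite invr_ge0.
rewrite lebesgue_rVS_fiber1//.
rewrite -(@ge0_integral_mscale _ _ _ (@lebesgue_measure R) setT measurableT (NngNum s1))//.
by apply: eq_measure_integral => B mB _; rewrite /mscale/= /pushforward; exact: lebesgue_measure_affine.
Qed.

Lemma scales_rV_translate d (v : 'rV[R]_d) : scales_rV (fun x => x + v) 1.
Proof.
elim: d v => [v|d IH v].
  rewrite (_ : (fun x => x + v) = id); last by apply/funext => x; rewrite !thinmx0.
  by split => // A mA; rewrite mul1e.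
have := @scales_rVS_lower d _ (fun=> v ord0 ord0) 1 1 ler01 (oner_neq0 _) (measurable_cst _) (IH (rV_tail v)).
rewrite normr1 invr1 mulr1; congr (scales_rV _ _); apply/funext => x.
rewrite [RHS]consrV_eta; congr (consrV (_, _)); first by rewrite mxE mul1r.
by apply/rowP => i; rewrite /rV_tail !mxE.
Qed.

Lemma scales_rV_dilate d (s : R) : 0 < s -> scales_rV (fun x : 'rV[R]_d => s *: x) (s^-1 ^+ d).
Proof.
move=> s0; elim: d => [|d IH].
  rewrite (_ : *:%R s = id); last by apply/funext => x; rewrite !thinmx0.
  by split => // A mA; rewrite mul1e.
have c0 : 0 <= s^-1 ^+ d by rewrite exprn_ge0// invr_ge0 ltW.
have := @scales_rVS_lower d _ (fun=> 0) _ s c0 (lt0r_neq0 s0) (measurable_cst _) IH.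
rewrite gtr0_norm// -exprSr; congr (scales_rV _ _); apply/funext => x.
rewrite [RHS]consrV_eta; congr (consrV (_, _)); first by rewrite mxE addr0.
by apply/rowP => i; rewrite /rV_tail !mxE.
Qed.

End scaling_maps.

Section linear_maps.
Context {R : realType}.

Lemma measurable_mulmxr d e (M : 'M[R]_(d, e)) : measurable_fun setT (fun x : 'rV[R]_d => x *m M).
Proof.
apply: measurable_fun_rV => i.
rewrite (_ : (fun _ => _) = (fun x : 'rV[R]_d => \sum_j x ord0 j * M j i)).
  by apply: measurable_sum => j; apply: measurable_funM => //; exact: measurable_coor.
by apply/funext => x; rewrite mxE.
Qed.

Lemma consrV_mul d (x : 'rV[R]_(1 + d)) (A : 'M[R]_(1 + d)) :
  x *m A = consrV (A ord0 ord0 * x ord0 ord0 + (rV_tail x *m dlsubmx A) ord0 ord0,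
    x ord0 ord0 *: ursubmx A + rV_tail x *m drsubmx A).
Proof.
have e0 : lshift d (ord0 : 'I_1) = ord0 by exact: val_inj.
rewrite -{1}(hsubmxK x) -{1}(submxK A) mul_row_block /consrV; apply: (f_equal2 (@row_mx R 1 1 d)) => /=.
  apply/matrixP => a b; rewrite !ord1 mxE [in RHS]mxE eqxx mulr1n; congr (_ + _).
  by rewrite mxE big_ord1 !mxE mulrC e0.
by rewrite [lsubmx x]mx11_scalar mul_scalar_mx mxE e0.
Qed.

Lemma scales_rV_trig d (A : 'M[R]_d) : is_trig_mx A -> \det A != 0 ->
  scales_rV (fun x => x *m A) (`|\det A|^-1).
Proof.
elim: d A => [A _ _|d IH A].
  rewrite (_ : (fun x => x *m A) = id); last by apply/funext => x; rewrite !thinmx0.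
  by split => // B mB; rewrite det_mx00 normr1 invr1 mul1e.
move: A; rewrite -[d.+1]/(1 + d)%N => A.
rewrite -{1 2}(submxK A) is_trig_block_mx// => /and3P[/eqP ur0 _ tdr].
rewrite ur0 det_lblock mulf_eq0 negb_or {1}[ulsubmx _]mx11_scalar det_scalar1 => /andP[a0 d0].
have detA : \det A = \det (drsubmx A) * A ord0 ord0.
  rewrite -{1}(submxK A) ur0 det_lblock mulrC; congr (_ * _).
  rewrite [ulsubmx _]mx11_scalar det_scalar1 !mxE; congr (A _ _); exact: val_inj.
have a0' : A ord0 ord0 != 0.
  by move: a0; rewrite !mxE; congr (_ != 0); congr (A _ _); exact: val_inj.
rewrite detA normrM invfM.
have mf : measurable_fun setT (fun x : 'rV[R]_d => (x *m dlsubmx A) ord0 ord0 : measurableTypeR R).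
  apply: (measurableT_comp (@measurable_coor R 1 ord0)); exact: measurable_mulmxr.
have := scales_rVS_lower (_ : 0 <= `|\det (drsubmx A)|^-1) a0' mf (IH _ tdr d0).
rewrite invr_ge0 => /(_ (normr_ge0 _)); congr (scales_rV _ _); apply/funext => x.
by rewrite (consrV_mul _ A) ur0 scaler0 add0r.
Qed.

Lemma scales_rV_trig_tr d (A : 'M[R]_d) : is_trig_mx A^T -> \det A != 0 ->
  scales_rV (fun x => x *m A) (`|\det A|^-1).
Proof.
elim: d A => [A _ _|d IH A].
  rewrite (_ : (fun x => x *m A) = id); last by apply/funext => x; rewrite !thinmx0.
  by split => // B mB; rewrite det_mx00 normr1 invr1 mul1e.
move: A; rewrite -[d.+1]/(1 + d)%N => A.
rewrite -{1 2}(submxK A) tr_block_mx is_trig_block_mx// => /and3P[/eqP ur0 _ tdr].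
have {}ur0 : dlsubmx A = 0 by rewrite -[LHS]trmxK ur0 trmx0.
rewrite ur0 det_ublock mulf_eq0 negb_or {1}[ulsubmx _]mx11_scalar det_scalar1 => /andP[a0 d0].
have detA : \det A = \det (drsubmx A) * A ord0 ord0.
  rewrite -{1}(submxK A) ur0 det_ublock mulrC; congr (_ * _).
  rewrite [ulsubmx _]mx11_scalar det_scalar1 !mxE; congr (A _ _); exact: val_inj.
have a0' : A ord0 ord0 != 0.
  by move: a0; rewrite !mxE; congr (_ != 0); congr (A _ _); exact: val_inj.
rewrite detA normrM invfM.
have := @scales_rVS_upper R d (fun t y => t *: ursubmx A + y *m drsubmx A)
  (`|\det (drsubmx A)|^-1) (A ord0 ord0) 0.
rewrite invr_ge0 => /(_ (normr_ge0 _) a0') H.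
have : scales_rV (fun x : 'rV[R]_d.+1 => consrV (A ord0 ord0 * x ord0 ord0 + 0,
     x ord0 ord0 *: ursubmx A + rV_tail x *m drsubmx A))
     (`|\det (drsubmx A)|^-1 * `|A ord0 ord0|^-1).
  apply: H.
    apply: measurable_fun_rV => i.
    rewrite (_ : (fun _ => _) = (fun p : measurableTypeR R * 'rV[R]_d => p.1 * ursubmx A ord0 i
       + (p.2 *m drsubmx A) ord0 i)); last by apply/funext => p; rewrite mxE [X in X + _]mxE.
    apply: measurable_funD; first by apply: measurable_funM.
    apply: (measurableT_comp (@measurable_coor R d i)).
    exact: (measurableT_comp (measurable_mulmxr (drsubmx A)) measurable_snd).
  move=> t; have := scales_rV_comp (scales_rV_translate (t *: ursubmx A)) (IH _ tdr d0).
  by rewrite mulr1; congr (scales_rV _ _); apply/funext => y /=; rewrite addrC.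
congr (scales_rV _ _); apply/funext => x.
by rewrite (consrV_mul _ A) ur0 mulmx0 mxE.
Qed.

Lemma scales_rV_mulmx d (A B : 'M[R]_d) :
  scales_rV (fun x => x *m A) (`|\det A|^-1) -> scales_rV (fun x => x *m B) (`|\det B|^-1) ->
  scales_rV (fun x => x *m (A *m B)) (`|\det (A *m B)|^-1).
Proof.
move=> sA sB; have := scales_rV_comp sB sA.
rewrite det_mulmx normrM invfM; congr (scales_rV _ _); apply/funext => x /=; by rewrite mulmxA.
Qed.

Lemma scales_rV_shear d (i j : 'I_d) (a : R) : i != j ->
  scales_rV (fun x => x *m (1%:M + a *: delta_mx i j)) (`|\det (1%:M + a *: delta_mx i j)|^-1) /\
  \det (1%:M + a *: delta_mx i j : 'M[R]_d) = 1.
Proof.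
move=> ij; pose S := 1%:M + a *: delta_mx i j : 'M[R]_d.
have diagS k : S k k = 1.
  rewrite /S !mxE eqxx; have [->|] := eqVneq k i; last by rewrite mulr0 addr0.
  by rewrite (negbTE ij) mulr0 addr0.
have offS k l : k != l -> (k, l) != (i, j) -> S k l = 0.
  move=> kl klij; rewrite /S !mxE (negbTE kl) add0r (_ : (k == i) && (l == j) = false) ?mulr0//.
  by apply: contra_neqF klij => /andP[/eqP -> /eqP ->].
have [lij|lji] := ltnP i j.
  have t : is_trig_mx S^T.
    apply/is_trig_mxP => k l kl; rewrite mxE; apply: offS; first by rewrite gt_eqF.
    by apply: contraTneq kl => -[-> ->]; rewrite -leqNgt ltnW.
  have d1 : \det S = 1 by rewrite -det_tr det_trig// big1// => k _; rewrite mxE.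
  by split=> //; apply: scales_rV_trig_tr => //; rewrite d1 oner_neq0.
have t : is_trig_mx S.
  apply/is_trig_mxP => k l kl; apply: offS; first by rewrite lt_eqF.
  by apply: contraTneq kl => -[-> ->]; rewrite -leqNgt.
have d1 : \det S = 1 by rewrite det_trig// big1// => k _.
by split=> //; apply: scales_rV_trig => //; rewrite d1 oner_neq0.
Qed.

(* a transposition is a product of three shears and a sign change *)
Lemma scales_rV_tperm d (i j : 'I_d) : i != j ->
  scales_rV (fun x => x *m (tperm_mx i j : 'M[R]_d)) (`|\det (tperm_mx i j : 'M[R]_d)|^-1).
Proof.
move=> ij; have ji : j != i by rewrite eq_sym.
have [s1 _] := @scales_rV_shear d i j 1 ij.
have [s2 _] := @scales_rV_shear d j i (-1) ji.
pose G : 'M[R]_d := diag_mx (\row_k (if k == i then -1 else 1)).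
have GE : G = 1%:M - delta_mx i i *+ 2.
  apply/matrixP => k l; rewrite !mxE; have [->|ki] := eqVneq k i; last by rewrite addr0 subr0.
  by rewrite (eq_sym i l); case: (l == i) => /=; ring.
have tE : tperm_mx i j = ((1%:M + 1 *: delta_mx i j) *m (1%:M + (-1) *: delta_mx j i) *m
     (1%:M + 1 *: delta_mx i j)) *m G :> 'M[R]_d.
  rewrite GE !scale1r scaleN1r.
  have -> : (1%:M + delta_mx i j) *m (1%:M - delta_mx j i) =
      1%:M + delta_mx i j - delta_mx j i - delta_mx i i :> 'M[R]_d.
    by rewrite mulmxDl mul1mx mulmxBr mulmx1 mul_delta_mx; apply/matrixP => k l; rewrite !mxE; ring.
  have -> : (1%:M + delta_mx i j - delta_mx j i - delta_mx i i) *m (1%:M + delta_mx i j) =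
      1%:M + delta_mx i j - delta_mx j i - delta_mx i i - delta_mx j j :> 'M[R]_d.
    rewrite mulmxDr mulmx1 !mulmxBl mulmxDl mul1mx !mul_delta_mx_cond (negbTE ji) !eqxx mulr0n !mulr1n.
    by apply/matrixP => k l; rewrite !mxE; ring.
  rewrite mulmxBr mulmx1 mulr2n mulmxDr !mulmxBl mulmxDl mul1mx !mul_delta_mx_cond (negbTE ji) !eqxx.
  apply/matrixP => k l; rewrite !mxE perm.permE/= (eq_sym _ l).
  have [->|ki] := eqVneq k i.
    rewrite (negbTE ij) (eq_sym i l).
    by case: (l == i); case: (l == j) => /=; ring.
  have [->|kj] := eqVneq k j.
    by rewrite (eq_sym j l); case: (l == i); case: (l == j) => /=; ring.
  by rewrite (eq_sym k l) /=; ring.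
rewrite tE; apply: scales_rV_mulmx; last first.
  apply: scales_rV_trig; last first.
    by rewrite det_diag; apply/prodf_neq0 => k _; rewrite mxE; case: ifP => _; rewrite ?oppr_eq0 oner_neq0.
  by apply/is_trig_mxP => k l kl; rewrite !mxE; have /negbTE -> : k != l by rewrite lt_eqF.
by apply: scales_rV_mulmx => //; apply: scales_rV_mulmx.
Qed.

Lemma scales_rV_perm d (s : perm.perm_of 'I_d) :
  scales_rV (fun x => x *m (perm_mx s : 'M[R]_d)) (`|\det (perm_mx s : 'M[R]_d)|^-1).
Proof.
have [ts -> /allP tsP] := perm.prod_tpermP s.
elim: ts tsP => [|t ts IH] H.
  rewrite big_nil perm_mx1 det1 normr1 invr1 (_ : (fun _ => _) = id); last by apply/funext => x; rewrite mulmx1.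
  by split => // A mA; rewrite mul1e.
rewrite big_cons perm_mxM; apply: scales_rV_mulmx.
  by apply: scales_rV_tperm; exact: (H t (mem_head _ _)).
by apply: IH => u uts; apply: H; rewrite in_cons uts orbT.
Qed.

(** By LUP decomposition: triangular factors are handled by slicing, a permutation is a product of
    transpositions, and the factors multiply like determinants. *)
Theorem scales_rV_unitmx d (A : 'M[R]_d) : A \in unitmx ->
  scales_rV (fun x => x *m A) (`|\det A|^-1).
Proof.
case: d A => [|d] A uA.
  rewrite (_ : (fun x => x *m A) = id); last by apply/funext => x; rewrite !thinmx0.
  by split => // B mB; rewrite det_mx00 normr1 invr1 mul1e.
have := cormen_lup_perm A; have := @cormen_lup_lower _ _ A; have := @cormen_lup_upper _ _ A.
have := cormen_lup_correct A; case: (cormen_lup A) => -[P L] U /= PALU tU tL /is_perm_mxP[s Ps].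
have AE : A = perm_mx (s : {perm 'I_d.+1})^-1%g *m (L *m U).
  by rewrite -[L *m U]PALU Ps -[perm_mx s * A]/(perm_mx s *m A) mulmxA -perm_mxM mulVg perm_mx1 mul1mx.
have dLU : \det (L *m U) != 0.
  move: uA; rewrite AE unitmxE det_mulmx unitrM => /andP[_]; rewrite unitfE//.
move: dLU; rewrite det_mulmx mulf_eq0 negb_or => /andP[dL dU].
rewrite AE; apply: scales_rV_mulmx; first exact: scales_rV_perm.
apply: scales_rV_mulmx.
  by apply: scales_rV_trig => //; apply/is_trig_mxP => k l kl; rewrite tL ?(ltnW kl)// lt_eqF.
by apply: scales_rV_trig_tr => //; apply/is_trig_mxP => k l kl; rewrite mxE tU.
Qed.

End linear_maps.

(** * Bounded sets have finite measure and hyperplanes are null *)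

Section null_and_bounded.
Context {R : realType}.

Lemma consrV_rshift d (x : R) (y : 'rV[R]_d) i : consrV (x, y) ord0 (rshift 1 i) = y ord0 i.
Proof. by rewrite /consrV [LHS](row_mxEr x%:M y). Qed.

Lemma rbox_consrV d (a b : 'rV[R]_d.+1) :
  @consrV R d @^-1` (rbox a b) = `]a ord0 ord0, b ord0 ord0[%classic `*` rbox (rV_tail a) (rV_tail b).
Proof.
apply/seteqP; split => -[x y] /= H.
  split; first by have := H ord0; rewrite consrV0 in_itv.
  by move=> i; have := H (rshift 1 i); rewrite consrV_rshift /rV_tail !mxE.
case: H; rewrite in_itv/= => H1 H2 i; case: (splitP (i : 'I_(1 + d))) => k ik.
  by rewrite (_ : i = ord0) ?consrV0//; apply: val_inj; rewrite /= ik ord1.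
have -> : i = rshift 1 k by exact: val_inj.
by have := H2 k; rewrite consrV_rshift /rV_tail !mxE.
Qed.

Lemma lebesgue_rV_rbox_fin d (a b : 'rV[R]_d) : (lebesgue_rV R d (rbox a b) < +oo)%E.
Proof.
elim: d a b => [|d IH] a b.
  rewrite (_ : rbox a b = setT); last by apply/seteqP; split => // x _ [].
  by rewrite /= diracT ltry.
rewrite /= /lebesgue_rV_step /pushforward rbox_consrV product_measure1E//; last exact: measurable_rbox.
apply: lte_mul_pinfty => //; rewrite ?IH//.
rewrite /= lebesgue_measure_itv/=; by case: ifP.
Qed.

Lemma lebesgue_rV_bounded_fin d (D : set 'rV[R]_d) : measurable D -> bounded_set D ->
  (lebesgue_rV R d D < +oo)%E.
Proof.
move=> mD [M [_ /(_ (M + 1))]]; rewrite ltrDl ltr01 => /(_ isT) MD.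
have {}MD x : D x -> `|x| <= M + 1 by move=> Dx; exact: MD.
have sD : D `<=` rbox (const_mx (- (M + 2))) (const_mx (M + 2)).
  move=> x Dx i; rewrite !mxE -ltr_norml (@le_lt_trans _ _ (M + 1))// ?ltrD2l ?ltr1n//.
  apply: le_trans (MD x Dx).
  rewrite [leRHS]mx_normrE; exact: (le_bigmax _ (fun ij => `|x ij.1 ij.2|) (ord0, i)).
apply: le_lt_trans (lebesgue_rV_rbox_fin (const_mx (- (M + 2))) (const_mx (M + 2))).
by apply: le_measure; rewrite ?inE//; exact: measurable_rbox.
Qed.

Lemma measurable_dotv d (b : 'rV[R]_d) :
  measurable_fun setT (fun x : 'rV[R]_d => dotv b x : measurableTypeR R).
Proof. by apply: measurable_sum => j; apply: measurable_funM => //; exact: measurable_coor. Qed.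

Lemma dotv_consrV d (b : 'rV[R]_d.+1) x y :
  dotv b (consrV (x, y)) = b ord0 ord0 * x + dotv (rV_tail b) y.
Proof.
rewrite /dotv big_ord_recl consrV0; congr (_ + _); apply: eq_bigr => i _.
have -> : lift ord0 i = rshift 1 i by exact: val_inj.
by rewrite consrV_rshift /rV_tail mxE.
Qed.

(** Induction on the dimension. If the tail of [b] is nonzero, each slice at a fixed first
    coordinate is again a hyperplane; otherwise the equation fixes the first coordinate, and slices
    at a fixed tail are single points. *)
Lemma lebesgue_rV_hyperplane0 d (b : 'rV[R]_d) (c : R) : b != 0 ->
  lebesgue_rV R d [set x | dotv b x + c = 0] = 0%E.
Proof.
elim: d b c => [b c|d IH b c b0]; first by rewrite thinmx0 eqxx.
have mH e (b' : 'rV[R]_e) c' : measurable [set x | dotv b' x + c' = 0].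
  rewrite (_ : [set x | _] = (fun x => dotv b' x + c' : measurableTypeR R) @^-1` [set 0])//.
  by apply: measurable_funT_preimage => //; apply: measurable_funD => //; exact: measurable_dotv.
have [b'0|b'0] := eqVneq (rV_tail b) 0; last first.
  rewrite lebesgue_rVS_fiber1// integral0_eq// => x _.
  rewrite -[RHS](IH (rV_tail b) (b ord0 ord0 * x + c) b'0); congr (lebesgue_rV _ _ _).
  by apply/seteqP; split => y /=; rewrite dotv_consrV addrA [dotv _ _ + _]addrC.
have b00 : b ord0 ord0 != 0.
  apply: contra b0 => /eqP b00; rewrite (consrV_eta b) b00 b'0 /consrV/=.
  by apply/eqP/matrixP => i j; rewrite !mxE; case: splitP => k _; rewrite mxE ?mul0rn.
rewrite lebesgue_rVS_fiber2// integral0_eq// => y _.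
rewrite (_ : [set x | _] = [set - c / b ord0 ord0]) ?lebesgue_measure_set1//.
have d0 : dotv 0 y = 0 by rewrite /dotv big1// => i _; rewrite mxE mul0r.
apply/seteqP; split => x /=; rewrite dotv_consrV b'0 d0 addr0.
  by move/eqP; rewrite addr_eq0 => /eqP <-; rewrite mulrAC mulfV// mul1r.
by move=> ->; rewrite mulrC mulfVK// addNr.
Qed.

End null_and_bounded.

(** * Test functions and the fundamental lemma *)

Section flat_exponential.
Context {R : realType}.
Implicit Types (c : R) (p : {poly R}).

(* exp(-c/t) p(1/t) for t > 0, extended by 0: these functions are closed under
   differentiation *)
Definition flatexp c p (t : R) : R := if 0 < t then p.[t^-1] * expR (- c * t^-1) else 0.

Lemma flatexp_bounded c p : 0 < c -> exists M : R, forall t, `|flatexp c p t| <= M.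
Proof.
move=> c0.
have mono n : exists M : R, forall s, 0 < s -> s ^+ n * expR (- c * s) <= M.
  (* A single term of the exponential series suffices: (c s)^n / n! is at most exp(c s). *)
  exists (n`!%:R / c ^+ n) => s s0; case: n => [|n].
    rewrite expr0 mul1r fact0 expr0 invr1 mulr1 -expR0 ler_expR mulNr oppr_le0 ltW// mulr_gt0//.
  have cs0 : 0 <= c * s by rewrite mulr_ge0// ltW.
  have h := expR_ge1Dxn n cs0.
  rewrite mulNr expRN ler_pdivlMr ?exprn_gt0// mulrAC -exprMn [s * c]mulrC ler_pdivrMr ?expR_gt0//.
  have f0 : 0 < (n.+1)`!%:R :> R by rewrite ltr0n fact_gt0.
  rewrite [leRHS]mulrC -ler_pdivrMr//; apply: le_trans h.
  by rewrite lerDr ler01.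
have [M HM] : exists M : nat -> R, forall n s, 0 < s -> s ^+ n * expR (- c * s) <= M n.
  by have [M HM] := choice mono; exists M.
have M0 n : 0 <= M n.
  by apply: le_trans (HM n 1 ltr01); rewrite mulr_ge0 ?expR_ge0// expr1n.
exists (\sum_(i < size p) `|p`_i| * M i) => t; rewrite /flatexp; case: ifPn => t0; last first.
  by rewrite normr0 sumr_ge0// => i _; rewrite mulr_ge0.
rewrite horner_coef mulr_suml (le_trans (ler_norm_sum _ _ _))// ler_sum// => i _.
rewrite !normrM -mulrA ler_wpM2l// (ger0_norm (expR_ge0 _)) normrX gtr0_norm ?invr_gt0//.
by apply: HM; rewrite invr_gt0.
Qed.

(** Writes the function as a bounded factor times t^2, so that its difference quotient at 0 is
    O(t). *)
Lemma flatexpX2 c p t : flatexp c p t = flatexp c (p * 'X^2) t * t ^+ 2.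
Proof.
rewrite /flatexp; case: ifPn => t0; last by rewrite mul0r.
rewrite hornerM hornerXn; field; rewrite gt_eqF//.
Qed.

(** For t > 0, differentiating p(1/t) and exp(-c/t) brings out -p'(1/t)/t^2 and c/t^2, whence the
    polynomial (c p - p') X^2. The only delicate point is t = 0, where [flatexpX2] and
    [flatexp_bounded] give derivative 0. *)
Lemma is_derive_flatexp c p (t : R) : 0 < c ->
  is_derive t (1 : R) (flatexp c p) (flatexp c ((c *: p - p^`()) * 'X^2) t).
Proof.
move=> c0; have [t0|t0|<-] := ltgtP 0 t.
- have eqn : \forall s \near t, (fun s => p.[s^-1] * expR (- c * s^-1)) s = flatexp c p s.
    by near=> s; rewrite /flatexp ifT//; near: s; exact: lt_nbhsr.
  apply: near_eq_is_derive eqn _.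
  have tn0 : t != 0 by rewrite gt_eqF.
  have dV : is_derive t (1 : R) (fun s : R => s^-1) (- t ^- 2 *: 1).
    exact: (@is_deriveV R id t 1 1 tn0 (is_derive_id _ _)).
  have d1 := is_derive1_comp (is_derive_poly p t^-1) dV.
  have dcV : is_derive t (1 : R) (fun s : R => - c * s^-1) _ := is_deriveZ (- c) dV.
  have d2 := @is_derive1_comp R expR (fun s : R => - c * s^-1) t _ _ (is_derive_expR _) dcV.
  apply: is_derive_eq (is_deriveM d1 d2) _.
  rewrite /flatexp t0 !hornerE /GRing.scale/= !mulr1; field; rewrite tn0//.
- have eqn : \forall s \near t, (cst 0 : R -> R) s = flatexp c p s.
    near=> s; rewrite /flatexp ifF//; apply/negbTE; rewrite -leNgt ltW//; near: s; exact: lt_nbhsl.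
  apply: near_eq_is_derive eqn _.
  by rewrite /flatexp ltNge ltW//=; exact: is_derive_cst.
- have [M HM] := flatexp_bounded (p * 'X^2) c0.
  have HM0 : 0 <= M by exact: le_trans (HM 0).
  have z0 q : flatexp c q 0 = 0 by rewrite /flatexp ltxx.
  have cv : h^-1 *: ((flatexp c p \o shift 0) (h *: (1 : R)) - flatexp c p 0) @[h --> 0^'] --> flatexp c ((c *: p - p^`()) * 'X^2) 0.
    rewrite !z0; apply/cvgrPdist_le => e e0; near=> h.
    have h0 : h != 0 by near: h; exact: nbhs_dnbhs_neq.
    rewrite sub0r normrN/= addr0 subr0 flatexpX2.
    rewrite /GRing.scale/= mulr1 mulrCA expr2 [h^-1 * _]mulrA mulVf ?mul1r//.
    rewrite normrM (le_trans (ler_wpM2r _ (HM h)))//.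
    apply: (@le_trans _ _ ((M + 1) * `|h|)); first by rewrite ler_wpM2r// lerDl.
    rewrite mulrC -ler_pdivlMr ?ltr_wpDl//.
    near: h.
    by apply: dnbhs0_le; rewrite divr_gt0// ltr_wpDl.
  split; first by apply/cvg_ex; eexists; exact: cv.
  exact: cvg_lim cv.
Unshelve. all: by end_near. Qed.

Lemma continuous_flatexp c p : 0 < c -> continuous (flatexp c p).
Proof.
by move=> c0 t; apply: differentiable_continuous; apply/derivable1_diffP; have [] := is_derive_flatexp p t c0.
Qed.

Lemma flatexp1_cvg (t : R) : flatexp n.+1%:R^-1 1 t @[n --> \oo] --> ((0 < t)%R%:R : R).
Proof.
rewrite /flatexp; case: (0 < t); last exact: cvg_cst.
under eq_fun do rewrite hornerE mul1r.
have h : (fun n : nat => - n.+1%:R^-1 * t^-1 : R) @ \oo --> - 0 * t^-1.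
  by apply: cvgMl; apply: cvgN; exact: cvg_harmonic.
have -> : true%:R = expR (- 0 / t) :> R by rewrite oppr0 mul0r expR0.
by apply: (continuous_cvg _ (@continuous_expR R _)).
Qed.

Lemma flatexp1_le1 c t : 0 < c -> 0 <= flatexp c 1 t <= 1.
Proof.
move=> c0; rewrite /flatexp; case: ifPn => t0; last by rewrite lexx ler01.
rewrite hornerE mul1r expR_ge0/= -expR0 ler_expR mulNr oppr_le0 mulr_ge0 ?invr_ge0 ?ltW//.
Qed.

End flat_exponential.

Section Ck_closure.
Context {R : realType} {d : nat}.
Implicit Types (phi psi : 'rV[R]_d -> R).

Lemma Ck_continuous k phi : Ck k phi -> continuous phi.
Proof. by case: k => [|k] []. Qed.

Lemma CkS k phi : Ck k.+1 phi -> Ck k phi.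
Proof.
elim: k phi => [|k IH] phi [cphi H]; split => // i.
by have [di ci] := H i; split => //; exact: IH.
Qed.

Lemma Ck_cst k (r : R) : Ck k (fun _ : 'rV[R]_d => r).
Proof.
elim: k r => [|k IH] r; split => //; try exact: cst_continuous.
move=> i; split; first by move=> x; exact: derivable_cst.
rewrite (_ : partial _ _ = fun=> 0); first exact: IH.
by apply/funext => x; rewrite /partial derive_cst.
Qed.

Lemma Ck_add k phi psi : Ck k phi -> Ck k psi -> Ck k (fun x => phi x + psi x).
Proof.
elim: k phi psi => [|k IH] phi psi [c1 H1] [c2 H2].
  by split => // x; apply: continuousD; [exact: c1|exact: c2].
split; first by move=> x; apply: continuousD; [exact: c1|exact: c2].
move=> i; have [d1 k1] := H1 i; have [d2 k2] := H2 i; split.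
  by move=> x; apply: derivableD; [exact: d1|exact: d2].
rewrite (_ : partial _ _ = fun x => partial i phi x + partial i psi x); first exact: IH.
by apply/funext => x; rewrite /partial deriveD.
Qed.

Lemma Ck_mul k phi psi : Ck k phi -> Ck k psi -> Ck k (fun x => phi x * psi x).
Proof.
elim: k phi psi => [|k IH] phi psi H1 H2.
  by split => // x; apply: continuousM; [exact: H1.1|exact: H2.1].
split; first by move=> x; apply: continuousM; [exact: H1.1|exact: H2.1].
move=> i; have [d1 k1] := H1.2 i; have [d2 k2] := H2.2 i; split.
  by move=> x; apply: derivableM; [exact: d1|exact: d2].
rewrite (_ : partial _ _ = fun x => phi x * partial i psi x + psi x * partial i phi x).
  by apply: Ck_add; apply: IH => //; exact: CkS.
by apply/funext => x; rewrite /partial deriveM.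
Qed.

Lemma Ck_prod k (I : Type) (r : seq I) (F : I -> 'rV[R]_d -> R) :
  (forall i, Ck k (F i)) -> Ck k (fun x => \prod_(i <- r) F i x).
Proof.
move=> H; elim: r => [|i r IH].
  by under eq_fun do rewrite big_nil; exact: Ck_cst.
by under eq_fun do rewrite big_cons; exact: Ck_mul.
Qed.

Lemma derive_coord (f : R -> R) (x : 'rV[R]_d) (i : 'I_d) (df : R) :
  is_derive (x ord0 i) (1 : R) f df ->
  is_derive x (delta_mx ord0 i) ((fun y => f (y ord0 i)) : 'rV[R]_d -> R^o) df.
Proof.
move=> [df1 df2].
have E : (fun h : R => h^-1 *: (((fun y : 'rV[R]_d => f (y ord0 i)) \o shift x) (h *: delta_mx ord0 i) - f (x ord0 i))) =
  (fun h : R => h^-1 *: ((f \o shift (x ord0 i)) (h *: (1 : R)) - f (x ord0 i))).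
  by apply/funext => h /=; rewrite !mxE !eqxx.
by split; [rewrite /derivable E|rewrite /derive E].
Qed.

Lemma derive_coord0 (f : R -> R) (x : 'rV[R]_d) (i j : 'I_d) : i != j ->
  is_derive x (delta_mx ord0 j) ((fun y => f (y ord0 i)) : 'rV[R]_d -> R^o) 0.
Proof.
move=> ij.
have E : (fun h : R => h^-1 *: (((fun y : 'rV[R]_d => f (y ord0 i)) \o shift x) (h *: delta_mx ord0 j) - f (x ord0 i))) =
  cst 0.
  by apply/funext => h /=; rewrite !mxE (negbTE ij) andbF mulr0 add0r subrr scaler0.
split; first by rewrite /derivable E; exact: is_cvg_cst.
by rewrite /derive E lim_cst.
Qed.

Lemma Ck_flatexp k (i : 'I_d) c p s a : 0 < c -> Ck k (fun x : 'rV[R]_d => flatexp c p (s * x ord0 i + a)).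
Proof.
move=> c0; elim: k p => [|k IH] p.
  split => // x.
  have ca : {for x, continuous (fun x : 'rV[R]_d => s * x ord0 i + a)}.
    apply: continuousD; last exact: cst_continuous.
    by apply: continuousM; [exact: cst_continuous|exact: coord_continuous].
  by apply: (@continuous_comp _ _ _ (fun x : 'rV[R]_d => s * x ord0 i + a) (flatexp c p)) => //; exact: continuous_flatexp.
split; first exact: Ck_continuous (IH p).
have daff (t : R) : is_derive t (1 : R) (fun y : R => s * y + a) s.
  have := is_deriveD (is_deriveZ s (is_derive_id t (1 : R))) (is_derive_cst a t (1 : R)).
  by rewrite addr0 /GRing.scale/= mulr1.
pose p' := s *: ((c *: p - p^`()) * 'X^2).
have dE (x : 'rV[R]_d) j : is_derive x (delta_mx ord0 j) ((fun x => flatexp c p (s * x ord0 i + a)) : 'rV[R]_d -> R^o)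
    (if i == j then flatexp c p' (s * x ord0 i + a) else 0).
  case: ifPn => [/eqP <-|ij]; last exact: (derive_coord0 (fun t => flatexp c p (s * t + a))).
  apply: (derive_coord (f := fun t => flatexp c p (s * t + a))).
  apply: is_derive_eq (is_derive1_comp (is_derive_flatexp p _ c0) (daff _)) _.
  by rewrite /p' /flatexp; case: ifP => _; rewrite ?mul0r// hornerZ; ring.
move=> j; split; first by move=> x; have [] := dE x j.
rewrite (_ : partial _ _ = if i == j then fun x => flatexp c p' (s * x ord0 i + a) else fun=> 0).
  by case: ifP => _; [exact: IH|exact: Ck_cst].
by apply/funext => x; rewrite /partial; have [_ ->] := dE x j; case: ifP.
Qed.

End Ck_closure.

Section bump.
Context {R : realType} {d : nat}.
Implicit Types (a b : 'rV[R]_d).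

(** As n grows, [flatexp n.+1%:R^-1 1] tends to the indicator of the positive half-line, so the
    products tend to the indicator of the box while their supports stay in [cbox a b]. The factors 1
    and -1 are kept to match the shape [s * x + a] of [Ck_flatexp]. *)
Definition bump a b (n : nat) (x : 'rV[R]_d) : R :=
  \prod_(i < d) (flatexp n.+1%:R^-1 1 (1 * x ord0 i + - a ord0 i) *
                 flatexp n.+1%:R^-1 1 (-1 * x ord0 i + b ord0 i)).

Lemma bump_le1 a b n x : 0 <= bump a b n x <= 1.
Proof.
have n0 : 0 < n.+1%:R^-1 :> R by rewrite invr_gt0.
apply: (big_ind (fun y : R => 0 <= y <= 1)) => [|y z /andP[y0 y1] /andP[z0 z1]|i _].
- by rewrite ler01 lexx.
- by rewrite mulr_ge0//= mulr_ile1.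
have /andP[? ?] := flatexp1_le1 (1 * x ord0 i + - a ord0 i) n0.
have /andP[? ?] := flatexp1_le1 (-1 * x ord0 i + b ord0 i) n0.
by rewrite mulr_ge0//= mulr_ile1.
Qed.

Lemma bump_cvg a b x : bump a b n x @[n --> \oo] --> (\1_(rbox a b) x : R).
Proof.
rewrite (_ : \1_(rbox a b) x = \prod_(i < d) ((0 < 1 * x ord0 i + - a ord0 i)%R%:R * (0 < -1 * x ord0 i + b ord0 i)%R%:R)).
  apply: cvg_big => [|i _]; first exact: mul_continuous.
  by apply: cvgM; exact: flatexp1_cvg.
rewrite indicE; case: (boolP (x \in rbox a b)) => [/set_mem xb|/negP xb].
  by rewrite big1// => i _; have /andP[h1 h2] := xb i; rewrite mul1r subr_gt0 h1 mulN1r addrC subr_gt0 h2 mul1r.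
have [i] : exists i, ~~ (a ord0 i < x ord0 i < b ord0 i).
  apply: contra_notP xb => H; apply/mem_set => i; apply: contra_notT H => ?; by exists i.
rewrite negb_and => H; rewrite (bigD1 i)//= mul1r subr_gt0 mulN1r [- _ + _]addrC subr_gt0.
by case/orP: H => /negbTE ->; rewrite ?mulr0 !mul0r.
Qed.

Lemma closed_cbox a b : closed (cbox a b).
Proof.
rewrite (_ : cbox a b = \bigcap_(i in [set: 'I_d]) ((fun x : 'rV[R]_d => x ord0 i) @^-1` `[a ord0 i, b ord0 i]%classic)).
  apply: closed_bigI => i _; apply: (closed_comp (f := fun x : 'rV[R]_d => x ord0 i)); last exact: itv_closed.
  by move=> x _; exact: coord_continuous.
apply/seteqP; split => x /= H i; first by move=> _ /=; rewrite in_itv/=; exact: H.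
by have := H i I; rewrite /= in_itv.
Qed.

Lemma compact_cbox a b : compact (cbox a b).
Proof.
have := @rV_compact R d (fun i => `[a ord0 i, b ord0 i]%classic) (fun i => @segment_compact R _ _).
congr compact; apply/seteqP; split => x /= H i; have := H i; by rewrite /= in_itv.
Qed.

Lemma bump_test a b n D : cbox a b `<=` D -> test_function D (bump a b n).
Proof.
move=> abD; have n0 : 0 < n.+1%:R^-1 :> R by rewrite invr_gt0.
have sab : tsupport (bump a b n) `<=` cbox a b.
  rewrite /tsupport closureE => x; apply; split; first exact: closed_cbox.
  move=> y /= /negP; apply: contra_notP => ny.
  have [i] : exists i, ~~ (a ord0 i <= y ord0 i <= b ord0 i).
    apply: contra_notP ny => H i; apply: contra_notT H => ?; by exists i.
  rewrite negb_and -!ltNge => H; rewrite /bump (bigD1 i)//= mulf_eq0 /flatexp.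
  rewrite mul1r subr_gt0 mulN1r [- _ + _]addrC subr_gt0 !ltNge.
  by case/orP: H => /ltW ->; rewrite /= ?mulr0 ?mul0r eqxx.
split.
- by move=> k; apply: Ck_prod => i; apply: Ck_mul; exact: Ck_flatexp.
- by apply: subclosed_compact sab; [exact: closed_closure|exact: compact_cbox].
- exact: subset_trans abD.
Qed.

End bump.

Lemma integrable_mul_bounded (disp : measure_display) (T : measurableType disp) (R : realType)
    (mu : {measure set T -> \bar R}) (D : set T) (M : R) (w f : T -> R) : measurable D ->
  mu.-integrable D (EFin \o w) -> measurable_fun D f -> (forall x, D x -> `|f x| <= M) ->
  mu.-integrable D (fun x => (w x * f x)%:E).
Proof.
move=> mD iw mf fM.
have iM : mu.-integrable D (fun x => M%:E * (w x)%:E)%E by exact: integrableZl.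
apply: le_integrable iM => //.
  apply/measurable_EFinP; apply: measurable_funM => //; apply/measurable_EFinP; exact: measurable_int iw.
move=> x Dx; rewrite -EFinM !abse_EFin lee_fin !normrM mulrC ler_wpM2r//.
by apply: le_trans (fM x Dx) _; exact: ler_norm.
Qed.

Lemma rboxI (R : realType) d (a b a' b' : 'rV[R]_d) : rbox a' b' `&` rbox a b =
  rbox (\row_i Num.max (a' ord0 i) (a ord0 i)) (\row_i Num.min (b' ord0 i) (b ord0 i)).
Proof.
apply/seteqP; split => x /= H.
  by move=> i; rewrite !mxE gt_max lt_min; case: H => /(_ i)/andP[-> ->] /(_ i)/andP[-> ->].
by split=> i; have := H i; rewrite !mxE gt_max lt_min => /andP[/andP[? ?] /andP[? ?]]; apply/andP.
Qed.

Section fundamental_lemma.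
Context {R : realType} {d : nat}.
Let mu := lebesgue_rV R d.

(** Boxes are stable under intersection ([rboxI]), so this generator is suited to Dynkin
    induction. *)
Lemma measurable_rV_rbox : @measurable _ 'rV[R]_d = <<s [set A | exists a b, A = @rbox R d a b] >>.
Proof.
set G := (X in <<s X >>).
have oG (D : set 'rV[R]_d) : open D -> <<s G >> D.
  move=> oD; rewrite (open_bigcup_grid oD) bigcup_mkcond.
  apply: (@countable_bigcupT_measurable _ (g_sigma_algebraType G)) => // p.
  case: ifP => _; last exact: (@measurable0 _ (g_sigma_algebraType G)).
  by apply: sub_sigma_algebra; exists (grid_lo p), (grid_hi p).
apply/seteqP; split; last first.
  apply: smallest_sub; first exact: sigma_algebra_measurable.
  by move=> _ [a [b ->]]; exact: measurable_rbox.
apply: smallest_sub; first exact: smallest_sigma_algebra.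
rewrite -bigcup_seq => _ [i /= _] [Y mY <-].
have : measurable_fun setT (fun x : g_sigma_algebraType G => (x : 'rV[R]_d) ord0 i : measurableTypeR R).
  apply: (measurability _ (RGenOpens.measurableE R)) => _ [_ [u [v ->] <-]]; rewrite setTI.
  apply: oG; apply: open_comp; last exact: interval_open.
  by move=> x _; exact: coord_continuous.
exact.
Qed.

(** Bumps converge boundedly to indicators, so [w] has integral 0 over each box whose closure lies
    in [D]. Dynkin induction inside such a box extends this to its measurable subsets, so [w]
    vanishes almost everywhere there, and countably many of these boxes cover [D]. *)
Lemma fundamental_lemma (D : set 'rV[R]_d) (w : 'rV[R]_d -> R) : open D ->
  mu.-integrable D (EFin \o w) ->
  (forall phi, test_function D phi -> ip D w phi = 0) ->
  {ae mu, forall x, D x -> w x = 0}.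
Proof.
move=> oD iw H; have mD := measurable_open oD.
have mw : measurable_fun D (w : _ -> measurableTypeR R) by apply/measurable_EFinP; exact: measurable_int iw.
have box0 a b : cbox a b `<=` D -> (\int[mu]_(x in rbox a b) (w x)%:E = 0)%E.
  move=> abD.
  have rD : rbox a b `<=` D by apply: subset_trans abD => x xb i; have /andP[? ?] := xb i; rewrite !ltW.
  have mb n : measurable_fun setT (bump a b n : _ -> measurableTypeR R).
    apply: measurable_fun_continuous_rV.
    by have [+ _ _] := bump_test n abD => /(_ 0%N)[].
  have [] := @dominated_convergence _ _ _ mu D mD (fun n x => (w x * bump a b n x)%:E)
    (fun x => (w x * \1_(rbox a b) x)%:E) (fun x => `|(w x)%:E|)%E.
  - move=> n; apply/measurable_EFinP; apply: measurable_funM => //; exact: measurable_funTS (mb n).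
  - apply/measurable_EFinP; apply: measurable_funM => //; apply: measurable_funTS; apply: measurable_indic.
    exact: measurable_rbox.
  - apply: aeW => x _; apply: cvg_EFin; first exact: nearW.
    by apply: cvgMr; exact: bump_cvg.
  - exact: integrable_abse.
  - apply: aeW => x n _; rewrite !abse_EFin lee_fin normrM ler_piMr//.
    by case/andP: (bump_le1 a b n x) => ? ?; rewrite ger0_norm.
  move=> _ _; rewrite (_ : [sequence _]_n = cst 0%E); last first.
    apply/funext => n; have := H _ (bump_test n abD); rewrite /ip /Rintegral => E.
    rewrite -[LHS]fineK ?E//; apply: integrable_fin_num => //.
    apply: (@integrable_mul_bounded _ _ _ mu _ 1) => //; first exact: measurable_funTS (mb n).
    by move=> x _; case/andP: (bump_le1 a b n x) => ? ?; rewrite ger0_norm.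
  move/cvg_lim => /(_ (@ereal_hausdorff _)); rewrite lim_cst// => /esym.
  move=> E0; rewrite -(setIidr rD) integral_mkcondr -[RHS]E0.
  by apply: eq_integral => x _; rewrite epatch_indic -EFinM.
have ae0 a b : cbox a b `<=` D -> ae_eq mu (rbox a b) (EFin \o w) (cst 0%E).
  move=> abD.
  have rD : rbox a b `<=` D by apply: subset_trans abD => x xb i; have /andP[? ?] := xb i; rewrite !ltW.
  have mB := measurable_rbox a b.
  have iB : mu.-integrable (rbox a b) (EFin \o w) by exact: integrableS iw.
  apply: integral_ae_eq => // E EB mE; rewrite integral0.
  have : (\int[mu]_(x in E `&` rbox a b) (w x)%:E = 0)%E.
    have := mE; rewrite {1}measurable_rV_rbox; move: E {EB mE}.
    have iE E : measurable E -> mu.-integrable (E `&` rbox a b) (EFin \o w).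
      by move=> mE; apply: integrableS iB => //; exact: measurableI.
    apply: (@dynkin_induction _ 'rV[R]_d _ (fun E => \int[mu]_(x in E `&` rbox a b) (w x)%:E = 0)%E).
    - exact: measurable_rV_rbox.
    - move=> _ _ [a1 [b1 ->]] [a2 [b2 ->]]; rewrite rboxI; by eexists; eexists.
    - by rewrite setTI; exact: box0.
    - move=> _ [a1 [b1 ->]]; rewrite rboxI; apply: box0; apply: subset_trans abD => x xb i.
      by have := xb i; rewrite !mxE ge_max le_min => /andP[/andP[_ ->] /andP[_ ->]].
    - move=> S mS IS; have := box0 _ _ abD.
      rewrite -[X in integral _ X _](setIT (rbox a b)) -(setUv S) setIUr !(setIC (rbox a b)).
      rewrite integral_setU_EFin//; last 4 first.
      + exact: measurableI.
      + by apply: measurableI => //; exact: measurableC.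
      + by rewrite -setIUl setUv setTI; exact: measurable_funS mw.
      + by apply/disj_setPS => x [[Sx _] [nSx _]].
      by rewrite IS add0e.
    - move=> F mF tF IF; rewrite setI_bigcupl integral_bigcup.
      + by rewrite eseries0// => i _ _; exact: IF.
      + by apply/trivIsetP => i j _ _ ij; rewrite setIACA setIid; move/trivIsetP: tF => /(_ i j I I ij) ->; rewrite set0I.
      + by move=> k; exact: measurableI.
      + by rewrite -setI_bigcupl; apply: iE; exact: bigcup_measurable.
  by rewrite setIidl.
(* The grid boxes are enumerated by natural numbers so that the countably many exceptional null sets
   can be united. *)
pose Q n := if @unpickle (nat * 'rV[int]_d)%type n is Some p then
  (if asbool (cbox (@grid_lo R d p) (grid_hi p) `<=` D) then rbox (@grid_lo R d p) (grid_hi p) else set0) else set0.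
have : {ae mu, forall x, forall n, Q n x -> w x = 0}.
  apply: ae_foralln => n; rewrite /Q; case: unpickle => [p|]; last exact: aeW.
  case: asboolP => [pD|_]; last exact: aeW.
  by have := ae0 _ _ pD; apply: filterS => x /= + xb => /(_ xb) [].
apply: filterS => x Qx; rewrite {1}(open_bigcup_grid oD) => -[p /= pD px].
by apply: (Qx (pickle p)); rewrite /Q pickleK; case: asboolP.
Qed.

End fundamental_lemma.

(** * Weak derivatives *)

Section L2_algebra.
Context {R : realType} {d : nat}.
Variable D : set 'rV[R]_d.
Hypotheses (oD : open D) (bD : bounded_set D).
Let mu := lebesgue_rV R d.
Implicit Types (v w : 'rV[R]_d -> R).

Lemma measurable_domain : measurable D. Proof. exact: measurable_open. Qed.
Let mD := measurable_domain.

Lemma domain_fin : (mu D < +oo)%E. Proof. exact: lebesgue_rV_bounded_fin. Qed.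

Lemma L2_measurable v : L2 D v -> measurable_fun D v. Proof. by case. Qed.

Lemma L2_sqr_integrable v : L2 D v -> mu.-integrable D (fun x => (v x ^+ 2)%:E).
Proof.
move=> [mv fv]; apply/integrableP; split.
  by apply/measurable_EFinP; exact: measurable_funX.
by under eq_integral do rewrite gee0_abs ?lee_fin ?sqr_ge0//.
Qed.

Lemma L2_mul_integrable v w : L2 D v -> L2 D w -> mu.-integrable D (fun x => (v x * w x)%:E).
Proof.
move=> Lv Lw.
have i2 : mu.-integrable D (fun x => (v x ^+ 2)%:E + (w x ^+ 2)%:E)%E.
  by apply: integrableD => //; exact: L2_sqr_integrable.
apply: le_integrable i2 => //.
  by apply/measurable_EFinP; apply: measurable_funM; exact: L2_measurable.
move=> x Dx; rewrite -EFinD !abse_EFin lee_fin normrM [leRHS]ger0_norm ?addr_ge0 ?sqr_ge0//.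
rewrite -(real_normK (num_real (v x))) -(real_normK (num_real (w x))).
have := sqr_ge0 (`|v x| - `|w x|); have := normr_ge0 (v x); have := normr_ge0 (w x); nra.
Qed.

Lemma L2_bounded v (M : R) : measurable_fun D v -> (forall x, D x -> `|v x| <= M) -> L2 D v.
Proof.
move=> mv vM; split => //; apply: (@le_lt_trans _ _ (\int[mu]_(x in D) (M ^+ 2)%:E)%E).
  apply: ge0_le_integral => //.
  - by move=> x _; rewrite lee_fin sqr_ge0.
  - by apply/measurable_EFinP; exact: measurable_funX.
  move=> x Dx; rewrite lee_fin -(real_normK (num_real (v x))) lerXn2r ?nnegrE//; last exact: vM.
  by rewrite (le_trans _ (vM x Dx)).
by rewrite integral_cst//= lte_mul_pinfty ?lee_fin ?sqr_ge0//; exact: domain_fin.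
Qed.

Lemma L2_cst (r : R) : L2 D (fun=> r).
Proof. by apply: (@L2_bounded _ `|r|). Qed.

Lemma L2_integrable v : L2 D v -> mu.-integrable D (EFin \o v).
Proof.
move=> Lv; have := L2_mul_integrable Lv (L2_cst 1).
by under eq_fun do rewrite mulr1.
Qed.

Lemma L2_lin (a : R) v w : L2 D v -> L2 D w -> L2 D (fun x => a * v x + w x).
Proof.
move=> Lv Lw; have mm : measurable_fun D (fun x => a * v x + w x).
  by apply: measurable_funD; [apply: measurable_funM => //|]; exact: L2_measurable.
split => //.
have i2 : mu.-integrable D (fun x => (2 * a ^+ 2)%:E * (v x ^+ 2)%:E + 2%:E * (w x ^+ 2)%:E)%E.
  by apply: integrableD => //; apply: integrableZl => //; exact: L2_sqr_integrable.
have : mu.-integrable D (fun x => ((a * v x + w x) ^+ 2)%:E).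
  apply: le_integrable i2 => //; first by apply/measurable_EFinP; exact: measurable_funX.
  move=> x Dx; rewrite -!EFinM -EFinD !abse_EFin lee_fin ger0_norm ?sqr_ge0// ger0_norm; last first.
    by have := sqr_ge0 (a * v x); have := sqr_ge0 (w x); nra.
  by have := sqr_ge0 (a * v x - w x); nra.
by move/integrableP => [_]; under eq_integral do rewrite abse_EFin ger0_norm ?sqr_ge0//.
Qed.

Lemma L2_sum (I : Type) (r : seq I) (c : I -> R) (v : I -> 'rV[R]_d -> R) :
  (forall i, L2 D (v i)) -> L2 D (fun x => \sum_(i <- r) c i * v i x).
Proof.
move=> H; elim: r => [|i r IH].
  by under eq_fun do rewrite big_nil; exact: L2_cst.
by under eq_fun do rewrite big_cons; exact: L2_lin.
Qed.

Lemma ipC v w : ip D v w = ip D w v.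
Proof. by apply: eq_Rintegral => x _; rewrite mulrC. Qed.

Lemma ip_linl (a : R) v v' w : L2 D v -> L2 D v' -> L2 D w ->
  ip D (fun x => a * v x + v' x) w = a * ip D v w + ip D v' w.
Proof.
move=> Lv Lv' Lw; have i1 := L2_mul_integrable Lv Lw; have i2 := L2_mul_integrable Lv' Lw.
rewrite /ip -RintegralZl// -RintegralD//; last first.
  by have := integrableZl mD a i1; congr (integrable _ _ _).
by apply: eq_Rintegral => x _; ring.
Qed.

Lemma ip_eq v v' w w' : (forall x, D x -> v x = v' x) -> (forall x, D x -> w x = w' x) ->
  ip D v w = ip D v' w'.
Proof. by move=> vv ww; apply: eq_Rintegral => x /set_mem Dx; rewrite vv// ww. Qed.

Lemma ip_suml (I : Type) (r : seq I) (c : I -> R) (v : I -> 'rV[R]_d -> R) w :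
  (forall i, L2 D (v i)) -> L2 D w ->
  ip D (fun x => \sum_(i <- r) c i * v i x) w = \sum_(i <- r) c i * ip D (v i) w.
Proof.
move=> H Lw; elim: r => [|i r IH].
  rewrite big_nil /ip; under eq_Rintegral do rewrite big_nil mul0r.
  by rewrite Rintegral_cst// mul0r.
rewrite big_cons -IH -ip_linl//; last exact: L2_sum.
by apply: ip_eq => // x _; rewrite big_cons.
Qed.

Lemma ip_ge0 v : 0 <= ip D v v.
Proof. by apply: Rintegral_ge0 => x _; rewrite -expr2 sqr_ge0. Qed.

Lemma ip_ae v v' w : L2 D v -> L2 D v' -> L2 D w ->
  {ae mu, forall x, D x -> v x = v' x} -> ip D v w = ip D v' w.
Proof.
move=> Lv Lv' Lw vv; congr fine; apply: ae_eq_integral => //.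
- exact: measurable_int (L2_mul_integrable Lv Lw).
- exact: measurable_int (L2_mul_integrable Lv' Lw).
- by apply: filterS vv => x H Dx; rewrite H.
Qed.

Lemma measurable_test phi : test_function D phi -> measurable_fun setT phi.
Proof. by move=> [/(_ 0%N)[? _] _ _]; exact: measurable_fun_continuous_rV. Qed.

Lemma tsupport_out (phi : 'rV[R]_d -> R) x : ~ tsupport phi x -> phi x = 0.
Proof. by move=> H; apply: contra_notP H => /eqP H; apply: subset_closure. Qed.

Lemma compact_bounded_fun (phi : 'rV[R]_d -> R) K : continuous phi -> compact K ->
  (forall x, ~ K x -> phi x = 0) -> exists M, forall x, `|phi x| <= M.
Proof.
move=> cphi cK K0.
have := compact_bounded (continuous_compact (continuous_subspaceT cphi) cK).
move=> [M [_ /(_ (M + 1))]]; rewrite ltrDl ltr01 => /(_ isT) MD.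
exists (`|M + 1|) => x; have [Kx|/K0 ->] := pselect (K x); last by rewrite normr0.
by apply: le_trans (MD (phi x) _) (ler_norm _); exists x.
Qed.

Lemma test_bounded phi : test_function D phi -> exists M, forall x, `|phi x| <= M.
Proof.
move=> [/(_ 0%N)[cphi _] cK _]; apply: (compact_bounded_fun cphi cK).
exact: tsupport_out.
Qed.

Lemma continuous_partial_test phi i : test_function D phi -> continuous (partial i phi).
Proof. by move=> [/(_ 1%N)[_ /(_ i)[_ []]]]. Qed.

Lemma partial_test_out (phi : 'rV[R]_d -> R) i x : ~ tsupport phi x -> partial i phi x = 0.
Proof.
move=> H; rewrite /partial -[RHS](@derive_cst R _ R^o (0 : R) x (delta_mx ord0 i)).
apply: near_eq_derive; near=> y; apply: tsupport_out; near: y.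
by apply: open_nbhs_nbhs; split => //; apply: closed_openC; exact: closed_closure.
Unshelve. all: by end_near. Qed.

Lemma partial_test_bounded phi i : test_function D phi -> exists M : R, forall x, `|partial i phi x| <= M.
Proof.
move=> tphi; have [_ cK _] := tphi.
have [M HM] := @compact_bounded_fun (partial i phi) (tsupport phi) (@continuous_partial_test phi i tphi) cK
  (fun x => @partial_test_out phi i x).
by exists M => x; exact: HM.
Qed.

Lemma L2_test phi : test_function D phi -> L2 D phi.
Proof.
move=> tphi; have [M HM] := test_bounded tphi; apply: (@L2_bounded _ M) => //.
by apply: measurable_funTS; exact: measurable_test.
Qed.

Lemma L2_partial_test phi i : test_function D phi -> L2 D (partial i phi).
Proof.
move=> tphi; have [M HM] := partial_test_bounded i tphi; apply: (@L2_bounded _ M) => //.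
by apply: measurable_funTS; apply: measurable_fun_continuous_rV; exact: continuous_partial_test.
Qed.

Lemma weak_partial_unique i v w w' : weak_partial D i v w -> weak_partial D i v w' ->
  {ae mu, forall x, D x -> w x = w' x}.
Proof.
move=> [Lw Hw] [Lw' Hw'].
have : {ae mu, forall x, D x -> -1 * w' x + w x = 0}.
  apply: fundamental_lemma => //; first by apply: L2_integrable; exact: L2_lin.
  move=> phi tphi; rewrite ip_linl//; last exact: L2_test.
  by rewrite mulN1r addrC; apply/eqP; rewrite subr_eq0 -eqr_opp -Hw// Hw'.
by apply: filterS => x H Dx; apply/eqP; rewrite -subr_eq0 addrC -mulN1r H.
Qed.

Lemma weak_partial_lin i (a : R) v v' w w' : L2 D v -> L2 D v' ->
  weak_partial D i v w -> weak_partial D i v' w' ->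
  weak_partial D i (fun x => a * v x + v' x) (fun x => a * w x + w' x).
Proof.
move=> Lv Lv' [Lw Hw] [Lw' Hw']; split; first exact: L2_lin.
move=> phi tphi; have Lp := L2_partial_test i tphi; have Lt := L2_test tphi.
by rewrite !ip_linl// Hw// Hw'//; ring.
Qed.

Lemma weak_partial_eq i v v' w : (forall x, D x -> v x = v' x) ->
  weak_partial D i v w -> weak_partial D i v' w.
Proof.
by move=> vv' [Lw H]; split => // phi tphi; rewrite -H//; apply: ip_eq => // x Dx; rewrite vv'.
Qed.

Lemma wpartialP i v w : weak_partial D i v w -> weak_partial D i v (wpartial D i v).
Proof. by move=> H; rewrite /wpartial; case: xgetP => // /(_ w). Qed.

Lemma wpartial_ae i v w : weak_partial D i v w -> {ae mu, forall x, D x -> wpartial D i v x = w x}.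
Proof. by move=> H; exact: weak_partial_unique (wpartialP H) H. Qed.

Lemma Hs1P v : Hs D 1 v <-> L2 D v /\ forall i, weak_partial D i v (wpartial D i v).
Proof.
split => [[Lv H]|[Lv H]]; split => // i.
  by have [w [Hw _]] := H i; exact: wpartialP Hw.
by exists (wpartial D i v); split => //; have [? _] := H i; split.
Qed.

Lemma Hs1_lin (a : R) v v' : Hs D 1 v -> Hs D 1 v' -> Hs D 1 (fun x => a * v x + v' x).
Proof.
move=> /Hs1P[Lv Hv] /Hs1P[Lv' Hv']; split; first exact: L2_lin.
move=> i; eexists; split; first exact: weak_partial_lin.
by split => //; have [? _] := Hv i; have [? _] := Hv' i; exact: L2_lin.
Qed.

Lemma ip_wpartial i j v w b c : weak_partial D i v b -> weak_partial D j w c ->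
  ip D (wpartial D i v) (wpartial D j w) = ip D b c.
Proof.
move=> Hb Hc; have [Lb' _] := wpartialP Hb; have [Lc' _] := wpartialP Hc.
have [Lb _] := Hb; have [Lc _] := Hc.
rewrite (ip_ae Lb' Lb)//; last exact: wpartial_ae.
by rewrite ipC (ip_ae Lc' Lc)//; [exact: ipC|exact: wpartial_ae].
Qed.

Lemma ip_gradE v w b c : (forall i, weak_partial D i v (b i)) -> (forall i, weak_partial D i w (c i)) ->
  ip_grad D v w = \sum_i ip D (b i) (c i).
Proof. by move=> Hb Hc; apply: eq_bigr => i _; exact: ip_wpartial. Qed.

Lemma ip_gradC v w : ip_grad D v w = ip_grad D w v.
Proof. by apply: eq_bigr => i _; exact: ipC. Qed.

Lemma ip_grad_linl (a : R) v v' w : Hs D 1 v -> Hs D 1 v' -> Hs D 1 w ->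
  ip_grad D (fun x => a * v x + v' x) w = a * ip_grad D v w + ip_grad D v' w.
Proof.
move=> /Hs1P[Lv Hv] /Hs1P[Lv' Hv'] /Hs1P[Lw Hw].
rewrite (@ip_gradE _ _ (fun i x => a * wpartial D i v x + wpartial D i v' x) (fun i => wpartial D i w))//; last first.
  by move=> i; exact: weak_partial_lin.
rewrite /ip_grad mulr_sumr -big_split/=; apply: eq_bigr => i _.
by rewrite ip_linl//; [case: (Hv i)|case: (Hv' i)|case: (Hw i)].
Qed.

Lemma ip_grad_ge0 v : 0 <= ip_grad D v v.
Proof. by apply: sumr_ge0 => i _; exact: ip_ge0. Qed.

Lemma ip_grad_eq v v' w w' : (forall x, D x -> v x = v' x) -> (forall x, D x -> w x = w' x) ->
  Hs D 1 v -> Hs D 1 w -> ip_grad D v w = ip_grad D v' w'.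
Proof.
move=> vv ww /Hs1P[Lv Hv] /Hs1P[Lw Hw]; 
apply: (esym (@ip_gradE v' w' (fun i => wpartial D i v) (fun i => wpartial D i w) _ _)).
  by move=> i; exact: weak_partial_eq (Hv i).
by move=> i; exact: weak_partial_eq (Hw i).
Qed.

Lemma Hs1_cst0 : Hs D 1 (fun=> 0).
Proof.
split; first exact: L2_cst.
move=> i; exists (fun=> 0); split; last by split => //; exact: L2_cst.
split; first exact: L2_cst.
have z phi : ip D (fun=> 0) phi = 0.
  by rewrite /ip; under eq_Rintegral do rewrite mul0r; rewrite Rintegral_cst// mul0r.
by move=> phi tphi; rewrite !z oppr0.
Qed.

Lemma Hs1_sum (I : Type) (r : seq I) (c : I -> R) (v : I -> 'rV[R]_d -> R) :
  (forall i, Hs D 1 (v i)) -> Hs D 1 (fun x => \sum_(i <- r) c i * v i x).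
Proof.
move=> H; elim: r => [|i r IH].
  by under eq_fun do rewrite big_nil; exact: Hs1_cst0.
by under eq_fun do rewrite big_cons; exact: Hs1_lin.
Qed.

Lemma ip_grad_suml (I : Type) (r : seq I) (c : I -> R) (v : I -> 'rV[R]_d -> R) w :
  (forall i, Hs D 1 (v i)) -> Hs D 1 w ->
  ip_grad D (fun x => \sum_(i <- r) c i * v i x) w = \sum_(i <- r) c i * ip_grad D (v i) w.
Proof.
move=> H Lw; elim: r => [|i r IH].
  (* Writing zero as -1 * 0 + 0 lets linearity give -z + z, hence 0, whichever representatives
     [wpartial] has chosen. *)
  have z : ip_grad D (fun=> -1 * 0 + 0) w = 0.
    by rewrite (ip_grad_linl (-1) Hs1_cst0 Hs1_cst0 Lw) mulN1r addNr.
  rewrite big_nil -[in RHS]z; suff -> : (fun x => \sum_(i <- [::]) c i * v i x) = (fun=> -1 * 0 + 0) by [].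
  by apply/funext => x; rewrite big_nil mulr0 addr0.
have -> : (fun x => \sum_(j <- i :: r) c j * v j x) = (fun x => c i * v i x + \sum_(j <- r) c j * v j x).
  by apply/funext => x; rewrite big_cons.
by rewrite big_cons (ip_grad_linl (c i) (H i) (Hs1_sum r c H) Lw) IH.
Qed.

End L2_algebra.

(** * Barycentric coordinates *)

Section barycentric.
Context {R : realType} {d : nat}.
Variable M : mesh R d.
Local Notation idx := 'I_(nb_nodes M).
Implicit Types (K : {set idx}) (i j k l : idx) (x : 'rV[R]_d).

Lemma dotvDr (b x y : 'rV[R]_d) : dotv b (x + y) = dotv b x + dotv b y.
Proof. by rewrite /dotv -big_split/=; apply: eq_bigr => i _; rewrite mxE mulrDr. Qed.

Lemma dotvZr (b x : 'rV[R]_d) a : dotv b (a *: x) = a * dotv b x.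
Proof. by rewrite /dotv mulr_sumr; apply: eq_bigr => i _; rewrite mxE mulrCA. Qed.

Lemma dotvC (b x : 'rV[R]_d) : dotv b x = dotv x b.
Proof. by apply: eq_bigr => i _; rewrite mulrC. Qed.

Lemma dotvDl (b x y : 'rV[R]_d) : dotv (x + y) b = dotv x b + dotv y b.
Proof. by rewrite !(dotvC _ b) dotvDr. Qed.

Lemma dotvZl (b x : 'rV[R]_d) a : dotv (a *: x) b = a * dotv x b.
Proof. by rewrite !(dotvC _ b) dotvZr. Qed.

Lemma dotv0l (x : 'rV[R]_d) : dotv 0 x = 0.
Proof. by rewrite -(scale0r 0) dotvZl mul0r. Qed.

Lemma dotv0r (x : 'rV[R]_d) : dotv x 0 = 0.
Proof. by rewrite dotvC dotv0l. Qed.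

Lemma dotvNr (b x : 'rV[R]_d) : dotv b (- x) = - dotv b x.
Proof. by rewrite -scaleN1r dotvZr mulN1r. Qed.

Lemma dotvNl (b x : 'rV[R]_d) : dotv (- b) x = - dotv b x.
Proof. by rewrite dotvC dotvNr dotvC. Qed.

Lemma dotv_suml (I : Type) (r : seq I) (P : pred I) (F : I -> 'rV[R]_d) x :
  dotv (\sum_(i <- r | P i) F i) x = \sum_(i <- r | P i) dotv (F i) x.
Proof.
by elim/big_rec2: _ => [|i y z _ <-]; rewrite ?dotv0l// dotvDl.
Qed.

Lemma dotv_sumr (I : Type) (r : seq I) (P : pred I) (F : I -> 'rV[R]_d) x :
  dotv x (\sum_(i <- r | P i) F i) = \sum_(i <- r | P i) dotv x (F i).
Proof. by rewrite dotvC dotv_suml; apply: eq_bigr => i _; rewrite dotvC. Qed.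

Lemma dotv_ge0 x : 0 <= dotv x x.
Proof. by apply: sumr_ge0 => i _; rewrite -expr2 sqr_ge0. Qed.

Lemma dotv_eq0 x : dotv x x = 0 -> x = 0.
Proof.
move=> /eqP; rewrite psumr_eq0 => [/allP H|i _]; last by rewrite -expr2 sqr_ge0.
apply/rowP => i; have := H i (mem_index_enum _); rewrite mxE.
by rewrite -expr2 sqrf_eq0 => /eqP.
Qed.

Lemma dotv_delta x (j : 'I_d) : dotv x (delta_mx ord0 j) = x ord0 j.
Proof.
rewrite /dotv (bigD1 j)//= mxE !eqxx mulr1 big1 ?addr0// => i ij.
by rewrite mxE (negbTE ij) andbF mulr0.
Qed.

(* the affine map sending barycentric coordinates on K to points, in homogeneous coordinates *)
Definition vertex_mx K : 'M[R]_(#|K|, 1 + d) :=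
  \matrix_(r < #|K|) row_mx 1%:M (node (enum_val r)).

(** The gradient of the barycentric coordinate [k] on [K], read off the inverse of [vertex_mx K].
    The sum has one term if [k] is in [K] and none otherwise, so coordinates at foreign vertices are
    0 by construction. *)
Definition lamb K k : 'rV[R]_d :=
  \row_j \sum_(r < #|K| | enum_val r == k) pinvmx (vertex_mx K) (rshift 1 j) r.

Definition lamc K k : R :=
  \sum_(r < #|K| | enum_val r == k) pinvmx (vertex_mx K) (lshift d ord0) r.

Definition lam K k x : R := dotv (lamb K k) x + lamc K k.

Lemma mx11_1 : (1%:M : 'M[R]_1) ord0 ord0 = 1.
Proof. by rewrite mxE eqxx. Qed.

Lemma lam_enum_val K (r : 'I_#|K|) x :
  lam K (enum_val r) x = (row_mx 1%:M x *m pinvmx (vertex_mx K)) ord0 r.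
Proof.
have E F : \sum_(s < #|K| | enum_val s == enum_val r) F s = F r :> R.
  by rewrite (big_pred1 r)// => s; rewrite (inj_eq enum_val_inj).
rewrite /lam /lamc E [RHS]mxE (@big_split_ord _ _ _ 1 d)/= big_ord1 row_mxEl mx11_1 mul1r addrC.
by congr (_ + _); apply: eq_bigr => j _; rewrite row_mxEr mxE E mulrC.
Qed.

Lemma lamb_out K k : k \notin K -> lamb K k = 0.
Proof.
move=> kK; apply/rowP => j; rewrite !mxE big1// => r /eqP rk; move: kK; by rewrite -rk enum_valP.
Qed.

Lemma lam_out K k x : k \notin K -> lam K k x = 0.
Proof.
move=> kK; rewrite /lam lamb_out// dotv0l add0r /lamc big1// => r /eqP rk; move: kK; by rewrite -rk enum_valP.
Qed.

Lemma lamD K k x y : lam K k (x + y) = lam K k x + dotv (lamb K k) y.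
Proof. by rewrite /lam dotvDr; ring. Qed.

Section cell.
Variable K : {set idx}.
Hypotheses (cK : #|K| = d.+1) (aK : affinely_independent K).

Lemma vertex_mx_full : row_full (vertex_mx K).
Proof.
suff /eqP rf : row_free (vertex_mx K) by rewrite /row_full rf cK.
apply: inj_row_free => v vB.
have vE (r : 'I_#|K|) : v ord0 r = 0; last by apply/rowP => r; rewrite vE mxE.
have H := aK (c := fun k => \sum_(s < #|K| | enum_val s == k) v ord0 s).
have E (s : 'I_#|K|) : \sum_(t < #|K| | enum_val t == enum_val s) v ord0 t = v ord0 s.
  by rewrite (big_pred1 s)// => t; rewrite (inj_eq enum_val_inj).
rewrite -E; apply: H (enum_valP r).
  rewrite big_enum_val/=; under eq_bigr do rewrite E.
  have vB0 : (v *m vertex_mx K) ord0 (lshift d ord0) = 0 by rewrite vB mxE.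
  apply: etrans vB0; rewrite mxE.
  by apply: eq_bigr => s _; rewrite !mxE (unsplitK (inl _)) mxE eqxx mulr1.
rewrite big_enum_val/=; under eq_bigr do rewrite E.
apply/rowP => j; have vBj : (v *m vertex_mx K) ord0 (rshift 1 j) = 0 by rewrite vB mxE.
rewrite [RHS]mxE; apply: etrans vBj; rewrite mxE.
by rewrite summxE; apply: eq_bigr => s _; rewrite !mxE (unsplitK (inr _)).
Qed.

Lemma lam_mul x : row_mx 1%:M x *m pinvmx (vertex_mx K) *m vertex_mx K = row_mx 1%:M x.
Proof. by apply: mulmxKpV; exact: submx_full vertex_mx_full. Qed.

Lemma lam_sum x : \sum_(k in K) lam K k x = 1.
Proof.
rewrite big_enum_val/=; under eq_bigr do rewrite lam_enum_val.
have := congr1 (fun A : 'rV[R]_(1 + d) => A ord0 (lshift d ord0)) (lam_mul x).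
rewrite row_mxEl [X in _ = X]mxE eqxx => E; apply: etrans E; rewrite mxE; apply: eq_bigr => r _.
by rewrite [vertex_mx _ _ _]mxE row_mxEl mx11_1 mulr1.
Qed.

Lemma lam_comb x : \sum_(k in K) lam K k x *: node k = x.
Proof.
rewrite big_enum_val/=; under eq_bigr do rewrite lam_enum_val.
apply/rowP => j; have := congr1 (fun A : 'rV[R]_(1 + d) => A ord0 (rshift 1 j)) (lam_mul x).
rewrite row_mxEr => E; rewrite -[RHS]E mxE summxE; apply: eq_bigr => r _.
by rewrite mxE [vertex_mx _ _ _]mxE row_mxEr.
Qed.

Lemma lam_uniq (a : idx -> R) x : \sum_(k in K) a k = 1 -> \sum_(k in K) a k *: node k = x ->
  forall k, k \in K -> a k = lam K k x.
Proof.
move=> a1 ax k kK; apply/eqP; rewrite -subr_eq0; apply/eqP; move: k kK.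
apply: aK; first by rewrite sumrB a1 lam_sum subrr.
under eq_bigr do rewrite scalerBl; by rewrite sumrB ax lam_comb subrr.
Qed.

Lemma lam_node k l : k \in K -> l \in K -> lam K k (node l) = (k == l)%:R.
Proof.
move=> kK lK; apply/esym; apply: (lam_uniq (a := fun k => (k == l)%:R)) kK.
  by rewrite (bigD1 l)//= eqxx big1 ?addr0// => i /andP[_ /negbTE ->].
by rewrite (bigD1 l)//= eqxx scale1r big1 ?addr0// => i /andP[_ /negbTE ->]; rewrite scale0r.
Qed.

Lemma simplexP x : simplex K x <-> forall k, k \in K -> 0 <= lam K k x.
Proof.
split => [[c [c0 c1 cx]] k kK|H]; first by rewrite -(lam_uniq c1 (esym cx))// c0.
by exists (lam K ^~ x); split => //; rewrite ?lam_sum ?lam_comb.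
Qed.

Lemma simplex_node k : k \in K -> simplex K (node k).
Proof. by move=> kK; apply/simplexP => l lK; rewrite lam_node// ler0n. Qed.

Lemma affine_lam (u : 'rV[R]_d -> R) b c : (forall x, simplex K x -> u x = dotv b x + c) ->
  forall x, simplex K x -> u x = \sum_(k in K) u (node k) * lam K k x.
Proof.
move=> H x Kx; rewrite H//.
rewrite [RHS](eq_bigr (fun k => dotv b (node k) * lam K k x + c * lam K k x)); last first.
  by move=> k kK; rewrite H ?mulrDl//; exact: simplex_node.
rewrite big_split/= -mulr_sumr lam_sum mulr1; congr (_ + _).
by rewrite -{1}(lam_comb x) dotv_sumr; apply: eq_bigr => k kK; rewrite dotvZr mulrC.
Qed.

Lemma lam_le1 x k : simplex K x -> lam K k x <= 1.
Proof.
move=> /simplexP Kx; have [kK|kK] := boolP (k \in K); last by rewrite lam_out.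
by rewrite -(lam_sum x) (bigD1 k)//= lerDl sumr_ge0// => i /andP[iK _]; exact: Kx.
Qed.

Lemma lamb_neq0 k : (0 < d)%N -> k \in K -> lamb K k != 0.
Proof.
move=> d0 kK; have : (1 < #|K|)%N by rewrite cK ltnS.
rewrite (cardsD1 k) kK ltnS => /card_gt0P[l]; rewrite !inE => /andP[lk lK].
apply/eqP => b0; have := lam_node kK lK; have := lam_node kK kK.
by rewrite /lam b0 !dotv0l eqxx eq_sym (negbTE lk) => -> /eqP; rewrite oner_eq0.
Qed.

End cell.

Definition ocell K : set 'rV[R]_d := [set x | forall k, k \in K -> 0 < lam K k x].

Lemma continuous_dotv (b : 'rV[R]_d) : continuous (dotv b).
Proof.
rewrite (_ : dotv b = fun x => \sum_i b ord0 i * x ord0 i)//.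
elim: (index_enum _) => [|i r IH].
  by under eq_fun do rewrite big_nil; exact: cst_continuous.
under eq_fun do rewrite big_cons.
move=> x; apply: (@continuousD _ _ _ (fun x : 'rV[R]_d => b ord0 i * x ord0 i)); last exact: IH.
by apply: continuousM; [exact: cst_continuous|exact: coord_continuous].
Qed.

Lemma continuous_lam K k : continuous (lam K k).
Proof. by move=> x; apply: continuousD; [exact: continuous_dotv|exact: cst_continuous]. Qed.

Lemma open_ocell K : open (ocell K).
Proof.
rewrite (_ : ocell K = \big[setI/setT]_(k in K) (lam K k @^-1` `]0, +oo[%classic)).
  elim/big_ind: _ => [|A B|k _]; [exact: openT|exact: openI|].
  by apply: open_comp => [x _|]; [exact: continuous_lam|exact: interval_open].
rewrite -bigcap_seq_cond; apply/seteqP; split => x /= H k.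
  by move=> /andP[_ kK] /=; rewrite in_itv/= andbT H.
by move=> kK; have := H k; rewrite /= in_itv/= andbT kK mem_index_enum; apply.
Qed.

Lemma measurable_ocell K : measurable (ocell K).
Proof. by apply: measurable_open; exact: open_ocell. Qed.

Lemma measurable_lam K k : measurable_fun setT (lam K k).
Proof. by apply: measurable_fun_continuous_rV; exact: continuous_lam. Qed.

End barycentric.

Section triangulated_domain.
Context {R : realType} {d : nat}.
Variables (M : mesh R d) (D : set 'rV[R]_d).
Hypotheses (d0 : (0 < d)%N) (tM : triangulation M D).
Local Notation idx := 'I_(nb_nodes M).
Let mu := lebesgue_rV R d.
Implicit Types (K : {set idx}) (i j k l : idx) (x : 'rV[R]_d).

Lemma cell_card K : K \in cells M -> #|K| = d.+1.
Proof. by case: tM => H _ _ _ _ /H[]. Qed.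

Lemma cell_indep K : K \in cells M -> affinely_independent K.
Proof. by case: tM => H _ _ _ _ /H[]. Qed.

Lemma closure_cells : closure D = \bigcup_(K in [set` cells M]) simplex K.
Proof. by case: tM. Qed.

Lemma domain_simplex x : closure D x -> exists2 K, K \in cells M & simplex K x.
Proof. by rewrite closure_cells => -[K /= cK xK]; exists K. Qed.

Lemma simplex_closure K x : K \in cells M -> simplex K x -> closure D x.
Proof. by move=> cK xK; rewrite closure_cells; exists K. Qed.

Lemma node_cell k : exists2 K, K \in cells M & k \in K.
Proof. by case: tM. Qed.

Lemma node_closure k : closure D (node k).
Proof.
have [K cK kK] := node_cell k; apply: (simplex_closure cK).
by apply: simplex_node => //; [exact: cell_card|exact: cell_indep].
Qed.

(** By conformity [x] lies in the common face. Its coordinates there, extended by 0, are barycentric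
    coordinates in both cells, and these are unique. *)
Lemma lam_conform K K' x k : K \in cells M -> K' \in cells M -> simplex K x -> simplex K' x ->
  lam K k x = lam K' k x.
Proof.
move=> cK cK' xK xK'; have : simplex (K :&: K') x by case: tM => _ _ <-.
move=> [a [a0 a1 ax]].
pose a' k := if k \in K :&: K' then a k else 0.
have gen (L : {set idx}) : L \in cells M -> K :&: K' \subset L -> lam L k x = a' k.
  move=> cL sL; have [kL|kL] := boolP (k \in L); last first.
    by rewrite lam_out// /a' ifF//; apply: contraNF kL; exact: (fintype.subsetP sL).
  apply/esym/lam_uniq => //; [exact: cell_card|exact: cell_indep| |].
    rewrite -big_mkcondr/= -[RHS]a1; apply: eq_bigl => i.
    by rewrite andb_idl//; exact: (fintype.subsetP sL).
  rewrite ax; under eq_bigr do rewrite /a' (fun_if (fun r => r *: _)) scale0r.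
  rewrite -big_mkcondr/=; apply: eq_bigl => i.
  by rewrite andb_idl//; exact: (fintype.subsetP sL).
by rewrite !gen ?subsetIl ?subsetIr.
Qed.

Lemma ocell_simplex K : K \in cells M -> ocell K `<=` simplex K.
Proof.
move=> cK x xK; apply/(simplexP (cell_card cK) (cell_indep cK)) => k kK.
by rewrite ltW// xK.
Qed.

Lemma ocell_sub K : K \in cells M -> ocell K `<=` D.
Proof.
move=> cK; case: tM => _ _ _ _ DE; rewrite [X in _ `<=` X]DE.
rewrite -open_subsetE; last exact: open_ocell.
by move=> x /(ocell_simplex cK) xK; exists K.
Qed.

(** All coordinates at vertices of [K] are positive and agree with those of [K'], which vanish off
    [K']; so [K] is contained in [K'], and both have d + 1 elements. *)
Lemma ocell_disj K K' x : K \in cells M -> K' \in cells M -> ocell K x -> ocell K' x -> K = K'.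
Proof.
move=> cK cK' xK xK'.
apply/eqP; rewrite eqEcard !cell_card// leqnn andbT; apply/fintype.subsetP => k kK.
have := xK k kK; rewrite (lam_conform _ cK cK' (ocell_simplex cK xK) (ocell_simplex cK' xK')).
by apply: contraTT => kK'; rewrite lam_out// ltxx.
Qed.

Definition ocells : set 'rV[R]_d := \big[setU/set0]_(K in cells M) ocell K.

Lemma ocellsP x : ocells x <-> exists2 K, K \in cells M & ocell K x.
Proof.
rewrite /ocells -bigcup_seq_cond; split => [[K /= /andP[_ cK] xK]|[K cK xK]]; first by exists K.
by exists K => //=; rewrite mem_index_enum.
Qed.

Lemma ocells_sub : ocells `<=` D.
Proof. by move=> x /ocellsP[K cK]; exact: ocell_sub. Qed.

Lemma measurable_ocells : measurable ocells.
Proof. by apply: bigsetU_measurable => K _; exact: measurable_ocell. Qed.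

(** A point of a closed cell outside the open one has a vanishing barycentric coordinate, so the
    remainder lies on finitely many hyperplanes. *)
Lemma domain_null : mu (D `\` ocells) = 0%E.
Proof.
have oD : open D by case: tM => _ _ _ _ ->; exact: open_interior.
have mDo : measurable (D `\` ocells) by apply: measurableD; [exact: measurable_open|exact: measurable_ocells].
pose N := \big[setU/set0]_(p : {set idx} * idx | (p.1 \in cells M) && (p.2 \in p.1)) [set x | lam p.1 p.2 x = 0].
have mL (p : {set idx} * idx) : measurable [set x | lam p.1 p.2 x = 0].
  rewrite (_ : [set x | _] = lam p.1 p.2 @^-1` [set 0])//.
  by apply: measurable_funT_preimage => //; exact: measurable_lam.
have [mN N0] : measurable N /\ mu N = 0%E.
  rewrite /N; elim/big_ind: _ => [|A B [mA A0] [mB B0]|p /andP[p1 p2]].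
  - by split; [exact: measurable0|exact: measure0].
  - by split; [exact: measurableU|rewrite null_set_setU].
  split => //; apply: lebesgue_rV_hyperplane0.
  by apply: lamb_neq0 => //; [exact: cell_card|exact: cell_indep].
apply/eqP; rewrite eq_le measure_ge0 andbT -N0; apply: le_measure; rewrite ?inE//.
move=> x [Dx nx].
have [K cK xK] := domain_simplex (subset_closure Dx).
have [k kK xk] : exists2 k, k \in K & ~ 0 < lam K k x.
  apply: contra_notP nx => H; apply/ocellsP; exists K => // k kK.
  by apply: contra_notP H => H; exists k.
rewrite /N -bigcup_seq_cond; exists (K, k) => /=; first by rewrite mem_index_enum cK.
apply/eqP; rewrite eq_le leNgt; apply/andP; split; first exact/negP.
by have /(simplexP (cell_card cK) (cell_indep cK)) := xK; apply.
Qed.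

Lemma Rintegral_ocells (f : 'rV[R]_d -> R) : mu.-integrable D (EFin \o f) ->
  \int[mu]_(x in D) f x = \sum_(K in cells M) \int[mu]_(x in ocell K) f x.
Proof.
move=> fi.
have oD : open D by case: tM => _ _ _ _ ->; exact: open_interior.
have mD := measurable_open oD; have mO := measurable_ocells.
have -> : \int[mu]_(x in D) f x = \int[mu]_(x in ocells) f x.
  congr fine; rewrite (negligible_integral (measurableD mD mO) mD fi domain_null) setDD setIidr//.
  exact: ocells_sub.
have : mu.-integrable ocells (EFin \o f) by apply: integrableS fi => //; exact: ocells_sub.
rewrite /ocells -2!big_enum/=.
have : uniq (enum (cells M)) by exact: enum_uniq.
have : {subset enum (cells M) <= cells M} by move=> K; rewrite mem_enum.
elim: (enum (cells M)) => [|K r IH] rM.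
  by rewrite !big_nil Rintegral_set0.
rewrite cons_uniq => /andP[Kr ur]; rewrite !big_cons => iU.
have mr : measurable (\big[setU/set0]_(L <- r) ocell L) by apply: bigsetU_measurable => L _; exact: measurable_ocell.
rewrite Rintegral_setU//; first last.
- apply/disj_setPS => x [xK]; rewrite -bigcup_seq => -[L /= Lr xL].
  by move: Kr; rewrite (ocell_disj _ _ xK xL) ?Lr// rM// in_cons ?eqxx// Lr orbT.
- exact: measurable_ocell.
congr (_ + _); apply: IH => //; first by move=> L Lr; apply: rM; rewrite in_cons Lr orbT.
by apply: integrableS iU => //; apply: measurableU => //; exact: measurable_ocell.
Qed.

(** On the closure of [D] the value does not depend on the chosen cell, by [lam_conform]; elsewhere
    the default [set0] yields 0. *)
Definition hat i x : R := lam (xget finset.set0 [set K | K \in cells M /\ simplex K x]) i x.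

Lemma hatE K i x : K \in cells M -> simplex K x -> hat i x = lam K i x.
Proof.
move=> cK xK; rewrite /hat; case: xgetP => [L _ [cL xL]|/(_ K)[]//].
exact: lam_conform.
Qed.

Lemma hat_node i j : hat i (node j) = (i == j)%:R.
Proof.
have [K cK jK] := node_cell j; have c := cell_card cK; have a := cell_indep cK.
rewrite (hatE _ cK); last exact: simplex_node.
have [iK|iK] := boolP (i \in K); first by rewrite lam_node.
by rewrite lam_out//; case: eqVneq iK jK => // -> /negbTE ->.
Qed.

Lemma hat_ge0 i x : closure D x -> 0 <= hat i x.
Proof.
move=> /domain_simplex[K cK xK]; rewrite (hatE _ cK xK).
have [iK|iK] := boolP (i \in K); last by rewrite lam_out.
by move/(simplexP (cell_card cK) (cell_indep cK)): xK; apply.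
Qed.

Lemma hat_le1 i x : closure D x -> hat i x <= 1.
Proof.
move=> /domain_simplex[K cK xK]; rewrite (hatE _ cK xK).
by apply: lam_le1 => //; [exact: cell_card|exact: cell_indep].
Qed.

(* Elements of V_h, apart from their weak differentiability. *)
Definition piecewise_affine (v : 'rV[R]_d -> R) : Prop :=
  forall K, K \in cells M -> exists (b : 'rV[R]_d) (c : R), forall x, simplex K x -> v x = dotv b x + c.

Lemma pw_affine_hat v x : piecewise_affine v -> closure D x -> v x = \sum_i v (node i) * hat i x.
Proof.
move=> pv /domain_simplex[K cK xK]; have [b [c vE]] := pv K cK.
rewrite (affine_lam (cell_card cK) (cell_indep cK) vE)// [RHS](bigID (mem K))/= [X in _ + X]big1 ?addr0.
  by apply: eq_bigr => k kK; rewrite (hatE _ cK xK).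
by move=> k kK; rewrite (hatE _ cK xK) lam_out// mulr0.
Qed.

Lemma pw_affine_comb (U : idx -> R) : piecewise_affine (fun x => \sum_i U i * hat i x).
Proof.
move=> K cK; exists (\sum_i U i *: lamb K i), (\sum_i U i * lamc K i) => x xK.
rewrite dotv_suml -big_split/=; apply: eq_bigr => i _.
by rewrite (hatE _ cK xK) dotvZl -mulrDr.
Qed.

End triangulated_domain.

(** * The chain rule for piecewise affine functions *)

(** Let m be the supremum of the points up to which the bound from [a] holds. The local bound at m
    carries the estimate up to m and, if m < b, strictly beyond it. Each s is compared only with its
    neighbours, which is what a piecewise affine function offers where cells meet. *)
Lemma pointwise_lipschitz_itv (R : realType) (h : R -> R) (a b L : R) : a <= b ->
  (forall s, a <= s <= b -> exists e : R, 0 < e /\ forall s', a <= s' <= b -> `|s' - s| < e ->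
     `|h s' - h s| <= L * `|s' - s|) ->
  `|h b - h a| <= L * (b - a).
Proof.
move=> ab H; pose S := [set s | a <= s <= b /\ `|h s - h a| <= L * (s - a)].
have Sa : S a by split; rewrite ?lexx ?ab// !subrr normr0 mulr0.
have Sb : ubound S b by move=> s [/andP[]].
have supS : has_sup S by split; [exists a|exists b].
pose m := sup S.
have am : a <= m by apply: sup_ubound => //; case: supS.
have mb : m <= b by apply: sup_le_ub => //; case: supS.
have [e [e0 He]] := H m (introT andP (conj am mb)).
have [s [/andP[as_ sb] hs] sm] := sup_adherent e0 supS.
have s_le_m : s <= m by apply: sup_ubound => //; [case: supS|split => //; rewrite as_].
have hsm := He s; rewrite as_ sb distrC ger0_norm ?subr_ge0// in hsm.
have {}hsm : `|h s - h m| <= L * (m - s) by apply: hsm => //; rewrite ltrBlDr addrC -ltrBlDr.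
have key r : m <= r -> r <= b -> r - m < e -> `|h r - h a| <= L * (r - a).
  move=> mr rb rme; have := He r; rewrite rb (le_trans am mr) ger0_norm ?subr_ge0// => /(_ isT rme) hr.
  have -> : h r - h a = (h r - h m) - (h s - h m) + (h s - h a) by ring.
  apply: le_trans (ler_normD _ _) _; apply: le_trans (lerD (ler_normB _ _) (lexx _)) _.
  have -> : L * (r - a) = L * (r - m) + L * (m - s) + L * (s - a) by ring.
  by rewrite !lerD.
have [->|mb'] := eqVneq b m; first by apply: key; rewrite ?lexx// subrr.
have {}mb' : m < b by rewrite lt_neqAle eq_sym mb'.
pose r := Num.min b (m + e / 2).
have mr : m < r by rewrite lt_min mb' ltrDl divr_gt0.
have rb : r <= b by rewrite ge_min lexx.
have : S r.
  split; first by rewrite rb (le_trans am (ltW mr)).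
  apply: key => //; first exact: ltW.
  by rewrite ltrBlDl (@le_lt_trans _ _ (m + e / 2))// ?ge_min ?lexx ?orbT// ltrD2l ltr_pdivrMr// ltr_pMr// ltr1n.
by move=> /(sup_ubound (proj2 supS)); rewrite leNgt mr.
Qed.

Section piecewise_calculus.
Context {R : realType} {d : nat}.
Variables (M : mesh R d) (D : set 'rV[R]_d).
Hypotheses (d0 : (0 < d)%N) (tM : triangulation M D) (bD : bounded_set D).
Local Notation idx := 'I_(nb_nodes M).
Let mu := lebesgue_rV R d.
Implicit Types (K : {set idx}) (i j k l : idx) (x y : 'rV[R]_d) (v : 'rV[R]_d -> R).

Lemma triangulated_open : open D.
Proof. by case: tM => _ _ _ _ ->; exact: open_interior. Qed.
Let oD := triangulated_open.
Let mD := measurable_domain oD.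

Definition cgrad v K : 'rV[R]_d := \sum_(k in K) v (node k) *: lamb K k.

Lemma pw_affine_cell v K : piecewise_affine M v -> K \in cells M ->
  exists c : R, forall x, simplex K x -> v x = dotv (cgrad v K) x + c.
Proof.
move=> pv cK; have [b [c vE]] := pv K cK.
exists (\sum_(k in K) v (node k) * lamc K k) => x xK.
rewrite (affine_lam (cell_card tM cK) (cell_indep tM cK) vE)// /cgrad dotv_suml -big_split/=.
by apply: eq_bigr => k kK; rewrite dotvZl -mulrDr.
Qed.

Lemma cgradE v K x y : piecewise_affine M v -> K \in cells M -> simplex K x -> simplex K y ->
  v y - v x = dotv (cgrad v K) (y - x).
Proof.
move=> pv cK xK yK; have [c vE] := pw_affine_cell pv cK.
by rewrite !vE// dotvDr dotvNr; ring.
Qed.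

Lemma coord_le_norm x (j : 'I_d) : `|x ord0 j| <= `|x|.
Proof. rewrite [leRHS]mx_normrE; exact: (le_bigmax _ (fun ij => `|x ij.1 ij.2|) (ord0, j)). Qed.

Lemma dotv_le_norm (b : 'rV[R]_d) x : `|dotv b x| <= (\sum_j `|b ord0 j|) * `|x|.
Proof.
rewrite mulr_suml (le_trans (ler_norm_sum _ _ _))// ler_sum// => j _.
by rewrite normrM ler_wpM2l// coord_le_norm.
Qed.

Lemma closed_simplex K : K \in cells M -> closed (simplex K).
Proof.
move=> cK; rewrite (_ : simplex K = \bigcap_(k in [set` K]) (lam K k @^-1` [set y | 0 <= y])).
  apply: closed_bigI => k _; apply: closed_comp => [x _|]; first exact: continuous_lam.
  exact: closed_ge.
apply/seteqP; split => x /=; first by move/(simplexP (cell_card tM cK) (cell_indep tM cK)).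
by move=> H; apply/(simplexP (cell_card tM cK) (cell_indep tM cK)).
Qed.

(** A sum over cells in place of a maximum; the l1 norm of a gradient is dual to the sup norm of row
    vectors. *)
Definition pw_lip v : R := \sum_(K in cells M) \sum_j `|cgrad v K ord0 j|.

Lemma pw_lip_ge0 v : 0 <= pw_lip v.
Proof. by apply: sumr_ge0 => K _; apply: sumr_ge0. Qed.

(** The finitely many closed cells that miss [z] also miss a neighbourhood of it, so a nearby y
    shares a cell with [z], on which [v] is affine. *)
Lemma pw_affine_pointwise_lip v z : piecewise_affine M v -> D z ->
  \forall y \near z, D y /\ `|v y - v z| <= pw_lip v * `|y - z|.
Proof.
move=> pv Dz.
have : \forall y \near z, forall K, K \in cells M -> simplex K y -> simplex K z.
  apply: (@filter_forall _ {set idx} _ (nbhs z) _) => K; have [cK|/negP nK] := boolP (K \in cells M); last first.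
    by apply: nearW => y cK.
  have [zK|zK] := pselect (simplex K z); first exact: nearW.
  have oK : open (~` simplex K) by apply: closed_openC; exact: closed_simplex.
  near=> y => _ yK; exfalso; apply: (_ : (~` simplex K) y) => //; near: y.
  exact: open_nbhs_nbhs.
move=> H; near=> y.
have Dy : D y by near: y; exact: open_nbhs_nbhs.
split => //.
have [K cK yK] := domain_simplex tM (subset_closure Dy).
have zK : simplex K z by move: K cK yK; near: y.
rewrite (cgradE pv cK zK yK) (le_trans (dotv_le_norm _ _))// ler_wpM2r//.
rewrite /pw_lip (bigD1 K)//= lerDl sumr_ge0// => L _; exact: sumr_ge0.
Unshelve. all: by end_near. Qed.

Lemma pw_affine_bounded v x : piecewise_affine M v -> closure D x -> `|v x| <= \sum_(k : idx) `|v (node k)|.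
Proof.
move=> pv cx; rewrite (pw_affine_hat tM pv cx) (le_trans (ler_norm_sum _ _ _))// ler_sum// => k _.
rewrite normrM ler_piMr// ger0_norm; [exact: (hat_le1 tM k cx)|exact: (hat_ge0 tM k cx)].
Qed.

Lemma pw_affine_measurable v : piecewise_affine M v -> measurable_fun D v.
Proof.
move=> pv; apply: (measurability _ (RGenOpens.measurableE R)) => _ [_ [a [b ->] <-]].
apply: measurable_open; rewrite openE => z [Dz vz].
have oab : open (`]a, b[%classic : set R) by exact: interval_open.
have [e /= e0 He] := (@nbhs_ballP _ _ (v z) _).1 (open_nbhs_nbhs (conj oab vz)).
have L0 : 0 < pw_lip v + 1 by rewrite ltr_wpDl// pw_lip_ge0.
have e1 : 0 < e / (pw_lip v + 1) by rewrite divr_gt0.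
near=> y.
have [Dy vy] : D y /\ `|v y - v z| <= pw_lip v * `|y - z| by near: y; exact: pw_affine_pointwise_lip.
split => //; apply: He; rewrite /ball/= distrC; apply: le_lt_trans vy _.
apply: (@le_lt_trans _ _ ((pw_lip v + 1) * `|y - z|)); first by rewrite ler_wpM2r// lerDl.
rewrite mulrC -ltr_pdivlMr// distrC; near: y.
Unshelve. all: by end_near. Qed.

Definition pgrad v (i : 'I_d) x : R := \sum_(K in cells M) \1_(ocell K) x * cgrad v K ord0 i.

Lemma pgradE v (i : 'I_d) K x : K \in cells M -> ocell K x -> pgrad v i x = cgrad v K ord0 i.
Proof.
move=> cK xK; rewrite /pgrad (bigD1 K)//= indicE mem_set// mul1r big1 ?addr0// => L /andP[cL LK].
rewrite indicE memNset ?mul0r// => xL; move: LK; by rewrite (ocell_disj tM cK cL xK xL) eqxx.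
Qed.

Lemma pgrad_measurable v (i : 'I_d) : measurable_fun setT (pgrad v i).
Proof.
rewrite (_ : pgrad v i = fun x => \sum_K (if K \in cells M then \1_(ocell K) x * cgrad v K ord0 i else 0)); last first.
  by apply/funext => x; rewrite -big_mkcond.
apply: measurable_sum => K /=; case: (K \in cells M); last exact: measurable_cst.
apply: measurable_funM => //.
apply: measurable_indic; exact: measurable_ocell.
Qed.

Lemma pgrad_bounded v (i : 'I_d) x : `|pgrad v i x| <= pw_lip v.
Proof.
rewrite /pgrad (le_trans (ler_norm_sum _ _ _))// ler_sum// => K _.
rewrite normrM (@le_trans _ _ `|cgrad v K ord0 i|)//.
  by rewrite ler_piMl// indicE; case: (_ \in _); rewrite ?normr1 ?normr0.
by rewrite (bigD1 i)//= lerDl sumr_ge0.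
Qed.

Section weak_chain_rule.
Variables (g : R -> R) (kappa : R).
Hypotheses (dg : forall x : R, derivable (g : R -> R^o) x 1)
  (cg : continuous (derive1 (g : R -> R^o))) (k0 : 0 < kappa)
  (lg : forall a b : R, `|g a - g b| <= kappa * `|a - b|).

Lemma derive1_lip a : `|derive1 (g : R -> R^o) a| <= kappa.
Proof.
rewrite derive1E.
have cv : `|h^-1 *: (g (h *: (1 : R) + a) - g a)| @[h --> 0^'] --> `|'D_1 (g : R -> R^o) a|.
  by apply: cvg_norm; exact: dg.
apply: (ler_cvg_to cv (cvg_cst kappa)); near=> h.
have h0 : h != 0 by near: h; exact: nbhs_dnbhs_neq.
rewrite normrM normfV ler_pdivrMl ?normr_gt0// (le_trans (lg _ _))// addrK mulrC.
by rewrite /GRing.scale/= mulr1.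
Unshelve. all: by end_near. Qed.

Lemma comp_measurable v : piecewise_affine M v -> measurable_fun D (g \o v).
Proof.
move=> pv; have mg : measurable_fun setT g.
  apply: continuous_measurable_fun => x; apply: differentiable_continuous; apply/derivable1_diffP; exact: dg.
apply: (measurable_comp (F := setT)) => //; exact: pw_affine_measurable.
Qed.

Lemma comp_bounded v : exists B : R, piecewise_affine M v -> forall x, D x -> `|g (v x)| <= B.
Proof.
exists (`|g 0| + kappa * \sum_(k : idx) `|v (node k)|) => pv x Dx.
have -> : g (v x) = g 0 + (g (v x) - g 0) by rewrite addrC subrK.
rewrite (le_trans (ler_normD _ _))// lerD2l (le_trans (lg _ _))// ler_wpM2l ?(ltW k0)// subr0.
by apply: pw_affine_bounded => //; exact: subset_closure.
Qed.

Lemma comp_L2 v : piecewise_affine M v -> L2 D (g \o v).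
Proof.
move=> pv; have [B HB] := comp_bounded v; apply: (L2_bounded oD bD (M := B)); first exact: comp_measurable.
exact: HB.
Qed.

Lemma comp_pgrad_L2 v (i : 'I_d) : piecewise_affine M v -> L2 D (fun x => derive1 (g : R -> R^o) (v x) * pgrad v i x).
Proof.
move=> pv; apply: (L2_bounded oD bD (M := kappa * pw_lip v)).
  apply: measurable_funM; last by apply: measurable_funTS; exact: pgrad_measurable.
  apply: (measurable_comp (F := setT)) => //; last exact: pw_affine_measurable.
  exact: continuous_measurable_fun.
move=> x Dx; rewrite normrM ler_pM//; [exact: derive1_lip|exact: pgrad_bounded].
Qed.

Lemma near_shift x (i : 'I_d) (A : set 'rV[R]_d) : (\forall y \near x, A y) ->
  \forall t \near (0 : R), A (x + t *: delta_mx ord0 i).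
Proof.
move=> /nbhs_ballP[e /= e0 He]; have ne := @nbhs0_lt R R^o _ e0; near=> t; apply: He.
rewrite -ball_normE/= opprD addNKr normrN normrZ.
apply: (@le_lt_trans _ _ `|t|); last by near: t; exact: ne.
rewrite ler_piMr// [leLHS]mx_normrE; apply: bigmax_le => // -[a b] _ /=.
by rewrite mxE; case: (_ && _); rewrite ?normr1 ?normr0.
Unshelve. all: by end_near. Qed.

Lemma comp_shift_lip v (i : 'I_d) x (t : R) : piecewise_affine M v ->
  (forall s : R, `|s| <= `|t| -> D (x + s *: delta_mx ord0 i)) ->
  `|g (v (x + t *: delta_mx ord0 i)) - g (v x)| <= kappa * pw_lip v * `|t|.
Proof.
move=> pv H; rewrite (le_trans (lg _ _))// -mulrA ler_wpM2l ?(ltW k0)//.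
pose e : 'rV[R]_d := delta_mx ord0 i.
have ne (r : R) : `|r *: e| <= `|r|.
  rewrite normrZ ler_piMr// [leLHS]mx_normrE; apply: bigmax_le => // -[a b] _ /=.
  by rewrite mxE; case: (_ && _); rewrite ?normr1 ?normr0.
pose h s := v (x + (s * t) *: e).
have : `|h 1 - h 0| <= (pw_lip v * `|t|) * (1 - 0).
  apply: pointwise_lipschitz_itv => // s /andP[s0 s1].
  have Ds : D (x + (s * t) *: e) by apply: H; rewrite normrM ler_piMl// ger0_norm.
  have [e1 e10 He] := (@nbhs_ballP _ _ (0 : R) _).1 (near_shift i (pw_affine_pointwise_lip pv Ds)).
  have t1 : 0 < `|t| + 1 by rewrite ltr_wpDl.
  exists (e1 / (`|t| + 1)); split; first by rewrite divr_gt0.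
  move=> s' _ ss'.
  have [_] : D (x + (s * t) *: e + ((s' - s) * t) *: e) /\
      `|v (x + (s * t) *: e + ((s' - s) * t) *: e) - v (x + (s * t) *: e)| <=
      pw_lip v * `|x + (s * t) *: e + ((s' - s) * t) *: e - (x + (s * t) *: e)|.
    apply: He; rewrite -ball_normE/= sub0r normrN normrM.
    apply: (@le_lt_trans _ _ (`|s' - s| * (`|t| + 1))); first by rewrite ler_wpM2l// lerDl.
    by rewrite -ltr_pdivlMr.
  rewrite -addrA -scalerDl -mulrDl (addrC s) subrK => vb.
  rewrite (le_trans vb)// -mulrA ler_wpM2l ?pw_lip_ge0//.
  rewrite opprD addrACA subrr add0r -scalerBl -mulrBl (le_trans (ne _))// normrM mulrC//.
by rewrite subr0 mulr1 /h mul1r mul0r scale0r addr0.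
Qed.

Lemma test_shift_lip phi (i : 'I_d) : test_function D phi -> exists B : R, forall x (t : R),
  `|phi (x + t *: delta_mx ord0 i) - phi x| <= B * `|t|.
Proof.
move=> tphi; have [B HB] := partial_test_bounded i tphi; exists B => x t.
pose e : 'rV[R]_d := delta_mx ord0 i.
have [/(_ 1%N)[cphi /(_ i)[dphi _]] _ _] := tphi.
pose h (s : R) := phi (x + s *: e).
have dh (s : R) : is_derive s (1 : R) h (partial i phi (x + s *: e)).
  have E : (fun k : R => k^-1 *: ((h \o shift s) (k *: (1 : R)) - h s)) =
     (fun k : R => k^-1 *: ((phi \o shift (x + s *: e)) (k *: e) - phi (x + s *: e))).
    apply/funext => k /=; congr (_ *: (_ - _)); rewrite /h; congr phi.
    have -> : k%:A = k by rewrite [LHS]mulr1.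
    by rewrite scalerDl addrCA.
  by split; rewrite /derivable/derive E//; exact: dphi.
have B0 : 0 <= B by apply: le_trans (HB x).
have gen a b : a <= b -> `|h b - h a| <= B * (b - a).
  rewrite le_eqVlt => /predU1P[->|ab]; first by rewrite !subrr normr0 mulr0.
  have [c _ ->] := @MVT R h (fun s => partial i phi (x + s *: e)) a b ab (fun s _ => dh s)
    (derivable_within_continuous (fun s _ => @ex_derive _ _ _ _ _ _ _ (dh s))).
  rewrite normrM [`|b - a|]gtr0_norm ?subr_gt0//; apply: ler_wpM2r; first by rewrite subr_ge0 ltW.
  exact: HB.
have [t0|t0] := leP 0 t.
  by rewrite (ger0_norm t0); have := gen 0 t t0; rewrite /h scale0r addr0 subr0.
by rewrite (ltr0_norm t0); have := gen t 0 (ltW t0); rewrite /h scale0r addr0 sub0r distrC.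
Qed.

(** The support is compact in the open set [D], so one step length is admissible at all of its
    points. *)
Lemma test_segment phi (i : 'I_d) : test_function D phi -> exists e : R, 0 < e /\
  forall x (s : R), tsupport phi x -> `|s| <= e -> D (x + s *: delta_mx ord0 i).
Proof.
move=> [_ cK KD].
have H : forall x, tsupport phi x -> \forall x' \near x & t \near (0 : R),
    forall s : R, `|s| <= `|t| -> D (x' + s *: delta_mx ord0 i).
  move=> x /KD Dx; have [e [e0 He]] := rV_open_box oD Dx.
  have e20 : 0 < e / 2 by rewrite divr_gt0.
  exists (ball x (e / 2), ball (0 : R) (e / 2)); first by split; exact: nbhsx_ballx.
  move=> [y t] /= [xy t0] s st; apply: He => j.
  have h1 : `|x ord0 j - y ord0 j| < e / 2.
    by move: xy; rewrite -ball_normE/= => /(le_lt_trans (coord_le_norm _ j)); rewrite !mxE.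
  have h2 : `|s * (delta_mx ord0 i : 'rV[R]_d) ord0 j| < e / 2.
    apply: (@le_lt_trans _ _ `|t|); last by move: t0; rewrite -ball_normE/= sub0r normrN.
    by apply: le_trans st; rewrite normrM mxE ler_piMr//; case: (_ && _); rewrite ?normr1 ?normr0.
  have -> : (y + s *: delta_mx ord0 i) ord0 j = y ord0 j + s * (delta_mx ord0 i : 'rV[R]_d) ord0 j by rewrite !mxE.
  rewrite opprD addrA (le_lt_trans (ler_normB _ _))//.
  by rewrite [e]splitr ltrD.
have := (compact_near_coveringP (tsupport phi)).1 cK R (nbhs (0 : R))
  (fun t x => forall s : R, `|s| <= `|t| -> D (x + s *: delta_mx ord0 i)) _ H.
move=> /(_ (nbhs_filter _)) /nbhs_ballP[e /= e0 He].
exists (e / 2); split; first by rewrite divr_gt0.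
move=> x s Kx se; have := He (e / 2) _ x Kx s; apply.
  rewrite -ball_normE/= sub0r normrN gtr0_norm ?divr_gt0//.
  by rewrite ltr_pdivrMr// ltr_pMr// ltr1n.
by rewrite (le_trans se)// ler_norm.
Qed.

Lemma translate_integral (f : 'rV[R]_d -> R) (e : 'rV[R]_d) :
  measurable_fun setT f -> mu.-integrable setT (EFin \o f) ->
  \int[mu]_x f (x + e) = \int[mu]_x f x.
Proof.
move=> mf fi; congr fine.
have ste := scales_rV_translate e; have [mt st] := ste.
have pe : forall A, measurable A -> A `<=` setT -> pushforward mu (fun x => x + e) A = mu A.
  by move=> A mA _; have := st A mA; rewrite mul1e.
have mfE : measurable_fun setT (EFin \o f) by apply/measurable_EFinP.
rewrite -[LHS]/(\int[mu]_(x in (fun x => x + e)%R @^-1` setT) ((EFin \o f) \o (fun x => x + e)%R) x)%E.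
have fi' : mu.-integrable setT ((EFin \o f) \o (fun x => x + e)%R).
  apply/integrableP; split; first exact: measurableT_comp.
  have := ge0_integral_scales ler01 ste (measurableT_comp (@abse_measurable R setT) mfE) (fun x => abse_ge0 _).
  rewrite mul1e /comp => ->; by have /integrableP[] := fi.
rewrite -(integral_pushforward mt)//.
exact: eq_measure_integral.
Qed.

Lemma Rintegral_bounded_cvg (f_ : nat -> 'rV[R]_d -> R) (f : 'rV[R]_d -> R) (B : R) :
  (forall n, measurable_fun D (f_ n)) -> measurable_fun D f ->
  (forall n x, D x -> `|f_ n x| <= B) ->
  {ae mu, forall x, D x -> f_ n x @[n --> \oo] --> f x} ->
  \int[mu]_(x in D) f_ n x @[n --> \oo] --> \int[mu]_(x in D) f x.
Proof.
move=> mf_ mf fB cv.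
have [] := @dominated_convergence _ _ _ mu D mD (fun n x => (f_ n x)%:E) (fun x => (f x)%:E) (fun=> B%:E).
- by move=> n; apply/measurable_EFinP.
- exact/measurable_EFinP.
- apply: filterS cv => x H Dx; apply: cvg_EFin; [exact: nearW|exact: H].
- exact: (L2_integrable oD bD (L2_cst oD bD B)).
- by apply: aeW => x n Dx; rewrite abse_EFin lee_fin fB.
move=> fi _ H; apply: fine_cvg; rewrite fineK//.
exact: integrable_fin_num.
Qed.

(** Translation invariance moves a difference quotient from [phi] to [g \o v], and both sides pass
    to the limit by dominated convergence. The quotient of [g \o v] is bounded by the Lipschitz
    estimate along segments, which also cross faces, and it converges inside every open cell; no
    jump terms arise. *)
Lemma weak_partial_comp v (i : 'I_d) : piecewise_affine M v ->
  weak_partial D i (g \o v) (fun x => derive1 (g : R -> R^o) (v x) * pgrad v i x).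
Proof.
move=> pv; split; first exact: comp_pgrad_L2.
move=> phi tphi.
have [e0 [e00 He0]] := test_segment i tphi.
have [B HB] := test_shift_lip i tphi.
have [B' HB'] : exists B' : R, forall x, `|phi x| <= B' := test_bounded tphi.
have [C [C0 HC]] : exists C : R, 0 <= C /\ forall x, D x -> `|g (v x)| <= C.
  have [C HC] := comp_bounded v; exists `|C|; split => // x Dx.
  exact: le_trans (HC pv x Dx) (ler_norm _).
pose e : 'rV[R]_d := delta_mx ord0 i.
pose t (n : nat) : R := e0 / n.+1%:R.
have t0 n : 0 < t n by rewrite divr_gt0.
have tle n : t n <= e0 by rewrite ler_pdivrMr// ler_peMr ?ler1n// ltW.
have tc0 : t n @[n --> \oo] --> (0 : R).
  by rewrite -(mulr0 e0); apply: cvgMr; exact: cvg_harmonic.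
have tc : t n @[n --> \oo] --> (0 : R)^'.
  move=> A A0; have h : \forall n \near \oo, (t n != 0 -> A (t n)) := tc0 _ A0.
  suff : \forall n \near \oo, A (t n) by [].
  by apply: filterS h => n; apply; rewrite (gt_eqF (t0 n)).
pose W := g \o v.
have mW : measurable_fun D W by exact: comp_measurable.
have mphi := measurable_test tphi.
have mshift (s : R) : measurable_fun setT (fun x : 'rV[R]_d => x + s *: e) by have [] := scales_rV_translate (s *: e).
(* Extension by zero allows the translation to be performed over the whole space. *)
pose Wt := W \_ D.
have mWt : measurable_fun setT Wt by apply/(measurable_restrictT _ mD).
have WtB x : `|Wt x| <= C.
  rewrite /Wt patchE; case: ifPn => [/set_mem Dx|_]; first exact: HC.
  by rewrite normr0.
pose psi n x := (phi (x + t n *: e) - phi x) / t n.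
pose G n x := Wt (x + - t n *: e) * phi x.
(* The substitution shifts the argument of [Wt] backwards, so this quotient converges to minus the
   derivative times [phi]; this is the sign of integration by parts. *)
pose q n x := (G n x - Wt x * phi x) / t n.
have mG n : measurable_fun setT (G n) by apply: measurable_funM => //; exact: (measurableT_comp mWt (mshift (- t n))).
have mpsi n : measurable_fun setT (psi n).
  by apply: measurable_funM => //; apply: measurable_funB => //; exact: (measurableT_comp mphi (mshift (t n))).
have bi (f : 'rV[R]_d -> R) (K : R) : measurable_fun setT f -> (forall x, `|f x| <= K) -> mu.-integrable D (EFin \o f).
  by move=> mf fK; apply: (L2_integrable oD bD); apply: (L2_bounded oD bD (M := K)) => //; exact: measurable_funTS.
have CB (a b : R) : `|a| <= C -> `|b| <= B' -> `|a * b| <= C * B' by move=> ? ?; rewrite normrM ler_pM.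
have iG n : mu.-integrable D (EFin \o G n) by apply: (bi _ (C * B')) => // x; exact: CB.
have iWphi : mu.-integrable D (fun x => (Wt x * phi x)%:E).
  by apply: (bi _ (C * B')) => [|x]; [exact: measurable_funM|exact: CB].
have iWphit n : mu.-integrable D (fun x => (Wt x * phi (x + t n *: e))%:E).
  apply: (bi _ (C * B')) => [|x]; last exact: CB.
  by apply: measurable_funM => //; exact: (measurableT_comp mphi (mshift (t n))).
have lin (c : R) (f1 f2 : 'rV[R]_d -> R) : mu.-integrable D (fun x => (f1 x)%:E) -> mu.-integrable D (fun x => (f2 x)%:E) ->
    \int[mu]_(x in D) (c * (f1 x - f2 x)) = c * (\int[mu]_(x in D) f1 x - \int[mu]_(x in D) f2 x).
  move=> i1 i2; rewrite RintegralZl//; first by rewrite RintegralB.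
  by have := integrableB mD i1 i2; apply: eq_integrable => // x _; rewrite EFinB.
have phi0 x : ~ D x -> phi x = 0.
  by move=> nDx; apply: tsupport_out => /(let: And3 _ _ K := tphi in K).
have step1 n : \int[mu]_(x in D) (Wt x * psi n x) = \int[mu]_(x in D) q n x.
  have -> : \int[mu]_(x in D) (Wt x * psi n x) =
      (t n)^-1 * (\int[mu]_(x in D) (Wt x * phi (x + t n *: e)) - \int[mu]_(x in D) (Wt x * phi x)).
    rewrite -(lin _ _ _ (iWphit n) iWphi).
    by apply: eq_Rintegral => x _; rewrite /psi; ring.
  have -> : \int[mu]_(x in D) q n x =
      (t n)^-1 * (\int[mu]_(x in D) G n x - \int[mu]_(x in D) (Wt x * phi x)).
    rewrite -(lin _ _ _ (iG n) iWphi).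
    by apply: eq_Rintegral => x _; rewrite /q; ring.
  congr (_ * (_ - _)).
  have GD : G n = G n \_ D.
    apply/funext => x; rewrite patchE; case: ifPn => // /negP nDx.
    by rewrite /G phi0 ?mulr0// => Dx; apply: nDx; exact: mem_set.
  rewrite [RHS]Rintegral_mkcond -GD.
  rewrite -(translate_integral (t n *: e))//; last first.
    rewrite GD; have := (integrable_mkcond (EFin \o G n) mD).1 (iG n).
    by rewrite restrict_EFin.
  rewrite Rintegral_mkcond; apply: eq_Rintegral => x _; rewrite patchE /G.
  rewrite scaleNr addrK /Wt patchE; case: (x \in D) => //.
  exact: (esym (mul0r _)).
have c1 : \int[mu]_(x in D) (Wt x * psi n x) @[n --> \oo] --> \int[mu]_(x in D) (Wt x * partial i phi x).
  apply: (@Rintegral_bounded_cvg _ _ (C * B)).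
  - by move=> n; apply: measurable_funM; apply: measurable_funTS.
  - apply: measurable_funM; apply: measurable_funTS => //.
    exact: (measurable_fun_continuous_rV (continuous_partial_test tphi)).
  - move=> n x _; rewrite normrM ler_pM// /psi normrM normfV ler_pdivrMr ?normr_gt0 ?(gt_eqF (t0 n))//; exact: HB.
  apply: aeW => x _; apply: cvgMr.
  have [/(_ 1%N)[_ /(_ i)[/(_ x) dphi _]] _ _] := tphi.
  have := cvg_comp _ _ tc dphi; apply: cvg_trans; apply: near_eq_cvg; near=> n => /=.
  by rewrite /psi (addrC x) mulrC.
have c2 : \int[mu]_(x in D) q n x @[n --> \oo] -->
    \int[mu]_(x in D) (- (derive1 (g : R -> R^o) (v x) * pgrad v i x * phi x)).
  apply: (@Rintegral_bounded_cvg _ _ (kappa * pw_lip v * B')).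
  - by move=> n; apply: measurable_funM => //; apply: measurable_funTS; apply: measurable_funB => //; exact: measurable_funM.
  - apply: measurableT_comp => //; apply: measurable_funM; last exact: measurable_funTS.
    exact: L2_measurable (comp_pgrad_L2 i pv).
  (* Off the support both products vanish. On it, [t n <= e0] keeps the segment inside [D], where
     [comp_shift_lip] applies. *)
  - move=> n x Dx; have [sx|nsx] := pselect (tsupport phi x); last first.
      rewrite /q /G (tsupport_out nsx) !mulr0 subrr mul0r normr0.
      by rewrite mulr_ge0 ?mulr_ge0 ?pw_lip_ge0 ?(ltW k0)// (le_trans _ (HB' x)).
    have Ds (s : R) : `|s| <= `|- t n| -> D (x + s *: e).
      by move=> st; apply: He0 => //; rewrite (le_trans st)// normrN (gtr0_norm (t0 n)).
    have := comp_shift_lip pv Ds; rewrite normrN (gtr0_norm (t0 n)) => H.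
    rewrite /q /G -mulrBl /Wt !patchE !mem_set//; last by apply: Ds.
    by rewrite mulrAC normrM ler_pM// normrM normfV (gtr0_norm (t0 n)) ler_pdivrMr.
  (* Almost every point is in an open cell; small shifts stay there, and the quotient becomes that
     of the one-variable function [k] below. *)
  have : {ae mu, forall x, D x -> ocells M x}.
    exists (D `\` ocells M); split; [by apply: measurableD => //; exact: measurable_ocells|exact: domain_null|].
    by move=> x /= H; apply: contrapT => H'; apply: H => Dx; apply: contrapT => nx; apply: H'.
  apply: filterS => x + Dx => /(_ Dx) /ocellsP[K cK xK].
  rewrite -mulNr; under eq_fun do rewrite /q /G -mulrBl mulrAC.
  apply: cvgMl.
  have nK : \forall s \near (0 : R), ocell K (x + s *: e).
    by apply: near_shift; apply: open_nbhs_nbhs; split => //; exact: open_ocell.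
  have nKn : \forall n \near \oo, ocell K (x + - t n *: e).
    have tN : - t n @[n --> \oo] --> (0 : R) by rewrite -oppr0; apply: cvgN; exact: tc0.
    exact: (tN _ nK).
  pose k (s : R) := g (v x + s * - cgrad v K ord0 i).
  have dk : is_derive (0 : R) (1 : R) k (derive1 (g : R -> R^o) (v x) * - cgrad v K ord0 i).
    have da : is_derive (0 : R) (1 : R) (fun s : R => v x + s * - cgrad v K ord0 i) (- cgrad v K ord0 i).
      have := is_deriveD (is_derive_cst (v x) (0 : R) (1 : R)) (is_deriveZ (- cgrad v K ord0 i) (is_derive_id (0 : R) (1 : R))).
      rewrite add0r [_ *: 1]mulr1; congr (is_derive _ _ _ _); apply/funext => s /=.
      by rewrite [in RHS]mulrC.
    apply: (@is_derive1_comp R g (fun s : R => v x + s * - cgrad v K ord0 i)) => //.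
    rewrite mul0r addr0 derive1E; exact: DeriveDef.
  rewrite (pgradE _ i cK xK) -mulrN -(@derive_val _ _ _ _ _ _ _ dk).
  have := cvg_comp _ _ tc (@ex_derive _ _ _ _ _ _ _ dk); apply: cvg_trans; apply: near_eq_cvg; near=> n => /=.
  have xnK : ocell K (x + - t n *: e) by near: n.
  rewrite addr0 [_%:A]mulr1 /k mul0r addr0 /Wt !patchE !mem_set//; last exact: (ocell_sub tM cK).
  rewrite [LHS]mulrC; congr ((g _ - _) / _).
  rewrite -[RHS](subrK (v x)) (cgradE pv cK (ocell_simplex tM cK xK) (ocell_simplex tM cK xnK)).
  rewrite addrC; congr (_ + _).
  by rewrite addrAC subrr add0r dotvZr dotv_delta mulNr mulrN.
have E1 : ip D (g \o v) (partial i phi) = \int[mu]_(x in D) (Wt x * partial i phi x).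
  by apply: eq_Rintegral => x xD; rewrite /Wt patchE xD.
rewrite E1 /ip.
have -> : (- (\int[mu]_(x in D) (derive1 (g : R -> R^o) (v x) * pgrad v i x * phi x))) =
    \int[mu]_(x in D) (- (derive1 (g : R -> R^o) (v x) * pgrad v i x * phi x)).
  rewrite -mulN1r -RintegralZl//; first by apply: eq_Rintegral => x _; rewrite mulN1r.
  by apply: (L2_mul_integrable oD) => //; [exact: comp_pgrad_L2|exact: (L2_test oD bD)].
apply: (@cvg_unique _ (@Rhausdorff R) _ _ _ _ c1).
by apply: cvg_trans c2; apply: near_eq_cvg; near=> n; rewrite step1.
Unshelve. all: by end_near. Qed.

End weak_chain_rule.

End piecewise_calculus.

(** * Mass matrix, projection and discrete Laplacian *)

Section positive_measure.
Context {R : realType}.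

Lemma lebesgue_rV_rbox_gt0 d (a b : 'rV[R]_d) : (forall i, a ord0 i < b ord0 i) ->
  (0 < lebesgue_rV R d (rbox a b))%E.
Proof.
elim: d a b => [|d IH] a b ab.
  rewrite (_ : rbox a b = setT); last by apply/seteqP; split => // x _ [].
  by rewrite /= diracT lte01.
rewrite /= /lebesgue_rV_step /pushforward rbox_consrV product_measure1E//; last exact: measurable_rbox.
apply: mule_gt0; last by apply: IH => i; rewrite /rV_tail !mxE.
by rewrite [X in (0 < X)%E]lebesgue_measure_itv/= lte_fin ab -EFinB lte_fin subr_gt0.
Qed.

Lemma lebesgue_rV_open_gt0 d (A : set 'rV[R]_d) x : open A -> A x -> (0 < lebesgue_rV R d A)%E.
Proof.
move=> oA Ax; have [e [e0 He]] := rV_open_box oA Ax.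
apply: (@lt_le_trans _ _ (lebesgue_rV R d (rbox (x - const_mx e) (x + const_mx e)))).
  by apply: lebesgue_rV_rbox_gt0 => i; rewrite !mxE; lra.
apply: le_measure; rewrite ?inE; [exact: measurable_rbox|exact: measurable_open|].
by move=> y yb; apply: He => i; have := yb i; rewrite !mxE distrC ltr_distl.
Qed.

End positive_measure.

Section finite_element_space.
Context {R : realType} {d : nat}.
Variables (M : mesh R d) (D : set 'rV[R]_d).
Hypotheses (d0 : (0 < d)%N) (tM : triangulation M D) (bD : bounded_set D).
Local Notation idx := 'I_(nb_nodes M).
Let mu := lebesgue_rV R d.
Implicit Types (K : {set idx}) (i j k l : idx) (x y : 'rV[R]_d) (v w : 'rV[R]_d -> R).
Let oD := triangulated_open tM.
Let mD := measurable_domain oD.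
Let sD : D `<=` closure D := @subset_closure _ D.

Definition vol K : R := fine (mu (ocell K)).

Lemma ocell_fin K : K \in cells M -> (mu (ocell K) < +oo)%E.
Proof.
move=> cK; apply: le_lt_trans (domain_fin oD bD); apply: le_measure; rewrite ?inE//; first exact: measurable_ocell.
exact: (ocell_sub tM cK).
Qed.

Lemma volE K : K \in cells M -> mu (ocell K) = (vol K)%:E.
Proof. by move=> cK; rewrite fineK// ge0_fin_numE ?measure_ge0// ocell_fin. Qed.

Lemma vol_gt0 K : K \in cells M -> 0 < vol K.
Proof.
move=> cK; rewrite -lte_fin -volE//.
pose x := \sum_(k in K) (d.+1%:R^-1 : R) *: node k.
have cd := cell_card tM cK.
apply: (@lebesgue_rV_open_gt0 _ _ _ x); first exact: open_ocell.
move=> k kK; rewrite -(lam_uniq cd (cell_indep tM cK) (a := fun=> d.+1%:R^-1) _ (erefl _) kK) ?invr_gt0//.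
by rewrite sumr_const cd -[LHS]mulr_natr mulVf// pnatr_eq0.
Qed.

Lemma vol_ge0 K : K \in cells M -> 0 <= vol K.
Proof. by move=> cK; apply/ltW/vol_gt0. Qed.

Lemma pw_affine_lin (a : R) v w : piecewise_affine M v -> piecewise_affine M w ->
  piecewise_affine M (fun x => a * v x + w x).
Proof.
move=> pv pw K cK; have [b [c vE]] := pv K cK; have [b' [c' wE]] := pw K cK.
exists (a *: b + b'), (a * c + c') => x xK; rewrite vE// wE// dotvDl dotvZl; ring.
Qed.

Lemma pw_affine_cl v w : (forall x, closure D x -> v x = w x) -> piecewise_affine M v -> piecewise_affine M w.
Proof.
move=> vw pv K cK; have [b [c vE]] := pv K cK; exists b, c => x xK.
by rewrite -vw ?vE//; exact: (simplex_closure tM cK).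
Qed.

Lemma pw_affine_node v w : piecewise_affine M v -> piecewise_affine M w ->
  (forall i, v (node i) = w (node i)) -> forall x, closure D x -> v x = w x.
Proof.
move=> pv pw vw x cx; rewrite (pw_affine_hat tM pv cx) (pw_affine_hat tM pw cx).
by apply: eq_bigr => i _; rewrite vw.
Qed.

(** The chain rule for the identity, with Lipschitz constant 1. *)
Lemma pw_affine_weak_partial v (i : 'I_d) : piecewise_affine M v -> weak_partial D i v (pgrad M v i).
Proof.
move=> pv; have := @weak_partial_comp _ _ _ _ d0 tM bD id 1 _ _ ltr01 _ v i pv.
have d1 : derive1 (id : R -> R^o) = fun=> 1 by apply/funext => x; rewrite derive1E derive_id.
rewrite d1; under [X in weak_partial _ _ _ X]eq_fun do rewrite mul1r.
move=> H; apply: H; first by move=> x; exact: (@derivable_id _ R^o).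
- by move=> x; exact: cst_continuous.
- by move=> a b; rewrite mul1r.
Qed.

Lemma pw_affine_L2 v : piecewise_affine M v -> L2 D v.
Proof.
move=> pv; apply: (L2_bounded oD bD (M := \sum_(k : idx) `|v (node k)|)); first exact: (pw_affine_measurable tM pv).
by move=> x Dx; apply: (pw_affine_bounded tM pv); exact: sD.
Qed.

Lemma pw_affine_Hs1 v : piecewise_affine M v -> Hs D 1 v.
Proof.
move=> pv; split; first exact: pw_affine_L2.
move=> i; exists (pgrad M v i); split; first exact: pw_affine_weak_partial.
by split => //; have [] := pw_affine_weak_partial i pv.
Qed.

Lemma VhP v : Vh D M v <-> piecewise_affine M v.
Proof. by split => [[]//|pv]; split => //; exact: pw_affine_Hs1. Qed.

Lemma pw_affine_hat1 i : piecewise_affine M (hat i).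
Proof. by move=> K cK; exists (lamb K i), (lamc K i) => x xK; rewrite (hatE tM _ cK xK). Qed.

Lemma nodal_basisP i : Vh D M (nodal_basis D i) /\ forall j, nodal_basis D i (node j) = (i == j)%:R.
Proof.
rewrite /nodal_basis; case: xgetP => // /(_ (hat i))[]; split; first by apply/VhP; exact: pw_affine_hat1.
by move=> j; exact: (hat_node tM).
Qed.

Lemma nodal_basisE i x : closure D x -> nodal_basis D i x = hat i x.
Proof.
have [/VhP pb nb] := nodal_basisP i; apply: pw_affine_node => //; first exact: pw_affine_hat1.
by move=> j; rewrite nb (hat_node tM).
Qed.

Lemma interpolantE v x : closure D x -> interpolant D M v x = \sum_(i : idx) v (node i) * hat i x.
Proof. by move=> cx; apply: eq_bigr => i _; rewrite nodal_basisE. Qed.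

Lemma interpolant_node v i : interpolant D M v (node i) = v (node i).
Proof.
rewrite interpolantE; last exact: (node_closure tM).
rewrite (bigD1 i)//= (hat_node tM) eqxx mulr1 big1 ?addr0// => j ji.
by rewrite (hat_node tM) (negbTE ji) mulr0.
Qed.

Lemma interpolant_pw_affine v : piecewise_affine M (interpolant D M v).
Proof.
apply: (@pw_affine_cl (fun x => \sum_(i : idx) v (node i) * hat i x)); last exact: (pw_affine_comb tM).
by move=> x cx; rewrite interpolantE.
Qed.

Lemma ip_cells v w : L2 D v -> L2 D w ->
  ip D v w = \sum_(K in cells M) \int[mu]_(x in ocell K) (v x * w x).
Proof. by move=> Lv Lw; apply: (Rintegral_ocells d0 tM); exact: (L2_mul_integrable oD). Qed.

Lemma ip_gradP v w : piecewise_affine M v -> piecewise_affine M w ->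
  ip_grad D v w = \sum_(K in cells M) vol K * dotv (cgrad v K) (cgrad w K).
Proof.
move=> pv pw.
rewrite (ip_gradE oD bD (fun i : 'I_d => pw_affine_weak_partial i pv) (fun i : 'I_d => pw_affine_weak_partial i pw)).
rewrite [RHS](eq_bigr (fun K => \sum_i vol K * (cgrad v K ord0 i * cgrad w K ord0 i))); last first.
  by move=> K _; rewrite /dotv mulr_sumr.
rewrite exchange_big/=; apply: eq_bigr => i _.
rewrite ip_cells; [|by have [] := pw_affine_weak_partial i pv|by have [] := pw_affine_weak_partial i pw].
apply: eq_bigr => K cK; rewrite (@eq_Rintegral _ _ _ mu _ (fun=> cgrad v K ord0 i * cgrad w K ord0 i)); last first.
  by move=> x /set_mem xK; rewrite !(pgradE tM _ _ cK xK).
by rewrite (Rintegral_cst _ (@measurable_ocell _ _ M K)) mulrC.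
Qed.

(* mass lumping, up to the factor (d + 1)^-1 *)
Definition lump v w : R := \sum_(K in cells M) \sum_(k in K) vol K * (v (node k) * w (node k)).

Lemma pw_affine_cell_lam v K x : piecewise_affine M v -> K \in cells M -> simplex K x ->
  v x = \sum_(k in K) v (node k) * lam K k x.
Proof.
move=> pv cK xK; have [b [c vE]] := pv K cK.
exact: (affine_lam (cell_card tM cK) (cell_indep tM cK) vE xK).
Qed.

Lemma Rint_cell v w K : K \in cells M -> L2 D v -> L2 D w ->
  mu.-integrable (ocell K) (EFin \o (fun x => v x * w x)).
Proof.
move=> cK Lv Lw; apply: (integrableS mD); [exact: measurable_ocell|exact: (ocell_sub tM cK)|].
exact: (L2_mul_integrable oD).
Qed.

(** Jensen on each cell: v(x) is the mean of the nodal values with weights [lam K k x], so v(x)^2 is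
    at most the mean of their squares (nonnegative variance); then the weights are at most 1. *)
Lemma ip_le_lump v : piecewise_affine M v -> ip D v v <= lump v v.
Proof.
move=> pv; have Lv := pw_affine_L2 pv; rewrite ip_cells//; apply: ler_sum => K cK.
have mK := @measurable_ocell _ _ M K.
rewrite -mulr_sumr mulrC -/(vol K) -(Rintegral_cst mu mK).
apply: le_Rintegral => //; first exact: Rint_cell.
  by apply: (integrableS mD) (L2_integrable oD bD (L2_cst oD bD _)) => //; exact: (ocell_sub tM cK).
move=> x xK; have sK := ocell_simplex tM cK xK.
set s := v x; have l1 := lam_sum (cell_card tM cK) (cell_indep tM cK) x.
have sE : s = \sum_(k in K) v (node k) * lam K k x by exact: pw_affine_cell_lam.
have H : 0 <= \sum_(k in K) lam K k x * (v (node k) - s) ^+ 2.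
  by apply: sumr_ge0 => k kK; rewrite mulr_ge0 ?sqr_ge0// ltW// xK.
have E : \sum_(k in K) lam K k x * (v (node k) - s) ^+ 2 =
    \sum_(k in K) lam K k x * v (node k) ^+ 2 - s * s.
  rewrite (eq_bigr (fun k => lam K k x * v (node k) ^+ 2 + (- 2 * s * (v (node k) * lam K k x) + s ^+ 2 * lam K k x))).
    by rewrite !big_split/= -!mulr_sumr l1 -sE; ring.
  by move=> k _; ring.
rewrite E subr_ge0 in H; apply: (le_trans H); apply: ler_sum => k kK.
rewrite -expr2 ler_piMl ?sqr_ge0//; exact: (lam_le1 (cell_card tM cK) (cell_indep tM cK)).
Qed.

(** The factor 4^d is the volume loss of a homothety of ratio 1/4, a further 4 comes from squaring
    |v| >= |v a| / 2, and d + 1 counts the vertices of a cell. *)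
Definition mass_const : R := (4 ^+ d.+1 * d.+1%:R)^-1.

Lemma mass_const_gt0 : 0 < mass_const.
Proof. by rewrite invr_gt0 mulr_gt0 ?exprn_gt0. Qed.

(* near a vertex a where |v| is maximal on the cell K, namely on the image of K under the
   homothety of centre a and ratio 1/4, one has |v| >= |v a| / 2 *)
Lemma cell_mass_ge v K : piecewise_affine M v -> K \in cells M ->
  mass_const * (\sum_(k in K) vol K * (v (node k) * v (node k))) <= \int[mu]_(x in ocell K) (v x * v x).
Proof.
move=> pv cK; have Lv := pw_affine_L2 pv; have cd := cell_card tM cK; have ai := cell_indep tM cK.
have mK := @measurable_ocell _ _ M K.
have [k0 k0K] : exists k0, k0 \in K by apply/set0Pn; rewrite -card_gt0 cd.
have [m mK' mmax] : exists2 m, m \in K & forall k, k \in K -> `|v (node k)| <= `|v (node m)|.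
  by case: (@arg_maxP _ _ _ k0 (mem K) (fun k => `|v (node k)|) k0K) => m mK' H; exists m.
(* The inverse of the homothety of centre [node m] and ratio 1/4: [A] below is the small copy of
   [K]. There the coordinate at [m] is at least 3/4, so |v| is at least (3/4 - 1/4) |v (node m)|. *)
pose phi x : 'rV[R]_d := (4 : R) *: x + (- 3 : R) *: node m.
have [mphi sphi] : scales_rV phi (1 * (4 : R)^-1 ^+ d).
  have := scales_rV_comp (scales_rV_translate ((- 3 : R) *: node m)) (scales_rV_dilate d (_ : 0 < (4 : R))).
  by move/(_ (ltr0n _ 4)); rewrite mulrC.
pose A := phi @^-1` ocell K.
have mA : measurable A by exact: measurable_funT_preimage.
have lamA k x : k \in K -> lam K k x = 4^-1 * lam K k (phi x) + 3 / 4 * (k == m)%:R.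
  move=> kK; have := lam_node cd ai kK mK'; rewrite /phi /lam !dotvDr !dotvZr => <-.
  by rewrite !mulrDr; field.
have AK : A `<=` ocell K.
  move=> x Ax k kK; rewrite lamA// ltr_pwDl ?mulr_ge0 ?ler0n//.
  by rewrite mulr_gt0//; exact: Ax.
have vA : mu A = ((4^-1 ^+ d * vol K)%:E)%E by rewrite sphi// mul1r EFinM -volE.
have vge x : A x -> v (node m) * v (node m) / 4 <= v x * v x.
  move=> Ax; have xK := ocell_simplex tM cK (AK _ Ax).
  have l1 := lam_sum cd ai x.
  have lm : 3 / 4 <= lam K m x.
    by rewrite lamA// eqxx mulr1 lerDr mulr_ge0// ltW//; exact: Ax.
  have [l0 lr] : 0 <= lam K m x /\ \sum_(k in K | k != m) lam K k x <= 1 / 4.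
    by split; [lra|move: l1; rewrite (bigD1 m)//=; lra].
  have : `|v x - v (node m) * lam K m x| <= `|v (node m)| * (1 / 4).
    rewrite (pw_affine_cell_lam pv cK xK) (bigD1 m)//= addrAC subrr add0r.
    rewrite (le_trans (ler_norm_sum _ _ _))// (le_trans _ (ler_wpM2l (normr_ge0 _) lr))// mulr_sumr.
    apply: ler_sum => k /andP[kK _]; rewrite normrM ler_pM ?mmax//.
    by rewrite ger0_norm// ltW//; exact: AK.
  rewrite -!expr2 -(real_normK (num_real (v x))) -(real_normK (num_real (v (node m)))) => H.
  have H2 : `|v (node m)| / 2 <= `|v x|.
    have : `|v (node m) * lam K m x| <= `|v x| + `|v x - v (node m) * lam K m x|.
      rewrite -[X in `|X| <= _](subKr (v x)); exact: ler_normB.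
    rewrite normrM (ger0_norm l0); have := ler_wpM2l (normr_ge0 (v (node m))) lm; nra.
  rewrite (_ : _ / 4 = (`|v (node m)| / 2) ^+ 2); last by field.
  by rewrite lerXn2r ?nnegrE// divr_ge0.
apply: (@le_trans _ _ (\int[mu]_(x in A) (v x * v x))).
  apply: (@le_trans _ _ (\int[mu]_(x in A) (v (node m) * v (node m) / 4))).
    rewrite Rintegral_cst//.
    rewrite /= vA /= -mulr_sumr.
    have : \sum_(k in K) v (node k) * v (node k) <= \sum_(k in K) v (node m) * v (node m).
      apply: ler_sum => k kK; rewrite -!expr2 -(real_normK (num_real (v (node k)))) -[leRHS](real_normK (num_real (v (node m)))).
      by rewrite lerXn2r ?nnegrE// mmax.
    rewrite sumr_const cd -(mulr_natr _ d.+1) => H.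
    have c0 : 0 <= mass_const * vol K by rewrite mulr_ge0 ?vol_ge0// ltW// mass_const_gt0.
    rewrite mulrA; apply: le_trans (ler_wpM2l c0 H) _.
    rewrite /mass_const exprS exprVn le_eqVlt; apply/orP; left; apply/eqP.
    have z0 : (4 : R) ^+ d != 0 by rewrite expf_neq0.
    have n0 : (d.+1%:R : R) != 0 by rewrite pnatr_eq0.
    by move: z0 n0; move: (4 ^+ d) (d.+1%:R) (vol K) => z n V z0 n0; field; rewrite z0 n0.
  apply: le_Rintegral => //.
    by apply: (integrableS mD) (L2_integrable oD bD (L2_cst oD bD _)) => //; apply: subset_trans AK _; exact: (ocell_sub tM cK).
  by apply: integrableS AK _ => //; exact: Rint_cell.
have -> : ocell K = A `|` (ocell K `\` A) by rewrite setDUK.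
rewrite Rintegral_setU//.
- rewrite lerDl; apply: Rintegral_ge0 => x _; by rewrite -expr2 sqr_ge0.
- exact: measurableD.
- by rewrite setDUK//; exact: Rint_cell.
- by rewrite disj_set2E; apply/eqP; rewrite setDE setICA setICr setI0.
Qed.

Lemma lump_le_ip v : piecewise_affine M v -> mass_const * lump v v <= ip D v v.
Proof.
move=> pv; rewrite ip_cells; [|exact: pw_affine_L2..].
by rewrite mulr_sumr; apply: ler_sum => K cK; exact: cell_mass_ge.
Qed.

Lemma lump_eq0 v : lump v v = 0 -> forall i, v (node i) = 0.
Proof.
move=> v0 i; have [K cK iK] := node_cell tM i; apply/eqP; rewrite -sqrf_eq0 -(mulrI_eq0 _ (mulfI (lt0r_neq0 (vol_gt0 cK)))).
rewrite eq_le; apply/andP; split; last by rewrite mulr_ge0 ?sqr_ge0// vol_ge0.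
rewrite -v0 /lump (bigD1 K)//= (bigD1 i)//= -addrA expr2 lerDl addr_ge0//.
  by apply: sumr_ge0 => k _; rewrite -expr2 mulr_ge0 ?sqr_ge0// vol_ge0.
by apply: sumr_ge0 => L /andP[cL _]; apply: sumr_ge0 => k _; rewrite -expr2 mulr_ge0 ?sqr_ge0// vol_ge0.
Qed.

Lemma ip_eq0_node v : piecewise_affine M v -> ip D v v = 0 -> forall i, v (node i) = 0.
Proof.
move=> pv v0; apply: lump_eq0; apply/eqP; rewrite eq_le; apply/andP; split.
  by rewrite -(ler_pM2l mass_const_gt0) mulr0 -v0 lump_le_ip.
by apply: sumr_ge0 => L cL; apply: sumr_ge0 => k _; rewrite -expr2 mulr_ge0 ?sqr_ge0// vol_ge0.
Qed.

Definition fe (U : idx -> R) x : R := \sum_i U i * hat i x.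

Lemma fe_node U i : fe U (node i) = U i.
Proof.
rewrite /fe (bigD1 i)//= (hat_node tM) eqxx mulr1 big1 ?addr0// => j ji.
by rewrite (hat_node tM) (negbTE ji) mulr0.
Qed.

Lemma ip_pw_affine v w : L2 D v -> piecewise_affine M w ->
  ip D v w = \sum_(i : idx) w (node i) * ip D v (hat i).
Proof.
move=> Lv pw; rewrite ipC (ip_eq (v' := fun x => \sum_(i : idx) w (node i) * hat i x) (w' := v))//; last first.
  by move=> x Dx; apply: (pw_affine_hat tM pw); exact: sD.
rewrite (ip_suml oD bD)//; first by apply: eq_bigr => i _; rewrite ipC.
by move=> i; apply: pw_affine_L2; exact: pw_affine_hat1.
Qed.

Lemma ip_grad_pw_affine v w : Hs D 1 v -> piecewise_affine M w ->
  ip_grad D v w = \sum_(i : idx) w (node i) * ip_grad D v (hat i).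
Proof.
move=> Lv pw; rewrite ip_gradC (ip_grad_eq oD bD (v' := fun x => \sum_(i : idx) w (node i) * hat i x) (w' := v))//; last exact: pw_affine_Hs1.
  have Hh (i : idx) : Hs D 1 (hat i) by apply: pw_affine_Hs1; exact: pw_affine_hat1.
  rewrite (ip_grad_suml oD bD (index_enum idx) (fun i => w (node i)) Hh Lv).
  by apply: eq_bigr => i _; rewrite ip_gradC.
by move=> x Dx; apply: (pw_affine_hat tM pw); exact: sD.
Qed.

(** The mass matrix is injective because a zero L2 norm forces zero nodal values. This provides the
    witnesses which make the [xget] in the projection and in the discrete Laplacian meaningful. *)
Lemma riesz (l : idx -> R) : exists2 v, piecewise_affine M v & forall i, ip D v (hat i) = l i.
Proof.
pose A : 'M[R]_(nb_nodes M) := \matrix_(i, j) ip D (hat i) (hat j).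
have LH i : L2 D (hat i) by apply: pw_affine_L2; exact: pw_affine_hat1.
have AE (U : 'rV[R]_(nb_nodes M)) j : (U *m A) ord0 j = ip D (fe (fun i => U ord0 i)) (hat j).
  by rewrite mxE (ip_suml oD bD)//; apply: eq_bigr => i _; rewrite mxE.
have uA : A \in unitmx.
  rewrite -row_free_unit; apply: inj_row_free => U UA; apply/rowP => i; rewrite mxE.
  rewrite -(fe_node (fun i => U ord0 i) i); apply: ip_eq0_node; first exact: (pw_affine_comb tM).
  rewrite (ip_pw_affine (pw_affine_L2 (pw_affine_comb tM _)) (pw_affine_comb tM _)) big1// => j _.
  by rewrite -AE UA mxE mulr0.
exists (fe (fun i => (\row_j l j *m invmx A) ord0 i)); first exact: (pw_affine_comb tM).
by move=> i; rewrite -AE mulmxKV// mxE.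
Qed.

Lemma L2_projectionP v : L2 D v -> Vh D M (L2_projection D M v) /\
  forall z, Vh D M z -> ip D (L2_projection D M v) z = ip D v z.
Proof.
move=> Lv; rewrite /L2_projection; case: xgetP => //.
have [p pp pE] := riesz (fun i => ip D v (hat i)).
move/(_ p) => []; split; first exact/VhP.
move=> z /VhP pz; rewrite (ip_pw_affine (pw_affine_L2 pp) pz) (ip_pw_affine Lv pz).
by apply: eq_bigr => i _; rewrite pE.
Qed.

Lemma discrete_laplacianP v : piecewise_affine M v -> Vh D M (discrete_laplacian D M v) /\
  forall z, Vh D M z -> ip D (discrete_laplacian D M v) z = - ip_grad D v z.
Proof.
move=> pv; rewrite /discrete_laplacian; case: xgetP => //.
have [p pp pE] := riesz (fun i => - ip_grad D v (hat i)).
move/(_ p) => []; split; first exact/VhP.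
move=> z /VhP pz; rewrite (ip_pw_affine (pw_affine_L2 pp) pz) (ip_grad_pw_affine (pw_affine_Hs1 pv) pz) -sumrN.
by apply: eq_bigr => i _; rewrite pE mulrN.
Qed.

(** Turns nodal values of a projection or a discrete Laplacian, known only through their pairings,
    into explicit expressions; measurability rests on this. *)
Lemma point_evaluation i : exists2 r, piecewise_affine M r & forall v, piecewise_affine M v -> v (node i) = ip D v r.
Proof.
have [r pr rE] := riesz (fun j => (i == j)%:R); exists r => // v pv.
rewrite ipC (ip_pw_affine (pw_affine_L2 pr) pv) (bigD1 i)//= rE eqxx mulr1 big1 ?addr0// => j ji.
by rewrite rE eq_sym (negbTE ji) mulr0.
Qed.

End finite_element_space.

(** * Stiffness matrix and dihedral angles *)

Section gram.
Context {R : realType}.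

Lemma dotvE d (x y : 'rV[R]_d) : dotv x y = (x *m y^T) ord0 ord0.
Proof. by rewrite mxE; apply: eq_bigr => i _; rewrite mxE. Qed.

Lemma det2 (A : 'M[R]_2) : \det A = A ord0 ord0 * A ord_max ord_max - A ord0 ord_max * A ord_max ord0.
Proof.
rewrite (expand_det_row _ ord0) !big_ord_recl big_ord0 addr0 /cofactor !det_mx11 !mxE /=.
have -> : lift ord0 ord0 = ord_max :> 'I_2 by exact: val_inj.
have -> : lift (ord_max : 'I_2) (ord0 : 'I_1) = ord0 by exact: val_inj.
by rewrite expr0 expr1 mul1r mulN1r mulrN.
Qed.

(** [E] is a unit upper triangular matrix times the rows p, q, W. So (det E)^2 is the Gram
    determinant of these rows, which is block diagonal as p and q are orthogonal to W. *)
Lemma det_gram_split d k (E : 'M[R]_d) (p q : 'rV[R]_d) (W : 'M[R]_(k, d)) (c1 c2 : 'rV[R]_k) :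
  d = (1 + 1 + k)%N ->
  (forall r : 'I_d, r = 0%N :> nat -> row r E = p + c1 *m W) ->
  (forall r : 'I_d, r = 1%N :> nat -> row r E = q + c2 *m W) ->
  (forall (r : 'I_d) (t : 'I_k), r = (2 + t)%N :> nat -> row r E = row t W) ->
  p *m W^T = 0 -> q *m W^T = 0 ->
  \det E ^+ 2 = (dotv p p * dotv q q - dotv p q ^+ 2) * \det (W *m W^T).
Proof.
move=> dk; subst d => E0 E1 E2 pW qW.
pose P : 'M[R]_(1 + 1, 1 + 1 + k) := col_mx p q.
have -> : E = block_mx 1%:M (col_mx c1 c2 : 'M[R]_(1 + 1, k)) 0 1%:M *m col_mx P W.
  rewrite mul_block_col !mul1mx mul0mx add0r mul_col_mx add_col_mx; apply/row_matrixP => r.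
  case: (splitP r) => t rt.
    have -> : r = lshift k t by exact: val_inj.
    rewrite rowKu; case: (splitP t) => s ts.
      have -> : t = lshift 1 s by exact: val_inj.
      by rewrite rowKu row_id E0//= ord1.
    have -> : t = rshift 1 s by exact: val_inj.
    by rewrite rowKd row_id E1//= ord1.
  have -> : r = rshift (1 + 1) t by exact: val_inj.
  by rewrite rowKd (E2 _ t).
rewrite det_mulmx det_ublock !det1 !mul1r expr2 -[X in _ * X]det_tr -det_mulmx tr_col_mx mul_col_row.
rewrite !mul_col_mx pW qW col_mx0 -[W *m P^T]trmxK trmx_mul trmxK mul_col_mx pW qW col_mx0 trmx0 det_ublock.
congr (_ * _); rewrite det2 tr_col_mx.
have e0 : (ord0 : 'I_2) = lshift 1 (ord0 : 'I_1) by exact: val_inj.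
have e1 : (ord_max : 'I_2) = rshift 1 (ord0 : 'I_1) by exact: val_inj.
rewrite !mul_mx_row e0 e1 !(@col_mxEu _ 1 1) !(@col_mxEd _ 1 1) !(@row_mxEl _ 1 1 1) !(@row_mxEr _ 1 1 1).
by rewrite -!dotvE expr2 (dotvC q p).
Qed.

Lemma dotv_CS d (p q : 'rV[R]_d) : 0 <= dotv p p * dotv q q - dotv p q ^+ 2.
Proof.
have [q0|q0] := eqVneq (dotv q q) 0.
  by rewrite (dotv_eq0 q0) !dotv0r mulr0 expr0n subr0.
have qq : 0 < dotv q q by rewrite lt0r q0 dotv_ge0.
rewrite -(pmulr_rge0 _ qq).
have := dotv_ge0 (dotv q q *: p - dotv p q *: q).
rewrite dotvDl !dotvDr !dotvNl !dotvNr !dotvZl !dotvZr (dotvC q p).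
by move=> H; apply: le_trans H _; rewrite le_eqVlt; apply/orP; left; apply/eqP; ring.
Qed.

End gram.

Section cell_geometry.
Context {R : realType} {d : nat}.
Variables (M : mesh R d) (K : {set 'I_(nb_nodes M)}).
Hypotheses (cK : #|K| = d.+1) (aK : affinely_independent K).
Local Notation idx := 'I_(nb_nodes M).
Let mu := lebesgue_rV R d.
Implicit Types (i j k l : idx) (x y : 'rV[R]_d).

Lemma lamb_diff k l l' : k \in K -> l \in K -> l' \in K ->
  dotv (lamb K k) (node l - node l') = (k == l)%:R - (k == l')%:R.
Proof.
move=> kK lK lK'; rewrite -(lam_node cK aK kK lK) -(lam_node cK aK kK lK') /lam dotvDr dotvNr; ring.
Qed.

Lemma sum_lamb : \sum_(k in K) lamb K k = 0.
Proof.
have H x : dotv (\sum_(k in K) lamb K k) x = 0.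
  have := lam_sum cK aK x; have := lam_sum cK aK 0; rewrite /lam !big_split/= -dotv_suml.
  by rewrite dotv0r add0r -dotv_suml => -> /(canRL (addrK _)); rewrite subrr.
exact/dotv_eq0.
Qed.

Section edges.
Variables (b : idx) (es : seq idx).
Hypothesis Kes : perm_eq (b :: es) (enum K).

Definition edge_mx : 'M[R]_d := \matrix_(r < d) (node (nth b es r) - node b).
Let L : 'M[R]_d := \matrix_(r, s) lamb K (nth b es s) ord0 r.

Lemma size_edges : size es = d.
Proof. by have := perm_size Kes; rewrite -cardE cK /= => -[]. Qed.

Lemma base_in : b \in K.
Proof. by rewrite -mem_enum -(perm_mem Kes) mem_head. Qed.

Lemma edge_in (r : 'I_d) : nth b es r \in K.
Proof. by rewrite -mem_enum -(perm_mem Kes) inE mem_nth ?orbT// size_edges. Qed.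

Lemma edge_neq (r : 'I_d) : nth b es r != b.
Proof.
have : uniq (b :: es) by rewrite (perm_uniq Kes) enum_uniq.
by rewrite cons_uniq => /andP[/negP H _]; apply/eqP => E; apply: H; rewrite -{1}E mem_nth// size_edges.
Qed.

Lemma sum_edges (V : zmodType) (G : idx -> V) : \sum_(k in K) G k = G b + \sum_(r < d) G (nth b es r).
Proof.
rewrite -big_enum -(perm_big _ Kes)/= big_cons; congr (_ + _).
by rewrite (big_nth b) size_edges big_mkord.
Qed.

Lemma mul_lamb_mx y (r : 'I_d) : (y *m L) ord0 r = dotv (lamb K (nth b es r)) y.
Proof. by rewrite mxE; apply: eq_bigr => s _; rewrite mxE mulrC. Qed.

(** The gradients form the basis dual to the edges issuing from [b]: expand [node b + y] in
    barycentric coordinates about [node b], with [y] a coordinate vector. *)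
Lemma lamb_edge_mx : L *m edge_mx = 1%:M.
Proof.
apply/row_matrixP => s; rewrite !rowE mulmxA mulmx1.
set y : 'rV[R]_d := delta_mx _ _.
have lb : lam K b (node b) = 1 by rewrite (lam_node cK aK base_in base_in) eqxx.
have E : \sum_(k in K) lam K k (node b + y) *: (node k - node b) = y.
  under eq_bigr do rewrite scalerBr.
  by rewrite sumrB (lam_comb cK aK) -scaler_suml (lam_sum cK aK) scale1r addrC addKr.
rewrite -[RHS]E sum_edges subrr scaler0 add0r; apply/rowP => t; rewrite mxE summxE.
apply: eq_bigr => r _; rewrite mul_lamb_mx [in RHS]mxE [edge_mx _ _]mxE; congr (_ * _).
by rewrite lamD (lam_node cK aK (edge_in r) base_in) (negbTE (edge_neq r)) add0r.
Qed.

Lemma edge_mx_unit : edge_mx \in unitmx.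
Proof. by have [_ ->] := mulmx1_unit lamb_edge_mx. Qed.

End edges.
End cell_geometry.

(** * Volume of a simplex as a determinant *)

Section reference_simplex.
Context {R : realType}.

Definition ref_simplex d : set 'rV[R]_d := [set y | (forall r, 0 < y ord0 r) /\ \sum_r y ord0 r < 1].

Definition ref_vol d : R := fine (lebesgue_rV R d (@ref_simplex d)).

Lemma ref_vol_ge0 d : 0 <= ref_vol d.
Proof. by rewrite fine_ge0. Qed.

(** [phi] sends a point to its barycentric coordinates other than that of [b], hence [ocell K] onto
    the reference simplex; its matrix is the inverse of [edge_mx]. *)
Lemma vol_edge_mx d (M : mesh R d) (K : {set 'I_(nb_nodes M)}) b es :
  #|K| = d.+1 -> affinely_independent K -> perm_eq (b :: es) (enum K) ->
  vol K = `|\det (edge_mx b es)| * ref_vol d.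
Proof.
move=> cK aK Kes.
pose L : 'M[R]_d := \matrix_(r, s) lamb K (nth b es s) ord0 r.
have LE : L *m edge_mx b es = 1%:M by exact: lamb_edge_mx.
have [uL uE] := mulmx1_unit LE.
have EL : edge_mx b es *m L = 1%:M by exact: mulmx1C.
pose phi x : 'rV[R]_d := (x + - node b) *m L.
have ocE : ocell K = phi @^-1` (@ref_simplex d).
  have lE x (r : 'I_d) : lam K (nth b es r) x = phi x ord0 r.
    rewrite /phi mul_lamb_mx -{1}(subrK (node b) x) addrC lamD.
    by rewrite (lam_node cK aK (edge_in cK Kes r) (base_in Kes)) (negbTE (edge_neq cK Kes r)) add0r.
  have lb x : lam K b x = 1 - \sum_r phi x ord0 r.
    by rewrite -(lam_sum cK aK x) (sum_edges cK Kes) (eq_bigr _ (fun r _ => lE x r)) addrK.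
  apply/seteqP; split => x /=.
    move=> H; split => [r|]; first by rewrite -lE; apply: H; exact: (edge_in cK Kes).
    by have := H b (base_in Kes); rewrite lb subr_gt0.
  move=> [H1 H2] k; rewrite -mem_enum -(perm_mem Kes) inE => /predU1P[->|]; first by rewrite lb subr_gt0.
  move=> /(nthP b)[r]; rewrite (size_edges cK Kes) => rd <-; by rewrite (lE x (Ordinal rd)).
have [mphi sphi] : scales_rV phi (1 * `|\det L|^-1).
  exact: (scales_rV_comp (scales_rV_unitmx uL) (scales_rV_translate (- node b))).
have mref : measurable (@ref_simplex d).
  have [mpsi _] := scales_rV_comp (scales_rV_translate (node b)) (scales_rV_unitmx uE).
  rewrite (_ : @ref_simplex d = ((fun x => x + node b) \o (fun x => x *m edge_mx b es)) @^-1` ocell K).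
    by apply: measurable_funT_preimage => //; exact: measurable_ocell.
  rewrite ocE -comp_preimage (_ : _ \o _ = id)//; apply/funext => x /=.
  by rewrite /phi /= addrK -mulmxA EL mulmx1.
rewrite /vol ocE sphi// mul1r /ref_vol.
have -> : `|\det L|^-1 = `|\det (edge_mx b es)|.
  have := congr1 (fun A : 'M[R]_d => `|\det A|) LE; rewrite /= det_mulmx det1 normr1 normrM => H.
  by rewrite -[LHS]mulr1 -H mulKf// normr_eq0 -unitfE -unitmxE.
(* The product is taken in the extended reals on one side and after [fine] on the other; an infinite
   measure would become 0 on both. *)
have [D0|D0] := eqVneq `|\det (edge_mx b es)| 0; first by rewrite D0 mul0e mul0r.
have : (0 <= lebesgue_rV R d (@ref_simplex d))%E by exact: measure_ge0.
case: (lebesgue_rV R d (@ref_simplex d)) => [r _|_|] //.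
by rewrite /=  gt0_muley ?mulr0// lte_fin lt0r D0 normr_ge0.
Qed.

End reference_simplex.

Section cell_angles.
Context {R : realType} {d : nat}.
Variables (M : mesh R d) (K : {set 'I_(nb_nodes M)}).
Hypotheses (cK : #|K| = d.+1) (aK : affinely_independent K) (d2 : (2 <= d)%N).
Local Notation idx := 'I_(nb_nodes M).
Implicit Types (i j k l : idx) (x y : 'rV[R]_d).
Let d0 : (0 < d)%N. Proof. exact: ltn_trans d2. Qed.

Lemma opp_faceC i j : opp_face K i j = opp_face K j i.
Proof. by rewrite /opp_face finset.setUC. Qed.

Lemma opp_faceP i j k : k \in opp_face K i j -> [/\ k \in K, k != i & k != j].
Proof. by rewrite !inE negb_or => /andP[/andP[-> ->] ->]. Qed.

Lemma sum_opp_face (V : zmodType) (G : idx -> V) i j : i \in K -> j \in K -> i != j ->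
  \sum_(k in K) G k = G i + (G j + \sum_(k in opp_face K i j) G k).
Proof.
move=> iK jK ij; rewrite (bigD1 i)//= (bigD1 j)/=; last by rewrite jK eq_sym.
do 2 congr (_ + _); apply: eq_bigl => k; rewrite !inE negb_or; by case: (k \in K); rewrite ?andbF//= andbT.
Qed.

Lemma card_opp_face i j : i \in K -> j \in K -> i != j -> #|opp_face K i j| = d.-1.
Proof.
move=> iK jK ij; have := sum_opp_face (fun=> 1%R : int) iK jK ij; rewrite !sumr_const cK !natz => E.
by move: E d2; lia.
Qed.

(** Were it 0, then |l_j|^2 l_i = (l_i . l_j) l_j. As d >= 2 there is a third vertex; on the edge
    from it to i, l_i takes the value 1 and l_j the value 0, whence l_j = 0. *)
Lemma lamb_gram_neq0 i j : i \in K -> j \in K -> i != j ->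
  dotv (lamb K i) (lamb K i) * dotv (lamb K j) (lamb K j) - dotv (lamb K i) (lamb K j) ^+ 2 != 0.
Proof.
move=> iK jK ij; apply/eqP => D0.
have [b0 [bK bi bj]] : exists b, [/\ b \in K, b != i & b != j].
  have : (0 < #|opp_face K i j|)%N by rewrite card_opp_face//; move: d2; lia.
  by move=> /card_gt0P[b /opp_faceP bP]; exists b.
pose y := dotv (lamb K j) (lamb K j) *: lamb K i - dotv (lamb K i) (lamb K j) *: lamb K j.
have /dotv_eq0 y0 : dotv y y = 0.
  rewrite /y dotvDl !dotvDr !dotvNl !dotvNr !dotvZl !dotvZr (dotvC (lamb K j) (lamb K i)).
  rewrite (_ : _ + _ = dotv (lamb K j) (lamb K j) *
     (dotv (lamb K i) (lamb K i) * dotv (lamb K j) (lamb K j) - dotv (lamb K i) (lamb K j) ^+ 2)); last by ring.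
  by rewrite D0 mulr0.
have := dotv0l (node i - node b0); rewrite -y0 /y dotvDl dotvNl !dotvZl !lamb_diff// !eqxx.
rewrite (eq_sym i b0) (negbTE bi) (eq_sym j i) (negbTE ij) (eq_sym j b0) (negbTE bj) subrr mulr0 !subr0 mulr1.
by move=> /dotv_eq0 /eqP; rewrite (negbTE (lamb_neq0 cK aK d0 jK)).
Qed.

Lemma altitudeP i j : i \in K -> j \in K -> i != j ->
  aff (opp_face K i j) (node j - altitude K i j) /\
  forall k l, k \in opp_face K i j -> l \in opp_face K i j -> dotv (altitude K i j) (node k - node l) = 0.
Proof.
move=> iK jK ij; rewrite /altitude; case: xgetP => //.
set li := lamb K i; set lj := lamb K j.
pose G := dotv li li * dotv lj lj - dotv li lj ^+ 2.
have G0 : G != 0 by exact: lamb_gram_neq0.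
(* The vector in the plane of the two gradients with l_i . p = 0 and l_j . p = 1. It is orthogonal
   to the opposite face, as both gradients are, and [node j - p] has zero coordinates at i and j. *)
pose p := (dotv li li / G) *: lj - (dotv li lj / G) *: li.
have pj : dotv lj p = 1.
  rewrite /p dotvDr dotvNr !dotvZr (dotvC lj li).
  by rewrite mulrAC (mulrAC (dotv li lj)) -mulrBl -expr2 divff.
have pi : dotv li p = 0 by rewrite /p dotvDr dotvNr !dotvZr; ring.
move/(_ p) => []; split.
  have lp k : lam K k (node j - p) = lam K k (node j) - dotv (lamb K k) p by rewrite lamD dotvNr.
  have lpi : lam K i (node j - p) = 0 by rewrite lp pi (lam_node cK aK)// (negbTE ij) subrr.
  have lpj : lam K j (node j - p) = 0 by rewrite lp pj (lam_node cK aK)// eqxx subrr.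
  exists (fun k => lam K k (node j - p)); split.
    by have := lam_sum cK aK (node j - p); rewrite (sum_opp_face _ iK jK ij) lpi lpj !add0r.
  by have := lam_comb cK aK (node j - p); rewrite (sum_opp_face _ iK jK ij) lpi lpj !scale0r !add0r.
move=> k l /opp_faceP[kK ki kj] /opp_faceP[lK li' lj'].
rewrite /p dotvDl dotvNl !dotvZl !lamb_diff//.
by rewrite !(eq_sym j) !(eq_sym i) (negbTE ki) (negbTE kj) (negbTE li') (negbTE lj') !subr0 !mulr0 subr0.
Qed.

Lemma lamb_altitude i j k : i \in K -> j \in K -> i != j -> (k == i) || (k == j) ->
  dotv (lamb K k) (altitude K i j) = (k == j)%:R.
Proof.
move=> iK jK ij kij; have [[c [c1 cE]] _] := altitudeP iK jK ij.
have kK : k \in K by case/orP: kij => /eqP ->.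
have -> : altitude K i j = node j - (node j - altitude K i j) by rewrite opprB addrC subrK.
rewrite cE -[node j]scale1r -c1 scaler_suml -sumrB dotv_sumr.
rewrite (eq_bigr (fun l => c l * (k == j)%:R)); first by rewrite -mulr_suml c1 mul1r.
move=> l /opp_faceP[lK li lj]; rewrite -scalerBr dotvZr lamb_diff//.
have /negbTE -> : k != l by case/orP: kij => /eqP ->; rewrite eq_sym.
by rewrite subr0.
Qed.

(* In a basis made of the two altitudes p, q and of edges of the opposite face, which is
   orthogonal to p and q, the Gram determinant factors and the gradients of the two barycentric
   coordinates are the basis dual to (p, q) in the plane they span. *)
Lemma cell_stiffness i j : i \in K -> j \in K -> i != j ->
  vol K * dotv (lamb K i) (lamb K j) =
  - (ref_vol d * (d.-2)`!%:R * (simplex_measure (opp_face K i j) * cot (dihedral_angle K i j))).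
Proof.
move=> iK jK ij; set S := opp_face K i j.
have cS : #|S| = d.-1 by exact: card_opp_face.
have cS1 : #|S| = (#|S|.-1).+1 by rewrite cS; move: d2; lia.
set k := #|S|.-1 in cS1 *.
have kd : d.-2 = k by rewrite /k cS.
have dk : d = (1 + 1 + k)%N by move: cS cS1 d2; lia.
set p := altitude K j i; set q := altitude K i j.
have ji : j != i by rewrite eq_sym.
have [[cp [cp1 cpE]] pW] := altitudeP jK iK ji.
have [[cq [cq1 cqE]] qW] := altitudeP iK jK ij.
rewrite (opp_faceC j i) -/S -/p in cp1 cpE pW; rewrite -/S -/q in cq1 cqE qW.
pose s n := nth i (enum S) n.
have sS n : (n <= k)%N -> s n \in S.
  by move=> nk; rewrite -mem_enum mem_nth// -cardE cS1.
have sumS (V : zmodType) (G : idx -> V) : \sum_(l in S) G l = G (s 0%N) + \sum_(t < k) G (s t.+1).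
  by rewrite -big_enum (big_nth i) -cardE cS1 big_mkord big_ord_recl.
pose W : 'M[R]_(k, d) := \matrix_(t < k) (node (s t.+1) - node (s 0%N)).
have rW t : row t W = node (s t.+1) - node (s 0%N) by apply/rowP => u; rewrite !mxE.
have orthW (x : 'rV[R]_d) : (forall l l', l \in S -> l' \in S -> dotv x (node l - node l') = 0) -> x *m W^T = 0.
  move=> H; apply/rowP => t; rewrite !mxE -[RHS](H (s t.+1) (s 0%N)) ?sS//.
  by apply: eq_bigr => u _; rewrite !mxE.
have foot c x : \sum_(l in S) c l = 1 -> x = \sum_(l in S) c l *: node l ->
    x - node (s 0%N) = (\row_t c (s t.+1)) *m W.
  move=> c1 ->; rewrite -[X in _ - X]scale1r -c1 scaler_suml -sumrB sumS subrr add0r mulmx_sum_row.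
  by apply: eq_bigr => t _; rewrite rW mxE scalerBr.
(* The base point is a vertex of the opposite face, and i, j come first: the first two rows of the
   edge matrix are then the altitudes plus combinations of edges of that face. *)
pose es := [:: i, j & behead (enum S)].
have enumS : enum S = s 0%N :: behead (enum S).
  by rewrite /s; move: cS1; rewrite cardE; case: (enum S).
have Kes : perm_eq (s 0%N :: es) (enum K).
  have uS : uniq (enum S) by exact: enum_uniq.
  apply: (@perm_trans _ [:: i, j & enum S]).
    by have /permPl := perm_catCA [:: s 0%N] [:: i; j] (behead (enum S)); rewrite /= -enumS.
  apply: uniq_perm; rewrite ?enum_uniq//=.
    have iS : i \notin S by apply/negP => /opp_faceP[_]; rewrite eqxx.
    have jS : j \notin S by apply/negP => /opp_faceP[_ _]; rewrite eqxx.
    by rewrite uS inE !mem_enum negb_or ij iS jS.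
  move=> l; rewrite !inE !mem_enum !inE negb_or.
  by case: eqVneq => [->|li] /=; [rewrite iK|case: eqVneq => [->|lj] /=; [rewrite jK|]].
have vE := vol_edge_mx cK aK Kes.
pose E : 'M[R]_d := edge_mx (s 0%N) es.
have rE (r : 'I_d) : row r E = node (nth (s 0%N) es r) - node (s 0%N) by apply/rowP => u; rewrite !mxE.
have E0 (r : 'I_d) : r = 0%N :> nat -> row r E = p + (\row_t cp (s t.+1)) *m W.
  by move=> r0; rewrite rE r0 /= -(foot _ _ cp1 cpE) addrA [p + _]addrC subrK.
have E1 (r : 'I_d) : r = 1%N :> nat -> row r E = q + (\row_t cq (s t.+1)) *m W.
  by move=> r0; rewrite rE r0 /= -(foot _ _ cq1 cqE) addrA [q + _]addrC subrK.
have E2 (r : 'I_d) (t : 'I_k) : r = (2 + t)%N :> nat -> row r E = row t W.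
  move=> rt; rewrite rE rt rW; congr (node _ - _).
  rewrite /es add2n /= nth_behead; apply: set_nth_default; rewrite -cardE cS1 ltnS; exact: ltn_ord.
have detE := det_gram_split dk E0 E1 E2 (orthW _ pW) (orthW _ qW).
have uE : E \in unitmx by exact: (edge_mx_unit cK aK Kes).
set G := dotv p p * dotv q q - dotv p q ^+ 2 in detE.
have G0 : 0 < G.
  rewrite lt0r dotv_CS andbT; apply/eqP => G0; move: detE; rewrite G0 mul0r => /eqP.
  by rewrite sqrf_eq0 => /eqP dE; move: uE; rewrite unitmxE dE unitr0.
have lW l : (l == i) || (l == j) -> lamb K l *m W^T = 0.
  move=> lij; apply: orthW => m m' /opp_faceP[mK mi mj] /opp_faceP[m'K m'i m'j].
  have lK : l \in K by case/orP: lij => /eqP ->.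
  rewrite lamb_diff//; case/orP: lij => /eqP ->.
    by rewrite !(eq_sym i) (negbTE mi) (negbTE m'i) subrr.
  by rewrite !(eq_sym j) (negbTE mj) (negbTE m'j) subrr.
have ipi : dotv (lamb K i) p = 1 by rewrite lamb_altitude ?eqxx ?orbT.
have jpi : dotv (lamb K j) p = 0 by rewrite lamb_altitude ?(negbTE ji) ?eqxx ?orbT.
have iqj : dotv (lamb K i) q = 0 by rewrite lamb_altitude ?eqxx//= (negbTE ij).
have jqj : dotv (lamb K j) q = 1 by rewrite lamb_altitude ?eqxx ?orbT.
(* The difference is orthogonal to p, q and the edges of the opposite face, hence to every row of
   the invertible matrix [E]. *)
have dual : G *: lamb K i = dotv q q *: p - dotv p q *: q.
  apply/eqP; rewrite -subr_eq0; apply/eqP; set y := _ - _.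
  have yp : dotv y p = 0.
    by rewrite /y !dotvDl dotvNl dotvDl dotvNl !dotvZl ipi (dotvC q p) /G; ring.
  have yq : dotv y q = 0 by rewrite /y !dotvDl dotvNl dotvDl dotvNl !dotvZl iqj; ring.
  have yW : y *m W^T = 0.
    by rewrite /y !mulmxDl mulNmx mulmxDl mulNmx -!scalemxAl lW ?(orthW _ pW) ?(orthW _ qW) ?scaler0 ?subr0// ?eqxx ?orbT.
  have yE : E *m y^T = 0.
    apply/row_matrixP => r; rewrite row_mul row0.
    have tr0 c : c *m W *m y^T = 0 by rewrite -mulmxA -[W]trmxK -trmx_mul yW trmx0 mulmx0.
    have xy0 (x : 'rV[R]_d) : dotv y x = 0 -> x *m y^T = 0.
      by move=> H; apply/matrixP => a a'; rewrite !ord1 [RHS]mxE -H dotvC dotvE.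
    have := ltn_ord r; rewrite {2}dk !addSn add0n; case: (nat_of_ord r) (E0 r) (E1 r) (E2 r) => [H _ _|[|n] H0 H1 H2] rd.
    - by rewrite H// mulmxDl tr0 xy0// addr0.
    - by rewrite H1// mulmxDl tr0 xy0// addr0.
    have nk : (n < k)%N by move: rd; lia.
    rewrite (H2 (Ordinal nk))// rowE.
    by rewrite tr0.
  by rewrite -[y]trmxK -[y^T]mul1mx -(mulVmx uE) -mulmxA yE mulmx0 trmx0.
have lij : G * dotv (lamb K i) (lamb K j) = - dotv p q.
  by rewrite -dotvZl dual dotvDl dotvNl !dotvZl ![dotv _ (lamb K j)]dotvC jpi jqj; ring.
(* The root of det(W W^T) is (d - 2)! times the measure of the opposite face; the other factor, the
   root of [G], combines with the cotangent. *)
have vol2 : vol K = Num.sqrt (G * \det (W *m W^T)) * ref_vol d.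
  by rewrite vE -detE sqrtr_sqr.
have smE : simplex_measure S = Num.sqrt (\det (W *m W^T)) / (d.-2)`!%:R.
  rewrite /simplex_measure kd; congr (Num.sqrt (\det _) / _).
  have nk t : (t < k.+1)%N -> nth 0 [seq node l | l <- enum S] t = node (s t).
    by move=> tk; rewrite (nth_map i)// -cardE cS1.
  by apply/matrixP => t u; rewrite !mxE !nk ?ltnS//; apply: eq_bigr => v _; rewrite !mxE.
have pq0 : 0 < dotv p p * dotv q q by apply: lt_le_trans G0 _; rewrite /G lerBlDr lerDl sqr_ge0.
(* The sine of the angle is the root of [G] over |p| |q|, by sin^2 = 1 - cos^2; the lengths cancel
   in the quotient. *)
have cotE : cot (dihedral_angle K i j) = dotv p q / Num.sqrt G.
  rewrite /dihedral_angle -/p -/q /cot (dotvC q p) /enorm -sqrtrM ?dotv_ge0// (mulrC (dotv q q)).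
  set m := Num.sqrt (_ * _).
  have m0 : 0 < m by rewrite sqrtr_gt0.
  have m2 : m ^+ 2 = dotv p p * dotv q q by rewrite sqr_sqrtr// ltW.
  have c1 : (dotv p q / m) ^+ 2 <= 1.
    by rewrite expr_div_n ler_pdivrMr ?exprn_gt0// mul1r m2 -subr_ge0 ltW.
  have cb : -1 <= dotv p q / m <= 1.
    by move: c1; move: (_ / m) => z z1; apply/andP; split; nra.
  rewrite acosK ?in_itv//= sin_acos// expr_div_n m2.
  have -> : 1 - dotv p q ^+ 2 / (dotv p p * dotv q q) = G / m ^+ 2.
    by rewrite m2 /G mulrBl divff ?lt0r_neq0.
  rewrite sqrtrM ?(ltW G0)// sqrtrV ?sqr_ge0// sqrtr_sqr gtr0_norm// invfM invrK.
  by field; rewrite !lt0r_neq0// sqrtr_gt0.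
have -> : dotv (lamb K i) (lamb K j) = - dotv p q / G by rewrite -lij mulrAC divff ?mul1r// lt0r_neq0.
rewrite vol2 smE cotE sqrtrM ?(ltW G0)//.
have f0 : ((d.-2)`!%:R : R) != 0 by rewrite pnatr_eq0 -lt0n fact_gt0.
have sG : 0 < Num.sqrt G by rewrite sqrtr_gt0.
rewrite -{2}(sqr_sqrtr (ltW G0)).
by field; rewrite f0 lt0r_neq0.
Qed.

End cell_angles.

(** * Sign of the off-diagonal stiffness entries *)

Section stiffness_sign.
Context {R : realType} {d : nat}.
Variables (M : mesh R d) (D : set 'rV[R]_d).
Hypotheses (d0 : (0 < d)%N) (tM : triangulation M D) (bD : bounded_set D) (hM : mesh_assumption M).
Local Notation idx := 'I_(nb_nodes M).
Implicit Types (i j k : idx) (K : {set idx}).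

Lemma cgrad_hat i K : K \in cells M -> cgrad (hat i) K = lamb K i.
Proof.
move=> cK; rewrite /cgrad; have [iK|iK] := boolP (i \in K).
  rewrite (bigD1 i)//= (hat_node tM) eqxx scale1r big1 ?addr0// => k /andP[_ ki].
  by rewrite (hat_node tM) eq_sym (negbTE ki) scale0r.
rewrite lamb_out// big1// => k kK; rewrite (hat_node tM); case: eqVneq kK => [<-|_ _].
  by rewrite (negbTE iK).
by rewrite scale0r.
Qed.

Lemma pair_subset i j K : ([set i; j] \subset K) = (i \in K) && (j \in K).
Proof.
apply/fintype.subsetP/andP => [H|[iK jK] k]; first by split; apply: H; rewrite inE/=; [left|right].
by rewrite inE/= => -[] ->.
Qed.

Lemma stiffness_le0 i j : i != j -> ip_grad D (hat i) (hat j) <= 0.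
Proof.
move=> ij; rewrite (ip_gradP d0 tM bD (pw_affine_hat1 tM i) (pw_affine_hat1 tM j)).
rewrite (eq_bigr (fun K => if [set i; j] \subset K then vol K * dotv (lamb K i) (lamb K j) else 0)); last first.
  move=> K cK; rewrite !cgrad_hat//; case: ifP => // /negbT; rewrite pair_subset negb_and.
  by move=> /orP[] H; rewrite (lamb_out H) ?dotv0l ?dotv0r mulr0.
(* For d = 1 the mesh assumption says nothing. A cell is then an interval whose two gradients add up
   to 0, so its contribution is minus a square times a length. *)
rewrite -big_mkcondr/=; have [d2|d1] := leqP 2 d; last first.
  apply: sumr_le0 => K /andP[cK]; rewrite pair_subset => /andP[iK jK].
  have cd := cell_card tM cK; have d1' : d = 1%N by move: d0 d1; lia.
  have -> : lamb K j = - lamb K i.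
    apply/eqP; rewrite -addr_eq0 -(sum_lamb cd (cell_indep tM cK)) (bigD1 j)//= (bigD1 i)/=; last by rewrite iK.
    rewrite big_pred0 ?addr0// => k; apply/negbTE/negP => /andP[/andP[kK kj] ki].
    have : (i |: (j |: [set k]))%SET \subset K by apply/fintype.subsetP => l; rewrite !inE => /orP[|/orP[]] /eqP ->.
    move=> /subset_leq_card; rewrite cd !cardsU1 cards1 !inE negb_or ij (eq_sym i) ki (eq_sym j) kj.
    by move: d1'; lia.
  by rewrite dotvNr mulrN oppr_le0 mulr_ge0 ?dotv_ge0// (vol_ge0 tM bD).
rewrite (eq_bigr (fun K => - (ref_vol d * (d.-2)`!%:R * (simplex_measure (opp_face K i j) * cot (dihedral_angle K i j))))); last first.
  move=> K /andP[cK]; rewrite pair_subset => /andP[iK jK].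
  exact: (cell_stiffness (cell_card tM cK) (cell_indep tM cK)).
rewrite sumrN oppr_le0 -mulr_sumr mulr_ge0// ?mulr_ge0 ?ref_vol_ge0 ?ler0n//.
have := hM d2 ij; rewrite pmulr_rge0// invr_gt0 ltr0n muln_gt0 d0/=; by move: d2; lia.
Qed.

End stiffness_sign.

(** * The energy inequality *)

(** The hypothesis is B(- a v + w, - a v + w) >= 0 in the shape in which [en_linl] or [lump_linl]
    expands it. *)
Lemma young_scalar (R : realFieldType) (a x y z : R) : 0 < a ->
  0 <= - a * (- a * x + y) + (- a * y + z) -> 2 * y <= a * x + a^-1 * z.
Proof.
move=> a0 H; rewrite -(ler_pM2l a0) mulrDr (mulrA a a^-1) divff ?lt0r_neq0// mul1r; nra.
Qed.

Lemma ler_odd_exp (R : realFieldType) (q : nat) (a b : R) : odd q -> a <= b -> a ^+ q <= b ^+ q.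
Proof.
move=> oq ab; have [a0|a0] := leP 0 a; first by rewrite lerXn2r// nnegrE// (le_trans a0).
have [b0|b0] := leP 0 b.
  by apply: (@le_trans _ _ 0); [rewrite exprn_odd_le0// ltW|rewrite exprn_odd_ge0].
have H : (- b) ^+ q <= (- a) ^+ q by rewrite lerXn2r ?nnegrE ?oppr_ge0 ?(ltW a0) ?(ltW b0)// lerN2.
by move: H; rewrite (exprNn a) (exprNn b) -(signr_odd _ q) oq expr1 !mulN1r lerN2.
Qed.

Section energy.
Context {R : realType} {d : nat}.
Variables (M : mesh R d) (D : set 'rV[R]_d).
Hypotheses (d0 : (0 < d)%N) (tM : triangulation M D) (bD : bounded_set D) (hM : mesh_assumption M).
Local Notation idx := 'I_(nb_nodes M).
Local Notation pw := (piecewise_affine M).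
Let mu := lebesgue_rV R d.
Implicit Types (K : {set idx}) (i j k l : idx) (x y : 'rV[R]_d) (v w z : 'rV[R]_d -> R).
Let oD := triangulated_open tM.
Let mD := measurable_domain oD.
Let sD : D `<=` closure D := @subset_closure _ D.

(* The stiffness form; for arbitrary functions it is the one of their nodal interpolants. *)
Definition gr v w : R := \sum_(K in cells M) vol K * dotv (cgrad v K) (cgrad w K).
Definition en v w : R := gr v w + lump M v w.

Lemma cgrad_lin a v w K : cgrad (fun x => a * v x + w x) K = a *: cgrad v K + cgrad w K.
Proof.
rewrite /cgrad scaler_sumr -big_split/=; apply: eq_bigr => k _.
by rewrite scalerDl scalerA.
Qed.

Lemma gr_linl a v v' w : gr (fun x => a * v x + v' x) w = a * gr v w + gr v' w.
Proof.
rewrite /gr mulr_sumr -big_split/=; apply: eq_bigr => K _.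
by rewrite cgrad_lin dotvDl dotvZl; ring.
Qed.

Lemma grC v w : gr v w = gr w v.
Proof. by apply: eq_bigr => K _; rewrite dotvC. Qed.

Lemma gr_ge0 v : 0 <= gr v v.
Proof. by apply: sumr_ge0 => K cK; rewrite mulr_ge0 ?dotv_ge0// (vol_ge0 tM bD). Qed.

Lemma gr_node v v' w : (forall i, v (node i) = v' (node i)) -> gr v w = gr v' w.
Proof. by move=> H; apply: eq_bigr => K _; congr (_ * dotv _ _); apply: eq_bigr => k _; rewrite H. Qed.

Lemma lump_linl a v v' w : lump M (fun x => a * v x + v' x) w = a * lump M v w + lump M v' w.
Proof.
rewrite /lump mulr_sumr -big_split/=; apply: eq_bigr => K _.
by rewrite mulr_sumr -big_split/=; apply: eq_bigr => k _; ring.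
Qed.

Lemma lumpC v w : lump M v w = lump M w v.
Proof. by apply: eq_bigr => K _; apply: eq_bigr => k _; rewrite [X in _ * X]mulrC. Qed.

Lemma lump_ge0 v : 0 <= lump M v v.
Proof. by apply: sumr_ge0 => K cK; apply: sumr_ge0 => k _; rewrite -expr2 mulr_ge0 ?sqr_ge0// (vol_ge0 tM bD). Qed.

Lemma lump_node v v' w : (forall i, v (node i) = v' (node i)) -> lump M v w = lump M v' w.
Proof. by move=> H; apply: eq_bigr => K _; apply: eq_bigr => k _; rewrite H. Qed.

Lemma en_linl a v v' w : en (fun x => a * v x + v' x) w = a * en v w + en v' w.
Proof. by rewrite /en gr_linl lump_linl; ring. Qed.

Lemma enC v w : en v w = en w v.
Proof. by rewrite /en grC lumpC. Qed.

Lemma en_ge0 v : 0 <= en v v.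
Proof. by rewrite addr_ge0 ?gr_ge0 ?lump_ge0. Qed.

Lemma en_node v v' w : (forall i, v (node i) = v' (node i)) -> en v w = en v' w.
Proof. by move=> H; rewrite /en (gr_node _ H) (lump_node _ H). Qed.

Lemma gr_pw v w : pw v -> pw w -> ip_grad D v w = gr v w.
Proof. exact: ip_gradP. Qed.

Lemma en_young a v w : 0 < a -> 2 * en v w <= a * en v v + a^-1 * en w w.
Proof.
move=> a0; have := en_ge0 (fun x => - a * v x + w x).
rewrite en_linl !(enC _ (fun x => _ + _)) !en_linl (enC w v) => H; exact: young_scalar.
Qed.

Lemma en_polar u u' v : (forall i, v (node i) = u' (node i) - u (node i)) ->
  en u' u' - en u u + en v v = 2 * en v u'.
Proof.
move=> H; have E w : en v w = - en u w + en u' w.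
  by rewrite (en_node (v' := fun x => -1 * u x + u' x)) ?en_linl ?mulN1r// => i; rewrite H mulN1r addrC.
by rewrite E (enC u v) (enC u' v) !E (enC u' u); ring.
Qed.

Lemma lump_young a v w : 0 < a -> 2 * lump M v w <= a * lump M v v + a^-1 * lump M w w.
Proof.
move=> a0; have := lump_ge0 (fun x => - a * v x + w x).
rewrite lump_linl !(lumpC _ (fun x => _ + _)) !lump_linl (lumpC w v) => H; exact: young_scalar.
Qed.

(** Applied to [gr] and [en], it makes them polynomials in the nodal values, for the matrix argument
    in [gr_pow_ge0] and for measurability. *)
Lemma nodal_expansion (L : ('rV[R]_d -> R) -> R) v :
  (forall a v1 v2, L (fun x => a * v1 x + v2 x) = a * L v1 + L v2) ->
  (forall v1 v2, (forall i, v1 (node i) = v2 (node i)) -> L v1 = L v2) ->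
  L v = \sum_(i : idx) v (node i) * L (hat i).
Proof.
move=> Ll Ln; rewrite (Ln v (fun x => \sum_(i <- index_enum idx) v (node i) * hat i x)); last first.
  move=> j; rewrite (bigD1 j)//= (hat_node tM) eqxx mulr1 big1 ?addr0// => i ij.
  by rewrite (hat_node tM) (negbTE ij) mulr0.
elim: (index_enum idx) => [|i r IH].
  rewrite big_nil (Ln _ (fun x => -1 * 0 + 0)); last by move=> i; rewrite big_nil mulr0 addr0.
  by rewrite (Ll (-1) (fun=> 0) (fun=> 0)); ring.
rewrite big_cons -IH -Ll; apply: Ln => j; by rewrite big_cons.
Qed.

Lemma gr_hatl v w : gr v w = \sum_(i : idx) v (node i) * gr (hat i) w.
Proof.
by apply: (nodal_expansion (L := fun v => gr v w)) => *; [exact: gr_linl|exact: gr_node].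
Qed.

Lemma en_hatl v w : en v w = \sum_(i : idx) v (node i) * en (hat i) w.
Proof.
by apply: (nodal_expansion (L := fun v => en v w)) => *; [exact: en_linl|exact: en_node].
Qed.

Lemma gr_hat v w : gr v w = \sum_(i : idx) \sum_(j : idx) v (node i) * w (node j) * gr (hat i) (hat j).
Proof.
rewrite gr_hatl; apply: eq_bigr => i _; rewrite grC gr_hatl mulr_sumr; apply: eq_bigr => j _.
by rewrite (grC (hat j)) mulrA.
Qed.

Lemma gr_row_sum i : \sum_(j : idx) gr (hat i) (hat j) = 0.
Proof.
rewrite exchange_big/= big1// => K cK.
rewrite -mulr_sumr -dotv_sumr (eq_bigr _ (fun j _ => cgrad_hat tM j cK)).
rewrite (bigID (mem K))/= [X in _ + X]big1 ?addr0; last by move=> j jK; rewrite lamb_out.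
by rewrite (sum_lamb (cell_card tM cK) (cell_indep tM cK)) dotv0r mulr0.
Qed.

Lemma gr_offdiag i j : i != j -> gr (hat i) (hat j) <= 0.
Proof.
by move=> ij; rewrite -(gr_pw (pw_affine_hat1 tM i) (pw_affine_hat1 tM j)); exact: stiffness_le0.
Qed.

(* As the rows of the stiffness matrix A sum to 0, A(v^q, v) is minus one half of the sum of
   A_ij (v_i^q - v_j^q) (v_i - v_j), where the off-diagonal A_ij are nonpositive. *)
Lemma gr_pow_ge0 q v : odd q -> 0 <= gr (fun x => v x ^+ q) v.
Proof.
move=> oq; rewrite -(pmulr_rge0 _ (ltr0n R 2)).
pose S := \sum_(i : idx) \sum_(j : idx) gr (hat i) (hat j) * ((v (node i) ^+ q - v (node j) ^+ q) * (v (node i) - v (node j))).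
have rowj i (c : R) : \sum_(j : idx) c * gr (hat i) (hat j) = 0 by rewrite -mulr_sumr gr_row_sum mulr0.
have T1 : \sum_(i : idx) \sum_(j : idx) v (node i) ^+ q * v (node i) * gr (hat i) (hat j) = 0.
  by rewrite big1// => i _; rewrite rowj.
have T2 : \sum_(i : idx) \sum_(j : idx) v (node j) ^+ q * v (node j) * gr (hat i) (hat j) = 0.
  by rewrite exchange_big/= big1// => j _; rewrite (eq_bigr _ (fun i _ => congr1 _ (grC (hat i) (hat j)))) rowj.
have T3 : \sum_(i : idx) \sum_(j : idx) v (node j) ^+ q * v (node i) * gr (hat i) (hat j) = gr (fun x => v x ^+ q) v.
  rewrite gr_hat exchange_big/=; apply: eq_bigr => j _; apply: eq_bigr => i _; by rewrite grC.
have T4 : \sum_(i : idx) \sum_(j : idx) v (node i) ^+ q * v (node j) * gr (hat i) (hat j) = gr (fun x => v x ^+ q) v.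
  by rewrite gr_hat.
have -> : 2 * gr (fun x => v x ^+ q) v = - S.
  have SE : S = \sum_(i : idx) \sum_(j : idx) (v (node i) ^+ q * v (node i) * gr (hat i) (hat j)
      - v (node i) ^+ q * v (node j) * gr (hat i) (hat j) - v (node j) ^+ q * v (node i) * gr (hat i) (hat j)
      + v (node j) ^+ q * v (node j) * gr (hat i) (hat j)).
    by apply: eq_bigr => i _; apply: eq_bigr => j _; ring.
  rewrite SE; under eq_bigr do rewrite big_split/= !sumrB.
  by rewrite big_split/= !sumrB T1 T2 T3 T4; ring.
rewrite oppr_ge0; apply: sumr_le0 => i _; apply: sumr_le0 => j _.
have [->|ij] := eqVneq i j; first by rewrite !subrr !mulr0.
rewrite mulr_le0_ge0 ?gr_offdiag//.
have mono (a b : R) : a <= b -> a ^+ q <= b ^+ q := ler_odd_exp oq.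
have [vij|/ltW vij] := leP (v (node i)) (v (node j)).
  by rewrite mulr_le0// subr_le0// mono.
by rewrite mulr_ge0// subr_ge0// mono.
Qed.

End energy.

(** * One step of the scheme, path by path *)

Section energy_step.
Context {R : realType} {d : nat}.
Variables (M : mesh R d) (D : set 'rV[R]_d).
Hypotheses (d0 : (0 < d)%N) (tM : triangulation M D) (bD : bounded_set D) (hM : mesh_assumption M).
Local Notation idx := 'I_(nb_nodes M).
Local Notation pw := (piecewise_affine M).
Let mu := lebesgue_rV R d.
Implicit Types (K : {set idx}) (i j k l : idx) (x y : 'rV[R]_d) (v w z : 'rV[R]_d -> R).
Let oD := triangulated_open tM.
Let mD := measurable_domain oD.
Let sD : D `<=` closure D := @subset_closure _ D.

Definition domain_measure : R := fine (mu D).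

Lemma domain_measure_ge0 : 0 <= domain_measure. Proof. exact: fine_ge0. Qed.

Lemma sum_vol : \sum_(K in cells M) vol K = domain_measure.
Proof.
have := Rintegral_ocells d0 tM (L2_integrable oD bD (L2_cst oD bD 1)).
rewrite Rintegral_cst// mul1r -/domain_measure => ->; apply: eq_bigr => K cK.
by rewrite (Rintegral_cst _ (@measurable_ocell _ _ M K)) mul1r.
Qed.

Lemma en_scale a v w : en M (fun x => a * v x) w = a * en M v w.
Proof.
rewrite (@en_node _ _ M (fun x => a * v x) (fun x => (a - 1) * v x + v x)) ?en_linl; first by ring.
by move=> i; ring.
Qed.

Variable q : nat.
Hypotheses (q3 : (3 <= q)%N) (oq : odd q).

(** With y = x^2 and c the inverse of [mass_const], the left side of [pot_bound] is at most (c + 4)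
    y - 2 y^2 + 2, and (c + 4)^2 / 8 is the maximum of its y-dependent part. *)
Definition pot_const : R := ((mass_const (R := R) (d := d))^-1 + 4) ^+ 2 / 8 + 2.

Lemma pot_const_ge0 : 0 <= pot_const.
Proof. by rewrite addr_ge0// divr_ge0// sqr_ge0. Qed.

Lemma pot_bound (x : R) :
  ((mass_const (R := R) (d := d))^-1 + 2) * (x * x) + 2 * ((x - x ^+ q) * x) <= pot_const.
Proof.
(* q + 1 is even and at least 4, so x^(q+1) dominates x^4 once x^2 >= 1; otherwise the left side is
   at most 0. *)
set c := (mass_const)^-1; have x4 : x ^+ 4 - 1 <= x ^+ q * x.
  have [n qn] : exists n, q.+1 = (4 + n.*2)%N.
    by exists ((q.+1 - 4)./2); move: q3 oq; lia.
  rewrite -exprSr qn exprD -mul2n exprM.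
  have y0 : 0 <= x ^+ 2 by exact: sqr_ge0.
  have -> : x ^+ 4 = (x ^+ 2) ^+ 2 by rewrite -exprM.
  move: y0; move: (x ^+ 2) => y y0; have [y1|y1] := leP 1 y.
    have : 1 <= y ^+ n by rewrite exprn_ege1.
    have := sqr_ge0 y; nra.
  by apply: (@le_trans _ _ 0); [nra|rewrite mulr_ge0 ?exprn_ge0].
have := sqr_ge0 (2 * x ^+ 2 - (c + 4) / 2); rewrite /pot_const -/c.
have E4 : x ^+ 4 = x ^+ 2 * x ^+ 2 by rewrite -exprD.
rewrite E4 in x4.
rewrite -expr2; move: x4; nra.
Qed.

(** [pot_bound] summed over vertices with the weights of [lump]: each of the d + 1 vertices of a
    cell carries the full volume of that cell. *)
Definition step_const : R := pot_const * d.+1%:R * domain_measure.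

Lemma step_const_ge0 : 0 <= step_const.
Proof. by rewrite !mulr_ge0 ?pot_const_ge0 ?domain_measure_ge0. Qed.

Lemma energy_step u u' G (tau om : R) : pw u -> pw u' -> L2 D G -> 0 <= tau ->
  let F := interpolant D M (fun x => u' x - u' x ^+ q) in
  let z := L2_projection D M G in
  let l := discrete_laplacian D M u' in
  let dl := fun x => u' x - u x in
  (forall v, Vh D M v -> ip D u' v + tau * ip_grad D u' v = ip D u v + tau * ip D F v + ip D G v * om) ->
  en M u' u' + 2^-1 * en M dl dl + tau / 2 * ip D l l <=
    en M u u + tau * step_const + 2 * om * en M z u + 2 * om ^+ 2 * en M z z.
Proof.
move=> pu pu' LG t0 F z l dl S.
have [/(VhP d0 tM bD) pz zE] := L2_projectionP d0 tM bD LG; rewrite -/z in pz zE.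
have [/(VhP d0 tM bD) pl lE] := discrete_laplacianP d0 tM bD pu'; rewrite -/l in pl lE.
have pF : pw F by exact: interpolant_pw_affine.
have L v : pw v -> L2 D v by exact: pw_affine_L2.
have V v : pw v -> Vh D M v by move=> pv; apply/(VhP d0 tM bD).
have FE i : F (node i) = u' (node i) - u' (node i) ^+ q by exact: interpolant_node.
(* The residual of the nodal identity, nested to fit [ip_linl]. Testing the scheme with [r] itself
   shows that its L2 norm is 0, hence that its nodal values vanish. *)
pose r x := - tau * l x + (- 1 * u x + (- tau * F x + (- om * z x + u' x))).
have p1 : pw (fun x => - om * z x + u' x) by exact: pw_affine_lin.
have p2 : pw (fun x => - tau * F x + (- om * z x + u' x)) by exact: pw_affine_lin.
have p3 : pw (fun x => - 1 * u x + (- tau * F x + (- om * z x + u' x))) by exact: pw_affine_lin.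
have pr : pw r by exact: pw_affine_lin.
have r0 : ip D r r = 0.
  have Lr := L _ pr.
  rewrite {1}/r (ip_linl oD (- tau) (L _ pl) (L _ p3) Lr) (ip_linl oD (- 1) (L _ pu) (L _ p2) Lr).
  rewrite (ip_linl oD (- tau) (L _ pF) (L _ p1) Lr) (ip_linl oD (- om) (L _ pz) (L _ pu') Lr).
  by rewrite lE ?zE; [|exact: V..]; have := S _ (V _ pr); lra.
have rn i : u' (node i) - u (node i) = tau * l (node i) + (tau * F (node i) + om * z (node i)).
  by have := ip_eq0_node d0 tM bD pr r0 i; rewrite /r; lra.
have dE w : en M dl w = tau * en M l w + (tau * en M F w + om * en M z w).
  rewrite (@en_node _ _ M dl (fun x => tau * l x + (tau * F x + om * z x))); last by move=> i; rewrite /dl rn.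
  by rewrite !en_linl en_scale.
have glu : gr M l u' = - ip D l l.
  by rewrite grC -(gr_pw d0 tM bD pu' pl) lE ?opprK//; exact: V.
have guu : gr M u' u' = - ip D l u'.
  by rewrite -(gr_pw d0 tM bD pu' pu') lE ?opprK//; exact: V.
have gFu : gr M F u' <= gr M u' u'.
  rewrite (@gr_node _ _ M F (fun x => -1 * u' x ^+ q + u' x)); last by move=> i; rewrite FE; ring.
  by rewrite gr_linl mulN1r gerDr oppr_le0; exact: (gr_pow_ge0 d0 tM bD hM).
set c0 := mass_const (R := R) (d := d).
have c00 : 0 < c0 by exact: mass_const_gt0.
(* Young with weight [c0], the constant for which c0 L(l, l) is at most the squared L2 norm of l. *)
have H1 : 2 * lump M l u' <= ip D l l + c0^-1 * lump M u' u'.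
  apply: le_trans (lump_young tM bD l u' c00) _; rewrite lerD2r.
  exact: (lump_le_ip d0 tM bD pl).
(* a(u', u') = - (l, u'), and the norm of l / 2 + u' is nonnegative. *)
have H2 : 2 * gr M u' u' <= 2^-1 * ip D l l + 2 * lump M u' u'.
  have := ip_ge0 D (fun x => 2^-1 * l x + u' x); have Lh : L2 D (fun x => 2^-1 * l x + u' x).
    by apply: (L2_lin oD); exact: L.
  rewrite (ip_linl oD)//; [|exact: L..]; rewrite !(ipC _ _ (fun x => _ + _)) !(ip_linl oD)//; [|exact: L..].
  rewrite guu (ipC _ u' l); have := ip_le_lump d0 tM bD pu'; lra.
have H3 : (c0^-1 + 2) * lump M u' u' + 2 * lump M F u' <= step_const.
  rewrite /step_const -sum_vol !mulr_sumr -big_split/=; apply: ler_sum => K cK.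
  rewrite !mulr_sumr -big_split/= (_ : _ * vol K = \sum_(k in K) pot_const * vol K); last first.
    by rewrite sumr_const (cell_card tM cK) -mulr_natr; ring.
  apply: ler_sum => k kK; rewrite FE.
  have := ler_wpM2l (vol_ge0 tM bD cK) (pot_bound (u' (node k))); rewrite -/c0; lra.
(* Balance for |l|^2: -2 from 2 a(l, u'), +1 from [H1], +1/2 from [H2]. The multiples of L(u', u')
   are those taken care of by [H3]. *)
have T : 2 * en M l u' + 2 * en M F u' <= - 2^-1 * ip D l l + step_const.
  rewrite /en glu; lra.
have P := en_polar (v := dl) (fun i => erefl : dl (node i) = u' (node i) - u (node i)).
rewrite (dE u') in P.
(* Replaces the new iterate by the old one, which is independent of the increment. *)
have zu : en M z u' = en M z u + en M z dl.
  rewrite !(enC _ z) (@en_node _ _ M u' (fun x => 1 * dl x + u x)); first by rewrite en_linl mul1r addrC.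
  by move=> i; rewrite /dl mul1r subrK.
(* Weight 2 leaves 1/2 of E(u' - u) in the estimate and costs 2 om^2 E(z). *)
have Y := en_young tM bD (fun x => om * z x) dl (ltr0n R 2).
have Y1 := en_scale om z dl; have Y2 : en M (fun x => om * z x) (fun x => om * z x) = om ^+ 2 * en M z z.
  by rewrite (en_scale om z) enC (en_scale om z) mulrA expr2.
rewrite Y1 Y2 in Y.
have T' := ler_wpM2l t0 T.
rewrite zu in P; nra.
Qed.

End energy_step.

(** * H1-stability of the projection and growth of the noise coefficient *)

Section projection_stability.
Context {R : realType} {d : nat}.
Variables (M : mesh R d) (D : set 'rV[R]_d).
Hypotheses (d0 : (0 < d)%N) (tM : triangulation M D) (hD : bounded_domain D).
Local Notation idx := 'I_(nb_nodes M).
Local Notation pw := (piecewise_affine M).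
Let mu := lebesgue_rV R d.
Implicit Types (K : {set idx}) (i j k l : idx) (x y : 'rV[R]_d) (v w z : 'rV[R]_d -> R).
Let bD : bounded_set D. Proof. by case: hD. Qed.
Let oD := triangulated_open tM.
Let mD := measurable_domain oD.

(** Needed to divide the projection estimate by h. As [mesh_size] is a [sup], the set of lengths has
    to be shown bounded before a single edge can serve as a lower bound. *)
Lemma mesh_size_gt0 : 0 < mesh_size M.
Proof.
have [x Dx] : D !=set0 by case: hD.
have [K cK _] := domain_simplex tM (@subset_closure _ D _ Dx).
have cd := cell_card tM cK; have ai := cell_indep tM cK.
have [i [j [iK jK ij]]] : exists i j, [/\ i \in K, j \in K & i != j].
  have : (1 < #|K|)%N by rewrite cd ltnS.
  by move=> /card_gt1P[i [j [iK jK ij]]]; exists i, j.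
have nij : node i != node j.
  apply/eqP => E; have := lam_node cd ai iK iK; rewrite E (lam_node cd ai iK jK) eqxx (negbTE ij).
  by move=> /eqP; rewrite eq_sym oner_eq0.
apply: (@lt_le_trans _ _ (enorm (node i - node j))).
  rewrite sqrtr_gt0 lt0r dotv_ge0 andbT; apply/eqP => /dotv_eq0 /eqP.
  by rewrite subr_eq0 (negbTE nij).
apply: ub_le_sup; last by exists K, (node i), (node j); split => //; exact: (simplex_node cd ai).
have [B [_ /(_ (B + 1))]] := bD; rewrite ltrDl ltr01 => /(_ isT) HB.
have {}HB y : closure D y -> `|y| <= B + 2.
  move=> /(_ _ (nbhsx_ballx y 1 ltr01))[z [Dz]]; rewrite -ball_normE/= => yz.
  by have := HB _ Dz; rewrite /= => Bz; have := ler_normD (y - z) z; rewrite subrK; lra.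
exists (Num.sqrt (\sum_(i < d) (2 * (B + 2)) ^+ 2)) => _ [K' [y [z [cK' yK zK ->]]]].
apply: ler_wsqrtr; apply: ler_sum => k _; rewrite -expr2 -real_normK ?num_real// lerXn2r ?nnegrE//.
  have := HB _ (simplex_closure tM cK' yK); have := normr_ge0 y; lra.
have := coord_le_norm y k; have := coord_le_norm z k.
have := HB _ (simplex_closure tM cK' yK); have := HB _ (simplex_closure tM cK' zK).
rewrite !mxE; have := ler_normB (y ord0 k) (z ord0 k); lra.
Qed.

Variable CP : R.
Hypothesis HP : forall w, Hs D 1 w ->
  let h := mesh_size M in let e := fun x => w x - L2_projection D M w x in
  normL2 D e + h * normL2_grad D e <= CP * h ^+ (minn 2 1) * normHs D 1 w.

(** For s = 1 the estimate bounds h |grad e| by CP h times the H1 norm of [w], where e = w - P_h w;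
    h cancels, and |grad(w - e)|^2 <= 2 |grad w|^2 + 2 |grad e|^2. *)
Lemma projection_grad w : Hs D 1 w ->
  ip_grad D (L2_projection D M w) (L2_projection D M w) <= 2 * (1 + CP ^+ 2) * (ip D w w + ip_grad D w w).
Proof.
move=> Hw; have [Lw _] := Hw; have := HP Hw; set e := fun x => _; set h := mesh_size M => /= H.
have [Vp _] := L2_projectionP d0 tM bD Lw; have [Hp _] := Vp.
set p := L2_projection D M w in e H Vp Hp *.
have h0 : 0 < h := mesh_size_gt0.
have N2 : normHs D 1 w ^+ 2 = ip D w w + ip_grad D w w.
  rewrite sqr_sqrtr/=; last by rewrite addr_ge0 ?ip_ge0//; apply: sumr_ge0 => i _; rewrite addr0 ip_ge0.
  by congr (_ + _); apply: eq_bigr => i _; rewrite addr0.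
have He : normL2_grad D e <= CP * normHs D 1 w.
  rewrite -(ler_pM2l h0); apply: le_trans (_ : _ <= normL2 D e + h * normL2_grad D e) _.
    by rewrite lerDr sqrtr_ge0.
  by apply: le_trans H _; rewrite expr1; rewrite le_eqVlt; apply/orP; left; apply/eqP; ring.
have He2 : ip_grad D e e <= CP ^+ 2 * (ip D w w + ip_grad D w w).
  rewrite -N2 -exprMn -[leLHS](sqr_sqrtr (ip_grad_ge0 D e)) lerXn2r ?nnegrE ?sqrtr_ge0//.
  exact: le_trans (sqrtr_ge0 _) He.
have Hs_e : Hs D 1 (fun x => -1 * p x + w x) by exact: (Hs1_lin oD).
have eE : (fun x => -1 * p x + w x) = e by apply/funext => x; rewrite /e mulN1r addrC.
have ge v : Hs D 1 v -> ip_grad D e v = - ip_grad D p v + ip_grad D w v.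
  by move=> Hv; have := @ip_grad_linl _ _ D oD bD (-1) p w v Hp Hw Hv; rewrite eE mulN1r.
have Hse : Hs D 1 e by rewrite -eE.
have E1 : ip_grad D e e = ip_grad D p p - 2 * ip_grad D p w + ip_grad D w w.
  have := ge e Hse; have := ge p Hp; have := ge w Hw; have := ip_gradC D p e; have := ip_gradC D w e.
  have := ip_gradC D w p; generalize (ip_grad D w e) (ip_grad D e w) (ip_grad D p e) (ip_grad D e p) (ip_grad D w p) (ip_grad D p w) (ip_grad D e e) (ip_grad D p p) (ip_grad D w w); clear => *; lra.
(* |grad(e + w)|^2 >= 0 controls the cross term in |grad(w - e)|^2. *)
have E2 : 0 <= ip_grad D e e + 2 * ip_grad D e w + ip_grad D w w.
  pose s := fun x => 1 * e x + w x; have Hss : Hs D 1 s by exact: (Hs1_lin oD).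
  have := ip_grad_ge0 D s; have := @ip_grad_linl _ _ D oD bD 1 e w s Hse Hw Hss.
  have := @ip_grad_linl _ _ D oD bD 1 e w e Hse Hw Hse; have := @ip_grad_linl _ _ D oD bD 1 e w w Hse Hw Hw.
  have := ip_gradC D e s; have := ip_gradC D w s; have := ip_gradC D e w; rewrite -/s.
  generalize (ip_grad D s s) (ip_grad D s e) (ip_grad D e s) (ip_grad D s w) (ip_grad D w s) (ip_grad D w e) (ip_grad D e w) (ip_grad D e e) (ip_grad D w w); clear => *; lra.
have E3 := ge w Hw; have E4 := ip_gradC D w p.
have := ip_ge0 D w; have := ip_grad_ge0 D w; move: E1 E2 E3 E4 He2.
generalize (ip_grad D w e) (ip_grad D e w) (ip_grad D p e) (ip_grad D e p) (ip_grad D w p) (ip_grad D p w) (ip_grad D e e) (ip_grad D p p) (ip_grad D w w) (ip D w w); clear => *; nra.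
Qed.

Lemma projection_L2 w : L2 D w -> ip D (L2_projection D M w) (L2_projection D M w) <= ip D w w.
Proof.
move=> Lw; have [Vp pE] := L2_projectionP d0 tM bD Lw; set p := L2_projection D M w in Vp pE *.
have Lp : L2 D p by case: Vp => -[].
have := ip_ge0 D (fun x => -1 * p x + w x); have Lh := L2_lin oD (-1) Lp Lw.
rewrite (ip_linl oD)// !(ipC _ _ (fun x => _ + _)) !(ip_linl oD)// (ipC _ p w) -pE//; lra.
Qed.

Definition stab_const : R := 2 * (1 + CP ^+ 2) + (mass_const (R := R) (d := d))^-1.

Lemma stab_const_ge0 : 0 <= stab_const.
Proof. by rewrite addr_ge0 ?invr_ge0 ?(ltW (mass_const_gt0))// mulr_ge0// addr_ge0// sqr_ge0. Qed.

Lemma projection_en w : Hs D 1 w ->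
  en M (L2_projection D M w) (L2_projection D M w) <= stab_const * (ip D w w + ip_grad D w w).
Proof.
move=> Hw; have [Lw _] := Hw; have [/(VhP d0 tM bD) pp _] := L2_projectionP d0 tM bD Lw.
have H1 := projection_grad Hw; have H2 := projection_L2 Lw; have H3 := lump_le_ip d0 tM bD pp.
rewrite /en -(gr_pw d0 tM bD pp pp) /stab_const mulrDl; apply: lerD => //.
have c0 := @mass_const_gt0 R d.
rewrite -(ler_pM2l c0) mulrA divff ?lt0r_neq0// mul1r; apply: le_trans H3 _; apply: le_trans H2 _.
by rewrite lerDl ip_grad_ge0.
Qed.

Variables (g : R -> R) (kappa : R).
Hypotheses (dg : forall x : R, derivable (g : R -> R^o) x 1)
  (cg : continuous (derive1 (g : R -> R^o))) (k0 : 0 < kappa)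
  (lg : forall a b : R, `|g a - g b| <= kappa * `|a - b|).

(** From g(v)^2 <= 2 g(0)^2 + 2 kappa^2 v^2 and |g'(v) grad v| <= kappa |grad v|. *)
Definition growth_const : R := 2 * g 0 ^+ 2 * domain_measure D + 2 * kappa ^+ 2.

Lemma growth_const_ge0 : 0 <= growth_const.
Proof.
by apply: addr_ge0; apply: mulr_ge0; rewrite ?sqr_ge0 ?domain_measure_ge0// mulr_ge0// sqr_ge0.
Qed.

Lemma comp_Hs1 v : pw v -> Hs D 1 (g \o v).
Proof.
move=> pv; split; first exact: (comp_L2 tM bD dg k0 lg).
move=> i; exists (fun x => derive1 (g : R -> R^o) (v x) * pgrad M v i x); split.
  exact: (weak_partial_comp d0 tM bD dg cg k0 lg).
by split => //; exact: (comp_pgrad_L2 tM bD dg cg lg).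
Qed.

Lemma comp_growth v : pw v ->
  ip D (g \o v) (g \o v) + ip_grad D (g \o v) (g \o v) <= growth_const * (1 + en M v v).
Proof.
move=> pv; have [Lgv _] := comp_Hs1 pv; have Lv : L2 D v := pw_affine_L2 tM bD pv.
have H1 : ip D (g \o v) (g \o v) <= 2 * g 0 ^+ 2 * domain_measure D + 2 * kappa ^+ 2 * ip D v v.
  have i2 := L2_mul_integrable oD Lv Lv.
  have ic := L2_integrable oD bD (L2_cst oD bD (2 * g 0 ^+ 2)).
  rewrite /domain_measure -Rintegral_cst// /ip -RintegralZl// -RintegralD//; last first.
    by have := integrableZl mD (2 * kappa ^+ 2) i2; congr (integrable _ _ _).
  apply: le_Rintegral => //; first exact: (L2_mul_integrable oD).
    by have := integrableD mD ic (integrableZl mD (2 * kappa ^+ 2) i2); congr (integrable _ _ _).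
  move=> x _ /=; have := lg (v x) 0; rewrite subr0 => H.
  have : (g (v x) - g 0) ^+ 2 <= kappa ^+ 2 * (v x * v x).
    rewrite -expr2 -exprMn -[leLHS]real_normK ?num_real// -[leRHS]real_normK ?num_real//.
    by rewrite lerXn2r ?nnegrE// normrM (ger0_norm (ltW k0)).
  have := sqr_ge0 (g (v x) - 2 * g 0); nra.
have H2 : ip_grad D (g \o v) (g \o v) <= kappa ^+ 2 * gr M v v.
  rewrite -(gr_pw d0 tM bD pv pv).
  have W (i : 'I_d) := weak_partial_comp d0 tM bD dg cg k0 lg i pv.
  have V (i : 'I_d) := pw_affine_weak_partial d0 tM bD i pv.
  rewrite (ip_gradE oD bD W W) (ip_gradE oD bD V V).
  rewrite mulr_sumr; apply: ler_sum => i _.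
  have [Lp _] := V i; have [Lw _] := W i.
  have ip2 := L2_mul_integrable oD Lp Lp.
  rewrite /ip -RintegralZl//; apply: le_Rintegral => //; first exact: (L2_mul_integrable oD).
    by have := integrableZl mD (kappa ^+ 2) ip2; congr (integrable _ _ _).
  move=> x _ /=; have := derive1_lip dg lg (v x) => H.
  rewrite mulrACA ler_wpM2r// -?expr2 ?sqr_ge0//.
  by rewrite -real_normK ?num_real// lerXn2r ?nnegrE// ltW.
have H3 := ip_le_lump d0 tM bD pv; have H4 := gr_ge0 tM bD v; have H5 := lump_ge0 tM bD v.
have D0 := domain_measure_ge0 D; have g0 := sqr_ge0 (g 0); have kk := sqr_ge0 kappa.
rewrite /growth_const /en.
have : 0 <= g 0 ^+ 2 * domain_measure D * (gr M v v + lump M v v).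
  by apply: mulr_ge0; [exact: mulr_ge0|exact: addr_ge0].
have : kappa ^+ 2 * ip D v v <= kappa ^+ 2 * lump M v v by rewrite ler_wpM2l.
have : 0 <= kappa ^+ 2 * gr M v v by rewrite mulr_ge0.
nra.
Qed.

End projection_stability.

(** * Independence and normal moments *)

Section laws.
Context {R : realType} {disp : measure_display} {Omega : measurableType disp}.
Variable P : probability Omega R.
Local Notation mu := lebesgue_measure.
Implicit Types (X Y : Omega -> R).

Import HBNNSimple.

Section density.
Variables (X : Omega -> R) (p : R -> R).
Hypotheses (mX : measurable_fun setT X) (mp : measurable_fun setT p) (p0 : forall x, 0 <= p x)
  (Xp : forall B : set (measurableTypeR R), measurable B -> P (X @^-1` B) = (\int[mu]_(x in B) (p x)%:E)%E).

Lemma integral_density_indic (r : R) (B : set (measurableTypeR R)) : 0 <= r -> measurable B ->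
  (\int[P]_w (r * \1_B (X w))%:E = \int[mu]_x ((p x)%:E * (r * \1_B x)%:E))%E.
Proof.
move=> r0 mB.
have mXB : measurable (X @^-1` B) by rewrite -[X in measurable X]setTI; exact: mX.
have -> : (\int[P]_w (r * \1_B (X w))%:E = r%:E * P (X @^-1` B))%E.
  under eq_integral do rewrite EFinM.
  rewrite ge0_integralZl_EFin//.
  - rewrite (_ : (fun x => (\1_B (X x))%:E) = EFin \o \1_(X @^-1` B))//.
    by rewrite integral_indic// setIT.
  - by apply/measurable_EFinP; apply: (measurableT_comp (measurable_indic mB) mX).
rewrite Xp// -ge0_integralZl_EFin//; last 2 first.
  - by move=> x _; rewrite lee_fin.
  - by apply/measurable_EFinP/measurable_funTS.
rewrite [LHS]integral_mkcond; apply: eq_integral => x _; rewrite patchE indicE.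
by case: ifPn => xB; rewrite ?mulr1 ?mulr0 ?mule0// muleC.
Qed.

Lemma integral_density_nnsfun (s : {nnsfun R >-> R}) :
  (\int[P]_w (s (X w))%:E = \int[mu]_x ((p x)%:E * (s x)%:E))%E.
Proof.
under [LHS]eq_integral do rewrite fimfunE -fsumEFin//.
rewrite [LHS]ge0_integral_fsum//; last 2 first.
  - move=> r; apply/measurable_EFinP; apply: measurable_funM => //.
    apply: (measurableT_comp _ mX); apply: measurable_indic.
    exact: measurable_funPTI.
  - by move=> n x _; rewrite EFinM nnfun_muleindic_ge0.
under [RHS]eq_integral.
  move=> x xD; rewrite fimfunE -fsumEFin// ge0_mule_fsumr; last first.
    by move=> r; rewrite EFinM nnfun_muleindic_ge0.
  over.
rewrite [RHS]ge0_integral_fsum//; last 2 first.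
  - move=> r; apply/measurable_EFinP; apply: (measurable_funM mp); apply: measurable_funM => //.
  - by move=> n x _; apply: mule_ge0; [rewrite lee_fin|rewrite EFinM nnfun_muleindic_ge0].
apply: eq_fsbigr => r _; have [r0|r0] := leP 0 r; first exact: (@integral_density_indic r (s @^-1` [set r]) r0 (measurable_funPTI s (measurable_set1 r))).
have s0 : s @^-1` [set r] = set0.
  by apply/seteqP; split => // x /= sr; move: r0; rewrite -sr ltNge fun_ge0.
rewrite s0 !integral0_eq// => x _; by rewrite indicE in_set0 mulr0 ?mule0.
Qed.

Lemma integral_density (f : R -> \bar R) : measurable_fun setT f -> (forall x, 0 <= f x)%E ->
  (\int[P]_w f (X w) = \int[mu]_x ((p x)%:E * f x))%E.
Proof.
move=> mf f0; pose f_ := nnsfun_approx measurableT mf.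
transitivity (lim (\int[P]_w (f_ n (X w))%:E @[n --> \oo])%E).
  rewrite -monotone_convergence//=.
  - apply: eq_integral => w _; apply/esym/cvg_lim => //=.
    exact: cvg_nnsfun_approx.
  - by move=> n; apply/measurable_EFinP; apply: (measurableT_comp _ mX); exact: measurable_funP.
  - by move=> n w _; rewrite lee_fin.
  - by move=> w _ a b ab; rewrite lee_fin; exact/lefP/nd_nnsfun_approx.
rewrite [RHS](_ : _ = lim (\int[mu]_x ((p x)%:E * (f_ n x)%:E) @[n --> \oo])%E); last first.
  rewrite -monotone_convergence//=.
  - apply: eq_integral => x _; apply/esym/cvg_lim => //.
    by apply: cvgeZl => //; exact: cvg_nnsfun_approx.
  - move=> n; apply/measurable_EFinP; apply: (measurable_funM mp); exact: measurable_funP.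
  - by move=> n x _; rewrite mule_ge0 ?lee_fin.
  - move=> x _ a b ab; apply: lee_wpmul2l; first by rewrite lee_fin.
    by rewrite lee_fin; have /lefP/(_ x) := nd_nnsfun_approx measurableT mf ab.
by apply: congr_lim; apply/funext => n /=; exact: integral_density_nnsfun.
Qed.

End density.

(** The joint law agrees with the product of the laws on rectangles, hence everywhere; Tonelli then
    splits the integral. *)
Lemma integral_independent X Y : measurable_fun setT X -> measurable_fun setT Y ->
  (forall A B : set (measurableTypeR R), measurable A -> measurable B ->
     P (X @^-1` A `&` Y @^-1` B) = (P (X @^-1` A) * P (Y @^-1` B))%E) ->
  (forall w, 0 <= X w) -> (forall w, 0 <= Y w) ->
  (\int[P]_w (X w * Y w)%:E = \int[P]_w (X w)%:E * \int[P]_w (Y w)%:E)%E.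
Proof.
move=> mX mY XY X0 Y0.
pose XF : {mfun Omega >-> R} := HB.pack X (isMeasurableFun.Build _ _ _ _ X mX).
pose YF : {mfun Omega >-> R} := HB.pack Y (isMeasurableFun.Build _ _ _ _ Y mY).
pose XY' : Omega -> (R * R)%type := fun w => (X w, Y w).
have mXY : measurable_fun setT XY' by exact: measurable_fun_pair.
pose XYF : {mfun Omega >-> (R * R)%type} :=
  HB.pack XY' (isMeasurableFun.Build _ _ _ _ XY' mXY).
pose m1 := distribution P XF; pose m2 := distribution P YF; pose m := distribution P XYF.
have mE A : measurable A -> (m1 \x m2)%E A = m A.
  by apply: product_measure_unique => B C mB mC; exact: XY.
(* Truncation makes the integrand nonnegative on the whole plane, as Tonelli requires, and changes
   nothing along the nonnegative X and Y. *)
pose f (z : (R * R)%type) : \bar R := ((Num.max 0 z.1)%:E * (Num.max 0 z.2)%:E)%E.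
have f0 z : (0 <= f z)%E by rewrite mule_ge0// lee_fin le_max lexx.
have mmax : measurable_fun setT (fun x : R => (Num.max 0 x)%:E).
  by apply/measurable_EFinP; apply: measurable_maxr.
have mf : measurable_fun setT f.
  by apply: emeasurable_funM; apply: (measurableT_comp mmax).
transitivity (\int[m]_z f z)%E.
  rewrite ge0_integral_distribution//; apply: eq_integral => w _ /=.
  by rewrite /f/= !max_r.
have -> : (\int[m]_z f z = \int[m1 \x m2]_z f z)%E.
  by apply: eq_measure_integral => A mA _; apply/esym; exact: mE.
rewrite fubini_tonelli1//.
transitivity (\int[m1]_x ((Num.max 0 x)%:E * \int[m2]_y (Num.max 0 y)%:E))%E.
  apply: eq_integral => x _; rewrite /fubini_F /f /= ge0_integralZl//.
  - by move=> y _; rewrite lee_fin le_max lexx.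
  - by rewrite lee_fin le_max lexx.
rewrite ge0_integralZr//; last 2 first.
  - by move=> x _; rewrite lee_fin le_max lexx.
  - by apply: integral_ge0 => y _; rewrite lee_fin le_max lexx.
rewrite !ge0_integral_distribution//; [|by move=> y; rewrite lee_fin le_max lexx..].
by congr (_ * _)%E; apply: eq_integral => w _ /=; rewrite max_r.
Qed.


Section normal_moments.
Variables (X : Omega -> R) (s : R).
Hypotheses (s0 : 0 < s) (mX : measurable_fun setT X)
  (Xs : forall B : set (measurableTypeR R), measurable B -> P (X @^-1` B) = normal_prob 0 s B).
Let s_neq0 : s != 0. Proof. exact: lt0r_neq0. Qed.

Lemma integral_normal (f : R -> \bar R) : measurable_fun setT f -> (forall x, 0 <= f x)%E ->
  (\int[P]_w f (X w) = \int[mu]_x ((normal_pdf 0 s x)%:E * f x))%E.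
Proof.
apply: integral_density => //; first exact: measurable_normal_pdf.
by move=> x; exact: normal_pdf_ge0.
Qed.

(* with y = x^2 / 8 s^2, this is y exp (- 4 y) <= exp (- y) *)
Lemma normal_pdf_sqr x : normal_pdf 0 s x * x ^+ 2 <= 16 * s ^+ 2 * normal_pdf 0 (2 * s) x.
Proof.
have s20 : 2 * s != 0 by rewrite mulf_neq0.
rewrite !normal_pdfE// /normal_peak /normal_fun !subr0.
set y := x ^+ 2 / (8 * s ^+ 2).
have y0 : 0 <= y by rewrite divr_ge0 ?sqr_ge0// mulr_ge0// sqr_ge0.
have xy : x ^+ 2 = 8 * s ^+ 2 * y by rewrite /y; field.
have -> : - x ^+ 2 / (s ^+ 2 *+ 2) = - (4 * y) by rewrite /y; field.
have -> : - x ^+ 2 / ((2 * s) ^+ 2 *+ 2) = - y by rewrite /y; field.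
have -> : Num.sqrt ((2 * s) ^+ 2 * pi *+ 2) = 2 * Num.sqrt (s ^+ 2 * pi *+ 2).
  rewrite (_ : (2 * s) ^+ 2 * pi *+ 2 = 2 ^+ 2 * (s ^+ 2 * pi *+ 2)); last by ring.
  by rewrite sqrtrM ?sqr_ge0// sqrtr_sqr ger0_norm.
have sq0 : 0 < Num.sqrt (s ^+ 2 * pi *+ 2).
  by rewrite sqrtr_gt0 pmulrn_lgt0// mulr_gt0 ?pi_gt0// exprn_gt0.
rewrite xy; move: sq0; set r := Num.sqrt _ => r0.
have H : y * expR (- (4 * y)) <= expR (- y).
  have -> : - (4 * y) = - y - 3 * y by ring.
  rewrite expRD mulrCA ler_piMr ?expR_ge0// expRN ler_pdivrMr ?expR_gt0// mul1r.
  by have := expR_ge1Dx (3 * y); lra.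
move: H; move: (expR (- (4 * y))) (expR (- y)) => a b H.
have -> : r^-1 * a * (8 * s ^+ 2 * y) = 8 * s ^+ 2 / r * (y * a) by ring.
have -> : 16 * s ^+ 2 * ((2 * r)^-1 * b) = 8 * s ^+ 2 / r * b by field; rewrite lt0r_neq0.
by rewrite ler_wpM2l// divr_ge0 ?(ltW r0)// mulr_ge0// sqr_ge0.
Qed.

(** Domination by the normal density of standard deviation 2 s, of total mass 1, yields the factor
    16 without computing the variance. *)
Lemma normal_sqr : (\int[P]_w (X w ^+ 2)%:E <= (16 * s ^+ 2)%:E)%E.
Proof.
have mq : measurable_fun setT (fun x : R => x ^+ 2) by exact: measurable_funX.
rewrite (integral_normal (f := fun x => (x ^+ 2)%:E)); [|exact/measurable_EFinP|by move=> x; rewrite lee_fin sqr_ge0].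
apply: (@le_trans _ _ (\int[mu]_x ((16 * s ^+ 2)%:E * (normal_pdf 0 (2 * s) x)%:E))%E).
  apply: ge0_le_integral => //.
  - by move=> x _; rewrite -EFinM lee_fin mulr_ge0 ?normal_pdf_ge0 ?sqr_ge0.
  - by apply/measurable_EFinP; apply: measurable_funM => //; exact: measurable_normal_pdf.
  - by apply/measurable_EFinP; apply: measurable_funM => //; exact: measurable_normal_pdf.
  - by move=> x _; rewrite -!EFinM lee_fin normal_pdf_sqr.
rewrite ge0_integralZl_EFin//.
- by rewrite integral_normal_pdf mule1.
- by move=> x _; rewrite lee_fin normal_pdf_ge0.
- by apply/measurable_EFinP; exact: measurable_normal_pdf.
- by rewrite mulr_ge0// sqr_ge0.
Qed.

Lemma normal_pdf_sym x : normal_pdf 0 s (- x) = normal_pdf 0 s x.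
Proof. by rewrite !normal_pdfE// /normal_fun !subr0 sqrrN. Qed.

(** Mean zero as equality of the integrals of positive and negative parts: the density is even, and
    x is replaced by -x on a half-line. *)
Lemma normal_mean : (\int[P]_w (Num.max 0 (X w))%:E = \int[P]_w (Num.max 0 (- X w))%:E)%E.
Proof.
have mp : measurable_fun setT (fun x : R => Num.max 0 x) by exact: measurable_maxr.
have mn : measurable_fun setT (fun x : R => Num.max 0 (- x)).
  by apply: measurable_maxr => //; exact: measurableT_comp.
have max0 (x : R) : 0 <= Num.max 0 x by rewrite le_max lexx.
rewrite (integral_normal (f := fun x => (Num.max 0 x)%:E)); [|exact/measurable_EFinP|by move=> x; rewrite lee_fin].
rewrite (integral_normal (f := fun x => (Num.max 0 (- x))%:E)); [|exact/measurable_EFinP|by move=> x; rewrite lee_fin].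
pose G x := normal_pdf 0 s x * Num.max 0 (- x).
have cG : continuous G.
  move=> x; apply: cvgM; first exact: continuous_normal_pdf.
  apply: (continuous_comp (f := fun x : R => - x) (g := fun x : R => Num.max 0 x)); first exact: opp_continuous.
  by apply: continuous_max; [exact: cst_continuous|exact: cvg_id].
have G0 x : 0 <= G x by rewrite mulr_ge0 ?normal_pdf_ge0.
have := @ge0_integration_by_substitutionNy R G 0; rewrite oppr0 => /(_ _ _).
move=> /(_ (continuous_subspaceT cG)) /(_ (fun x _ => G0 x)) H.
transitivity (\int[mu]_(x in `[0%R, +oo[) ((G \o -%R) x)%:E)%E.
  rewrite [RHS]integral_mkcond; apply: eq_integral => x _; rewrite patchE /G /=.
  rewrite mem_setE in_itv/= andbT opprK normal_pdf_sym -EFinM.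
  by case: ifPn => //; rewrite -ltNge => x0; rewrite max_l ?(ltW x0)// mulr0.
rewrite -H [LHS]integral_mkcond; apply: eq_integral => x _; rewrite patchE /G -EFinM.
rewrite mem_setE in_itv/=.
by case: ifPn => //; rewrite -ltNge => x0; rewrite max_l ?mulr0// oppr_le0 ltW.
Qed.

End normal_moments.

End laws.

(** * Stochastic Gronwall lemma *)

Section stochastic_gronwall.
Context {R : realType} {disp : measure_display} {Omega : measurableType disp}.
Variables (P : probability Omega R) (F : R -> set (set Omega)) (W : R -> Omega -> R).
Hypotheses (hF : filtration F) (hW : wiener_process P F W).
Implicit Types (X Y Z U V f g : Omega -> R).

Local Notation I f := (\int[P]_w (f w)%:E)%E.

Lemma measurable_wrt_fun t X : 0 <= t -> measurable_wrt (F t) X -> measurable_fun setT X.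
Proof.
move=> t0 mX _ B mB; rewrite setTI; case: hF => _ Fm _; apply: (Fm t) => //; exact: mX.
Qed.

Lemma measurable_wrt_comp (G : set (set Omega)) X (psi : R -> R) : measurable_wrt G X ->
  measurable_fun setT psi -> measurable_wrt G (psi \o X).
Proof.
move=> mX mpsi B mB; rewrite comp_preimage; apply: mX.
by rewrite -[X in measurable X]setTI; exact: mpsi.
Qed.

Lemma mean_add f g : measurable_fun setT f -> measurable_fun setT g -> (forall w, 0 <= f w) -> (forall w, 0 <= g w) ->
  I (fun w => f w + g w) = (I f + I g)%E.
Proof.
move=> mf mg f0 g0; under eq_integral do rewrite EFinD.
rewrite ge0_integralD//; by [move=> w _; rewrite lee_fin|apply/measurable_EFinP].
Qed.

Lemma mean_scale (c : R) f : 0 <= c -> measurable_fun setT f -> (forall w, 0 <= f w) ->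
  I (fun w => c * f w) = (c%:E * I f)%E.
Proof.
move=> c0 mf f0; under eq_integral do rewrite EFinM.
by rewrite ge0_integralZl_EFin//; [move=> w _; rewrite lee_fin|apply/measurable_EFinP].
Qed.

Lemma mean_cst (c : R) : I (fun=> c) = c%:E.
Proof. by rewrite integral_cst//= probability_setT mule1. Qed.

Lemma mean_ge0 f : (forall w, 0 <= f w) -> (0 <= I f)%E.
Proof. by move=> f0; apply: integral_ge0 => w _; rewrite lee_fin. Qed.

Lemma mean_le f g : measurable_fun setT f -> measurable_fun setT g -> (forall w, 0 <= f w) ->
  (forall w, f w <= g w) -> (I f <= I g)%E.
Proof.
move=> mf mg f0 fg; apply: ge0_le_integral => //.
- by move=> w _; rewrite lee_fin.
- exact/measurable_EFinP.
- exact/measurable_EFinP.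
- by move=> w _; rewrite lee_fin.
Qed.

Lemma mean_le_ae f g : measurable_fun setT f -> measurable_fun setT g -> (forall w, 0 <= f w) ->
  (forall w, 0 <= g w) -> {ae P, forall w, f w <= g w} -> (I f <= I g)%E.
Proof.
move=> mf mg f0 g0 fg; apply: ae_ge0_le_integral => //.
- by move=> w _; rewrite lee_fin.
- exact/measurable_EFinP.
- by move=> w _; rewrite lee_fin.
- exact/measurable_EFinP.
- by apply: filterS fg => w fg _; rewrite lee_fin.
Qed.

Lemma maxr0_le (c : R) : Num.max 0 c <= `|c|.
Proof. by rewrite ge_max normr_ge0 ler_norm. Qed.

Section one_step.
Variables (s t : R).
Hypotheses (s0 : 0 <= s) (st : s < t).
Let om w := W t w - W s w.
Let tau := t - s.
Let tau0 : 0 < tau. Proof. by rewrite subr_gt0. Qed.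

Lemma measurable_increment : measurable_fun setT om.
Proof.
have t0 : 0 <= t by rewrite (le_trans s0)// ltW.
case: hW => aW _ _ _ _; apply: measurable_funB.
  exact: (measurable_wrt_fun t0 (aW _ t0)).
exact: (measurable_wrt_fun s0 (aW _ s0)).
Qed.

Lemma increment_law (B : set (measurableTypeR R)) : measurable B -> P (om @^-1` B) = normal_prob 0 (Num.sqrt tau) B.
Proof. by case: hW => _ _ H _ _; exact: H. Qed.

Lemma increment_indep U (psi : R -> R) : measurable_wrt (F s) U -> measurable_fun setT psi ->
  (forall w, 0 <= U w) -> (forall x, 0 <= psi x) ->
  I (fun w => U w * psi (om w)) = (I U * I (psi \o om))%E.
Proof.
move=> mU mpsi U0 psi0; apply: integral_independent => //.
- exact: measurable_wrt_fun mU.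
- by apply: measurableT_comp => //; exact: measurable_increment.
- move=> A B mA mB; case: hW => _ _ _ H _.
  have mB' : measurable (psi @^-1` B) by rewrite -[X in measurable X]setTI; exact: mpsi.
  exact: (H s t s0 st _ _ (mU _ mA) mB').
Qed.

Let pos (x : R) : R := Num.max 0 x.
Let neg (x : R) : R := Num.max 0 (- x).
Let pos0 x : 0 <= pos x. Proof. by rewrite /pos le_max lexx. Qed.
Let neg0 x : 0 <= neg x. Proof. by rewrite /neg le_max lexx. Qed.
Let mpos : measurable_fun setT pos. Proof. exact: measurable_maxr. Qed.
Let mneg : measurable_fun setT neg.
Proof. by apply: measurable_maxr => //; exact: measurableT_comp. Qed.
Let posneg x : x = pos x - neg x.
Proof. by rewrite /pos /neg; case: (leP 0 x) => x0; [rewrite max_l ?oppr_le0// subr0|rewrite max_r ?oppr_ge0 ?(ltW x0)// opprK add0r]. Qed.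

Lemma increment_sqr : (I (fun w => om w ^+ 2) <= (16 * tau)%:E)%E.
Proof.
have sq0 : 0 < Num.sqrt tau by rewrite sqrtr_gt0.
have := normal_sqr sq0 measurable_increment increment_law.
by rewrite sqr_sqrtr// ltW.
Qed.

Lemma increment_mean : I (pos \o om) = I (neg \o om).
Proof.
have sq0 : 0 < Num.sqrt tau by rewrite sqrtr_gt0.
exact: normal_mean sq0 measurable_increment increment_law.
Qed.

Lemma increment_pos_fin : (I (pos \o om) < +oo)%E.
Proof.
have mom := measurable_increment.
have m2 : measurable_fun setT (fun w => om w ^+ 2) by exact: measurable_funX.
apply: (@le_lt_trans _ _ (I (fun w => 1 + om w ^+ 2))).
  apply: mean_le => //.
  - exact: measurableT_comp.
  - by apply: measurable_funD.
  - by move=> w; exact: pos0.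
  move=> w /=; apply: le_trans (maxr0_le _) _.
  have := sqr_ge0 (`|om w| - 1); rewrite -(real_normK (num_real (om w))); nra.
rewrite mean_add//; last by move=> w; exact: sqr_ge0.
by rewrite mean_cst lte_add_pinfty ?ltry// (le_lt_trans increment_sqr)// ltry.
Qed.

(* the mean of om * Z is 0, stated without integrals of signed functions *)
Lemma increment_mean_mul Z (K : R) X : 0 <= K -> measurable_wrt (F s) Z -> measurable_fun setT X ->
  (forall w, 0 <= X w) -> (forall w, `|Z w| <= K * (1 + X w)) -> (I X < +oo)%E ->
  I (fun w => pos (om w) * pos (Z w) + neg (om w) * neg (Z w)) =
  I (fun w => pos (om w) * neg (Z w) + neg (om w) * pos (Z w)) /\
  (I (fun w => pos (om w) * pos (Z w) + neg (om w) * neg (Z w)) < +oo)%E.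
Proof.
move=> K0 mZ mX X0 ZX Xoo; have mom := measurable_increment.
have mZ' := measurable_wrt_fun s0 mZ.
have [mpo mno] : measurable_fun setT (pos \o om) /\ measurable_fun setT (neg \o om).
  by split; exact: measurableT_comp.
have [mpz mnz] : measurable_fun setT (pos \o Z) /\ measurable_fun setT (neg \o Z).
  by split; exact: measurableT_comp.
have [wpz wnz] : measurable_wrt (F s) (pos \o Z) /\ measurable_wrt (F s) (neg \o Z).
  by split; exact: measurable_wrt_comp.
have fin U : measurable_fun setT U -> (forall w, 0 <= U w) -> (forall w, U w <= `|Z w|) -> (I U < +oo)%E.
  move=> mU U0 UZ; apply: (@le_lt_trans _ _ (I (fun w => K * (1 + X w)))).
    apply: mean_le => //; first by apply: measurable_funM => //; exact: measurable_funD.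
    by move=> w; exact: le_trans (UZ w) (ZX w).
  rewrite mean_scale//; [|exact: measurable_funD|by move=> w; rewrite addr_ge0].
  by rewrite mean_add// mean_cst lte_mul_pinfty ?lee_fin// lte_add_pinfty// ltry.
have fp : (I (pos \o Z) < +oo)%E by apply: fin => // w; [exact: pos0|exact: maxr0_le].
have fn : (I (neg \o Z) < +oo)%E.
  by apply: fin => // w; [exact: neg0|rewrite -normrN; exact: maxr0_le].
have E (psi : R -> R) U : measurable_fun setT psi -> (forall x, 0 <= psi x) -> measurable_wrt (F s) U ->
    (forall w, 0 <= U w) -> I (fun w => psi (om w) * U w) = (I (psi \o om) * I U)%E.
  move=> mpsi psi0 mU U0; rewrite muleC -increment_indep//.
  by apply: eq_integral => w _; rewrite mulrC.
have -> : I (fun w => pos (om w) * pos (Z w) + neg (om w) * neg (Z w)) =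
    (I (pos \o om) * I (pos \o Z) + I (neg \o om) * I (neg \o Z))%E.
  rewrite mean_add; [|exact: (measurable_funM mpo mpz)|exact: (measurable_funM mno mnz)|by move=> w; rewrite mulr_ge0..].
  by rewrite (E pos (pos \o Z)) ?(E neg (neg \o Z))// => w; rewrite /=.
have -> : I (fun w => pos (om w) * neg (Z w) + neg (om w) * pos (Z w)) =
    (I (pos \o om) * I (neg \o Z) + I (neg \o om) * I (pos \o Z))%E.
  rewrite mean_add; [|exact: (measurable_funM mpo mnz)|exact: (measurable_funM mno mpz)|by move=> w; rewrite mulr_ge0..].
  by rewrite (E pos (neg \o Z)) ?(E neg (pos \o Z))// => w; rewrite /=.
rewrite -increment_mean; split; first by rewrite addeC.
have po0 : (0 <= I (pos \o om))%E by apply: mean_ge0 => w; exact: pos0.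
have pof : I (pos \o om) \is a fin_num by rewrite ge0_fin_numE// increment_pos_fin.
apply: lte_add_pinfty; rewrite -(fineK pof) lte_mul_pinfty ?lee_fin ?fine_ge0//.
Qed.

(** The term linear in the increment has mean 0. In the quadratic one, independence and E om^2 <= 16
    tau turn 2 om^2 K (1 + X) into 32 K tau (1 + E X). *)
Lemma one_step X X' V Z (K c : R) : 0 <= K -> 0 <= c ->
  measurable_wrt (F s) X -> measurable_wrt (F s) Z ->
  measurable_fun setT X' -> measurable_fun setT V ->
  (forall w, 0 <= X w) -> (forall w, 0 <= X' w) -> (forall w, 0 <= V w) ->
  (forall w, `|Z w| <= K * (1 + X w)) -> (I X < +oo)%E ->
  {ae P, forall w, X' w + V w <= X w + tau * c + 2 * om w * Z w + 2 * om w ^+ 2 * (K * (1 + X w))} ->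
  (I X' + I V <= I X + (tau * c)%:E + (32 * K * tau)%:E * (1 + I X))%E.
Proof.
move=> K0 c0 mX mZ mX' mV X0 X'0 V0 ZX Xoo H.
have mXf := measurable_wrt_fun s0 mX; have mZf := measurable_wrt_fun s0 mZ.
have mom := measurable_increment.
have [mpo mno] : measurable_fun setT (pos \o om) /\ measurable_fun setT (neg \o om).
  by split; exact: measurableT_comp.
have [mpz mnz] : measurable_fun setT (pos \o Z) /\ measurable_fun setT (neg \o Z).
  by split; exact: measurableT_comp.
have [Epn Efin] := increment_mean_mul K0 mZ mXf X0 ZX Xoo.
(* [A] and [B] are the positive and negative parts of [om * Z]. Moving 2 B to the left makes both
   sides of the pathwise inequality nonnegative, so it can be integrated. *)
pose A w := pos (om w) * pos (Z w) + neg (om w) * neg (Z w).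
pose B w := pos (om w) * neg (Z w) + neg (om w) * pos (Z w).
have AB w : om w * Z w = A w - B w.
  by rewrite {1}(posneg (om w)) {1}(posneg (Z w)) /A /B; ring.
have mA : measurable_fun setT A by apply: measurable_funD; [exact: (measurable_funM mpo mpz)|exact: (measurable_funM mno mnz)].
have mB : measurable_fun setT B by apply: measurable_funD; [exact: (measurable_funM mpo mnz)|exact: (measurable_funM mno mpz)].
have A0 w : 0 <= A w by rewrite addr_ge0// mulr_ge0.
have B0 w : 0 <= B w by rewrite addr_ge0// mulr_ge0.
have m1X : measurable_fun setT (fun w => 1 + X w) by exact: measurable_funD.
have m2 : measurable_fun setT (fun w => om w ^+ 2) by exact: measurable_funX.
pose Q w := K * ((1 + X w) * om w ^+ 2).
have Q0 w : 0 <= Q w by rewrite mulr_ge0// mulr_ge0 ?sqr_ge0// addr_ge0.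
have mQ : measurable_fun setT Q by apply: measurable_funM => //; exact: measurable_funM.
have mXc : measurable_fun setT (fun w => X w + tau * c) by exact: measurable_funD.
have mAQ : measurable_fun setT (fun w => A w + Q w) by exact: measurable_funD.
have mAQ2 : measurable_fun setT (fun w => 2 * (A w + Q w)) by exact: measurable_funM.
have mB2 : measurable_fun setT (fun w => 2 * B w) by exact: measurable_funM.
have mXV : measurable_fun setT (fun w => X' w + V w) by exact: measurable_funD.
have tc0 : 0 <= tau * c by rewrite mulr_ge0// ltW.
have IQ : (I Q <= (16 * K * tau)%:E * (1 + I X))%E.
  rewrite mean_scale//; [|exact: measurable_funM|by move=> w; rewrite mulr_ge0 ?sqr_ge0// addr_ge0].
  have w1X : measurable_wrt (F s) (fun w => 1 + X w).
    by apply: (measurable_wrt_comp (psi := fun x => 1 + x) mX); exact: measurable_funD.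
  have -> : I (fun w => (1 + X w) * om w ^+ 2) = (I (fun w => 1 + X w) * I (fun w => om w ^+ 2))%E.
    by apply: (increment_indep (psi := fun x => x ^+ 2) w1X) => [|w|x]; [exact: measurable_funX|rewrite addr_ge0|exact: sqr_ge0].
  rewrite mean_add// mean_cst.
  have n0 : (0 <= 1 + I X)%E by rewrite adde_ge0// mean_ge0.
  rewrite (_ : 16 * K * tau = K * (16 * tau)); last by ring.
  rewrite EFinM -muleA lee_wpmul2l ?lee_fin// muleC lee_wpmul2r//.
  exact: increment_sqr.
have L : (I (fun w => X' w + V w + 2 * B w) <= I (fun w => X w + tau * c + 2 * (A w + Q w)))%E.
  apply: mean_le_ae.
  - exact: measurable_funD.
  - exact: measurable_funD.
  - by move=> w; rewrite !addr_ge0// mulr_ge0.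
  - by move=> w; rewrite !addr_ge0// mulr_ge0// addr_ge0.
  apply: filterS H => w; have := AB w; rewrite /Q; lra.
have XV0 w : 0 <= X' w + V w by rewrite addr_ge0.
have B20 w : 0 <= 2 * B w by rewrite mulr_ge0.
have Xc0 w : 0 <= X w + tau * c by rewrite addr_ge0.
have AQ0 w : 0 <= A w + Q w by rewrite addr_ge0.
have AQ20 w : 0 <= 2 * (A w + Q w) by rewrite mulr_ge0.
move: L; rewrite (mean_add mXV mB2 XV0 B20) (mean_add mX' mV X'0 V0) (mean_scale (ler0n R 2) mB B0).
rewrite (mean_add mXc mAQ2 Xc0 AQ20) (mean_add mXf (measurable_cst _) X0 (fun=> tc0)) mean_cst.
rewrite (mean_scale (ler0n R 2) mAQ AQ0) (mean_add mA mQ A0 Q0).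
rewrite -/A -/B in Epn; rewrite -/A in Efin.
have Afin : I A \is a fin_num by rewrite ge0_fin_numE// mean_ge0.
rewrite -Epn -(fineK Afin) -EFinM.
have [x xE] : exists x, I X = x%:E by exists (fine (I X)); rewrite fineK// ge0_fin_numE// mean_ge0.
have Qfin : I Q \is a fin_num.
  by rewrite ge0_fin_numE ?mean_ge0// (le_lt_trans IQ)// xE -EFinD -EFinM ltry.
move: IQ; rewrite -(fineK Qfin) xE -?EFinD -?EFinM -?EFinD -?EFinM -?EFinD lee_fin => IQ L.
(* [A] and [B] have the same finite integral, so it cancels. *)
have : (I X' + I V + (2 * fine (I A))%:E <= (x + tau * c + 32 * K * tau * (1 + x) + 2 * fine (I A))%:E)%E.
  by apply: le_trans L _; rewrite lee_fin; lra.
by rewrite [X in (_ <= X)%E -> _]EFinD leeD2rE.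
Qed.

End one_step.

Section gronwall.
Variables (T : R) (N : nat) (X V Z : nat -> Omega -> R) (K c K0 : R).
Hypotheses (T0 : 0 < T) (N0 : (0 < N)%N) (K_ge0 : 0 <= K) (c0 : 0 <= c) (K00 : 0 <= K0).
Let tau := T / N%:R.
Let t n := n%:R * tau.
Hypotheses (mX : forall n, (n <= N)%N -> measurable_wrt (F (t n)) (X n))
  (mZ : forall n, (n < N)%N -> measurable_wrt (F (t n)) (Z n))
  (mV : forall n, (n < N)%N -> measurable_fun setT (V n))
  (X0 : forall n w, (n <= N)%N -> 0 <= X n w) (V0 : forall n w, (n < N)%N -> 0 <= V n w)
  (ZX : forall n w, (n < N)%N -> `|Z n w| <= K * (1 + X n w))
  (X00 : forall w, X 0%N w <= K0)
  (step : {ae P, forall w n, (n < N)%N ->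
     X n.+1 w + V n w <= X n w + tau * c + 2 * (W (t n.+1) w - W (t n) w) * Z n w
       + 2 * (W (t n.+1) w - W (t n) w) ^+ 2 * (K * (1 + X n w))}).

Definition gronwall_const : R := (K0 + (c + 32 * K) * T) * expR (32 * K * T).

Let tau_gt0 : 0 < tau. Proof. by rewrite divr_gt0// ltr0n. Qed.

(** The finiteness of E X_k, required by [one_step], is not assumed: it comes from the bound itself
    in the same induction. *)
Lemma stochastic_gronwall n : (n <= N)%N ->
  (I (X n) + \sum_(0 <= k < n) I (V k) <= gronwall_const%:E)%E.
Proof.
pose a := 32 * K; pose b := c + 32 * K.
have [a0 b0] : 0 <= a /\ 0 <= b by rewrite /a /b; split; [rewrite mulr_ge0|rewrite addr_ge0// mulr_ge0].
have t_ge0 k : 0 <= t k by rewrite mulr_ge0// ltW.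
(* Chosen so that (1 + a tau) e_k + b tau <= e_(k+1), the recursion obtained from [one_step]; at the
   end (1 + a tau)^N <= exp(a T). *)
pose e k := (1 + a * tau) ^+ k * (K0 + k%:R * (b * tau)).
have at1 : 1 <= 1 + a * tau by rewrite lerDl mulr_ge0// ltW.
have mXf k : (k <= N)%N -> measurable_fun setT (X k).
  by move=> kN; apply: (measurable_wrt_fun (t_ge0 k)); exact: mX.
have IX0 k : (k <= N)%N -> (0 <= I (X k))%E by move=> kN; apply: mean_ge0 => w; exact: X0.
have SV0 k : (k <= N)%N -> (0 <= \sum_(0 <= j < k) I (V j))%E.
  move=> kN; rewrite big_nat; apply: sume_ge0 => j /andP[_ jk]; apply: mean_ge0 => w.
  by apply: V0; exact: leq_trans jk kN.
have claim k : (k <= N)%N -> (I (X k) + \sum_(0 <= j < k) I (V j) <= (e k)%:E)%E.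
  elim: k => [_|k IH kN].
    rewrite big_geq// adde0 /e expr0 mul1r mul0r addr0 -(mean_cst K0).
    by apply: mean_le => //; [exact: mXf|move=> w; exact: X0].
  have kN' := ltnW kN; have {}IH := IH kN'.
  have Xle : (I (X k) <= (e k)%:E)%E by apply: le_trans IH; rewrite leeDl// SV0.
  have Xoo : (I (X k) < +oo)%E by apply: le_lt_trans Xle _; rewrite ltry.
  have tt : t k < t k.+1 by rewrite /t ltr_pM2r// ltr_nat.
  have tE : t k.+1 - t k = tau by rewrite /t -mulrBl -natrB// subSnn mul1r.
  have := one_step (t_ge0 k) tt K_ge0 c0 (mX kN') (mZ kN) (mXf _ kN) (mV kN)
    (fun w => X0 w kN') (fun w => X0 w kN) (fun w => V0 w kN) (fun w => ZX w kN) Xoo.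
  rewrite tE => /(_ _) S.
  have {}S : (I (X k.+1) + I (V k) <= I (X k) + (tau * c)%:E + (32 * K * tau)%:E * (1 + I (X k)))%E.
    by apply: S; apply: filterS step => w /(_ k kN).
  rewrite big_nat_recr//= [X in (_ + X)%E]addeC addeA.
  apply: (@le_trans _ _ (I (X k) + (tau * c)%:E + (32 * K * tau)%:E * (1 + I (X k)) + \sum_(0 <= j < k) I (V j))%E).
    by rewrite leeD2r.
  have [x xE] : exists x, I (X k) = x%:E by exists (fine (I (X k))); rewrite fineK// ge0_fin_numE// IX0.
  have Sfin : (\sum_(0 <= j < k) I (V j) < +oo)%E.
    by apply: le_lt_trans (ltry (e k)); apply: le_trans IH; rewrite leeDr// IX0.
  have [y yE] : exists y, (\sum_(0 <= j < k) I (V j) = y%:E)%E.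
    by exists (fine (\sum_(0 <= j < k) I (V j))%E); rewrite fineK// ge0_fin_numE// SV0.
  have y0 := SV0 _ kN'; rewrite xE yE -?EFinD lee_fin in IH Xle y0 *.
  rewrite !lee_fin in Xle y0 *.
  have e1 : (1 + a * tau) * e k + b * tau <= e k.+1.
    have bt0 : 0 <= b * tau by rewrite mulr_ge0// ltW.
    have z1 : b * tau <= (1 + a * tau) ^+ k.+1 * (b * tau) by rewrite ler_peMl// exprn_ege1.
    by rewrite /e -natr1; move: z1; rewrite exprS; lra.
  apply: le_trans e1.
  have : a * tau * x <= a * tau * e k by rewrite ler_wpM2l// mulr_ge0// ltW.
  rewrite /a /b; lra.
move=> nN; apply: le_trans (claim n nN) _; rewrite lee_fin /gronwall_const /e mulrC.
have Nt : N%:R * tau = T by rewrite /tau mulrCA divff ?mulr1// pnatr_eq0 -lt0n.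
apply: ler_pM.
- by rewrite addr_ge0// mulr_ge0// mulr_ge0// ltW.
- by rewrite exprn_ge0// (le_trans _ at1).
- rewrite lerD2l mulrCA ler_wpM2l// -Nt ler_wpM2r ?(ltW tau_gt0)// ler_nat//.
- apply: (@le_trans _ _ ((1 + a * tau) ^+ N)); first by rewrite ler_weXn2l.
  have -> : 32 * K * T = N%:R * (a * tau) by rewrite -Nt /a; ring.
  rewrite expRM_natl lerXn2r ?nnegrE ?expR_ge0 ?(le_trans _ at1)//.
  exact: expR_ge1Dx.
Qed.

End gronwall.

End stochastic_gronwall.

(** * The main estimate *)

Section nodal_measurability.
Context {R : realType} {d : nat}.
Variables (M : mesh R d) (D : set 'rV[R]_d).
Hypotheses (d0 : (0 < d)%N) (tM : triangulation M D) (bD : bounded_set D).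
Local Notation idx := 'I_(nb_nodes M).
Local Notation pw := (piecewise_affine M).
Local Notation fn U := (fe (fun i : idx => (U : 'rV[R]_(nb_nodes M)) ord0 i)).
Let mu := lebesgue_rV R d.
Implicit Types (i j k l : idx) (x y : 'rV[R]_d) (v w z : 'rV[R]_d -> R).
Let oD := triangulated_open tM.
Let mD := measurable_domain oD.
Let sD : D `<=` closure D := @subset_closure _ D.

Lemma nodal_coor i : measurable_fun setT (fun U : 'rV[R]_(nb_nodes M) => U ord0 i : R).
Proof. exact: measurable_coor. Qed.

Lemma measurable_gr_fn w : measurable_fun setT (fun U => gr M (fn U) w : R).
Proof.
under eq_fun do rewrite (gr_hatl tM).
apply: measurable_sum => i; apply: measurable_funM => //.
by under eq_fun do rewrite (fe_node tM); exact: nodal_coor.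
Qed.

Lemma measurable_en_fnl w : measurable_fun setT (fun U => en M (fn U) w : R).
Proof.
under eq_fun do rewrite (en_hatl tM).
apply: measurable_sum => i; apply: measurable_funM => //.
by under eq_fun do rewrite (fe_node tM); exact: nodal_coor.
Qed.

Lemma measurable_en_fn : measurable_fun setT (fun U => en M (fn U) (fn U) : R).
Proof.
under eq_fun do rewrite (en_hatl tM).
apply: measurable_sum => i; apply: measurable_funM.
  by under eq_fun do rewrite (fe_node tM); exact: nodal_coor.
by under eq_fun do rewrite enC; exact: measurable_en_fnl.
Qed.

Lemma measurable_grr_fn : measurable_fun setT (fun U => gr M (fn U) (fn U) : R).
Proof.
under eq_fun do rewrite (gr_hatl tM).
apply: measurable_sum => i; apply: measurable_funM.
  by under eq_fun do rewrite (fe_node tM); exact: nodal_coor.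
by under eq_fun do rewrite grC; exact: measurable_gr_fn.
Qed.

(** With l the discrete Laplacian, |l|^2 is the sum of l(node k) (l, hat k), and l(node k) = (l, r
    k); both pairings are stiffness products with [v]. The choice hidden in [discrete_laplacian]
    disappears from the formula. *)
Lemma laplacian_nodal : exists r : idx -> ('rV[R]_d -> R), forall v, pw v ->
  ip D (discrete_laplacian D M v) (discrete_laplacian D M v) = \sum_(k : idx) gr M v (r k) * gr M v (hat k).
Proof.
have /boolp.choice[r' rP'] : forall k, exists r, pw r /\ forall v, pw v -> v (node k) = ip D v r.
  by move=> k; have [s ps sP] := point_evaluation d0 tM bD k; exists s.
exists r' => v pv; have [/(VhP d0 tM bD) pl lE] := discrete_laplacianP d0 tM bD pv.
rewrite (ip_pw_affine tM bD (pw_affine_L2 tM bD pl) pl); apply: eq_bigr => k _.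
have [pr rE] := rP' k; have V s : pw s -> Vh D M s by move=> ps; apply/(VhP d0 tM bD).
rewrite (rE _ pl) !lE; [|exact: V (pw_affine_hat1 tM k)|exact: V].
by rewrite mulrNN (gr_pw d0 tM bD pv pr) (gr_pw d0 tM bD pv (pw_affine_hat1 tM k)).
Qed.

Variables (g : R -> R) (kappa : R).
Hypotheses (dg : forall x : R, derivable (g : R -> R^o) x 1) (k0 : 0 < kappa)
  (lg : forall a b : R, `|g a - g b| <= kappa * `|a - b|).

(** The integral is nonlinear in the nodal values but Lipschitz in them, hence continuous. *)
Lemma measurable_ip_comp r : pw r -> measurable_fun setT (fun U => ip D (g \o fn U) r : R).
Proof.
move=> pr; apply: (@measurable_fun_continuous_rV R (nb_nodes M)).
have Lr := pw_affine_L2 tM bD pr.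
pose B := \sum_(k : idx) `|r (node k)|.
have B0 : 0 <= B by exact: sumr_ge0.
have lip (U V : 'rV[R]_(nb_nodes M)) : `|ip D (g \o fn U) r - ip D (g \o fn V) r| <=
    kappa * (\sum_(k : idx) `|U ord0 k - V ord0 k|) * B * domain_measure D.
  have LU := comp_L2 tM bD dg k0 lg (pw_affine_comb tM (fun i => U ord0 i)).
  have LV := comp_L2 tM bD dg k0 lg (pw_affine_comb tM (fun i => V ord0 i)).
  have -> : ip D (g \o fn U) r - ip D (g \o fn V) r = ip D (fun x => -1 * (g \o fn V) x + (g \o fn U) x) r.
    by rewrite (ip_linl oD (-1) LV LU Lr); ring.
  have Ld := L2_lin oD (-1) LV LU.
  have id := L2_mul_integrable oD Ld Lr.
  apply: le_trans (le_normr_Rintegral mD id) _.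
  rewrite /domain_measure -Rintegral_cst//; apply: le_Rintegral => //.
  - by have := integrable_abse id; congr (integrable _ _ _).
  - exact: (L2_integrable oD bD (L2_cst oD bD _)).
  move=> x Dx /=; have cx := sD Dx.
  rewrite normrM ler_pM//; last exact: (pw_affine_bounded tM pr cx).
  rewrite mulN1r addrC (le_trans (lg _ _))// ler_wpM2l ?(ltW k0)//.
  rewrite /fe -sumrB (le_trans (ler_norm_sum _ _ _))// ler_sum// => k _.
  rewrite -mulrBl normrM ler_piMr// ger0_norm; [exact: (hat_le1 tM k cx)|exact: (hat_ge0 tM k cx)].
pose C := kappa * (nb_nodes M)%:R * B * domain_measure D + 1.
have C0 : 0 < C by rewrite ltr_wpDl// !mulr_ge0 ?domain_measure_ge0// ltW.
move=> U A /nbhs_ballP[e /= e0 eA]; apply/nbhs_ballP; exists (e / C) => [|V]; first exact: divr_gt0.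
rewrite -ball_normE/= => UV; apply: eA; rewrite -ball_normE/= (le_lt_trans (lip U V))//.
have S : \sum_(k : idx) `|U ord0 k - V ord0 k| <= (nb_nodes M)%:R * `|U - V|.
  rewrite mulr_natl -[X in _ *+ X]card_ord -sumr_const; apply: ler_sum => k _.
  by have := coord_le_norm (U - V) k; rewrite !mxE.
apply: (@le_lt_trans _ _ (C * `|U - V|)); last by rewrite mulrC -ltr_pdivlMr.
have := domain_measure_ge0 D; have := normr_ge0 (U - V); rewrite /C => n0 D0.
have : kappa * (\sum_(k : idx) `|U ord0 k - V ord0 k|) * B * domain_measure D <=
    kappa * ((nb_nodes M)%:R * `|U - V|) * B * domain_measure D.
  by rewrite !ler_wpM2r// ler_wpM2l// ltW.
lra.
Qed.

(** Nodal values of P_h g(u) are pairings of g(u) itself with fixed functions, which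
    [measurable_ip_comp] handles. *)
Lemma noise_nodal : exists r : idx -> ('rV[R]_d -> R), (forall k, pw (r k)) /\ forall u, pw u ->
  en M (L2_projection D M (g \o u)) u = \sum_(k : idx) ip D (g \o u) (r k) * en M (hat k) u.
Proof.
have /boolp.choice[r rP] : forall k : idx, exists r, pw r /\ forall v, pw v -> v (node k) = ip D v r.
  by move=> k; have [s ps sP] := point_evaluation d0 tM bD k; exists s.
exists r; split => [k|u pu]; first by have [] := rP k.
rewrite (en_hatl tM); apply: eq_bigr => k _; congr (_ * _).
have [/(VhP d0 tM bD) pz zE] := L2_projectionP d0 tM bD (comp_L2 tM bD dg k0 lg pu).
by have [pr rE] := rP k; rewrite (rE _ pz) zE//; apply/(VhP d0 tM bD).
Qed.

End nodal_measurability.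

(** Adaptedness refers to a sub-sigma-algebra given as a set of sets, so the good sets argument is
    carried out by hand. *)
Lemma measurable_wrt_rV (R : realType) (disp : measure_display) (Omega : measurableType disp)
    (G : set (set Omega)) m (U : Omega -> 'rV[R]_m) (h : 'rV[R]_m -> R) :
  sigma_algebra setT G -> (forall i, measurable_wrt G (fun w => U w ord0 i)) ->
  measurable_fun setT h -> measurable_wrt G (h \o U).
Proof.
move=> sG mU mh B mB; rewrite comp_preimage.
have : measurable (h @^-1` B) by rewrite -[X in measurable X]setTI; exact: mh.
move: (h @^-1` B) => A.
pose H := [set A : set 'rV[R]_m | G (U @^-1` A)].
suff : measurable `<=` H by exact.
apply: smallest_sub.
  case: sG => G0 GC GU; split; rewrite /H/=.
  - by rewrite preimage_set0.
  - by move=> C mC; rewrite setTD preimage_setC -setTD; exact: GC.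
  - by move=> C mC; rewrite preimage_bigcup; exact: GU.
rewrite -bigcup_seq => C [i /= _] [E mE <-]; rewrite /H/= setTI.
exact: mU.
Qed.

(** [X] costs one [B]; twice the sum of the v_k, at most 2 B, dominates the sum of y_k + a l_k.
    Hence 3 B. *)
Lemma sup_add_sums_le (R : realType) (N : nat) (B a : R) (y l v : nat -> \bar R) (X : \bar R) :
  (X <= B%:E)%E -> 0 <= a ->
  (forall k, (k < N)%N -> 0 <= y k)%E -> (forall k, (k < N)%N -> 0 <= l k)%E ->
  (forall k, (k < N)%N -> (2^-1)%:E * y k + (a / 2)%:E * l k <= v k)%E ->
  (\sum_(0 <= k < N) v k <= B%:E)%E ->
  (X + (4^-1)%:E * \sum_(0 <= k < N) y k + a%:E * \sum_(0 <= k < N) l k <= (3 * B)%:E)%E.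
Proof.
move=> XB a0 y0 l0 yl vB.
rewrite !big_nat ge0_sume_distrr; last by move=> k /andP[_ kN]; exact: y0.
rewrite ge0_sume_distrr; last by move=> k /andP[_ kN]; exact: l0.
rewrite -addeA -big_split/=.
apply: (@le_trans _ _ (B%:E + 2%:E * B%:E)%E); last by rewrite -EFinM -EFinD lee_fin; lra.
apply: leeD => //; apply: (@le_trans _ _ (2%:E * \sum_(0 <= k < N) v k)%E); last by rewrite lee_wpmul2l.
have v0 k : (k < N)%N -> (0 <= v k)%E.
  move=> kN; apply: le_trans (yl k kN); rewrite adde_ge0// mule_ge0 ?lee_fin ?divr_ge0//.
  - exact: y0.
  - exact: l0.
rewrite [in leRHS]big_nat ge0_sume_distrr; last by move=> k /andP[_ kN]; exact: v0.
rewrite /=; apply: lee_sum => k kN; apply: (@le_trans _ _ (2%:E * ((2^-1)%:E * y k + (a / 2)%:E * l k))%E).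
  rewrite ge0_muleDr; [|by rewrite mule_ge0 ?lee_fin ?y0..|by rewrite mule_ge0 ?lee_fin ?divr_ge0// l0].
  rewrite !muleA -!EFinM; apply: leeD; rewrite lee_wpmul2r ?y0 ?l0// lee_fin; lra.
by rewrite lee_wpmul2l// yl.
Qed.

Theorem theorem3p1 (R : realType) (d : nat) (hd : (0 < d <= 3)%N)
    (D : set 'rV[R]_d) (hD : bounded_domain D) (T : R) (hT : 0 < T)
    (disp : measure_display) (Omega : measurableType disp)
    (P : probability Omega R) (F : R -> set (set Omega)) (hF : filtration F)
    (W : R -> Omega -> R) (hW : wiener_process P F W)
    (q : nat) (hq3 : (3 <= q)%N) (hqodd : odd q)
    (g : R -> R) (hg : forall x, derivable (g : R -> R^o) x 1)
    (hg' : continuous (derive1 (g : R -> R^o)))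
    (kappa1 : R) (hkappa1 : 0 < kappa1)
    (hglip : forall a b : R, `|g a - g b| <= kappa1 * `|a - b|)
    (u0 : 'rV[R]_d -> R) (hu0 : Hs D 1 u0)
    (I : Type) (Th : I -> mesh R d)
    (hTh : forall i, triangulation (Th i) D)
    (hmesh : forall i, mesh_assumption (Th i))
    (hPh : L2_projection_estimates D Th) :
  exists C : R, 0 < C /\
    forall (i : I) (N : nat), (0 < N)%N ->
    forall u : nat -> Omega -> 'rV[R]_d -> R,
    fem_solution P F W D T q g u0 (Th i) N u ->
    (ereal_sup [set 'E_P[fun w => (normL2_grad D (u n w) ^+ 2)%R]
                 | n in [set n | (n <= N)%N]]
     + (4^-1)%:E * \sum_(0 <= n < N)
         'E_P[fun w => (normL2_grad D (fun x => u n.+1 w x - u n w x) ^+ 2)%R]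
     + (T / N%:R)%:E * \sum_(0 <= n < N)
         'E_P[fun w =>
           (normL2 D (discrete_laplacian D (Th i) (u n.+1 w)) ^+ 2)%R]
     <= C%:E)%E.
Proof.
move/andP: (hd) => [d0 _]; have bD : bounded_set D by case: hD.
(* [CP] is obtained before a mesh is picked, so all the constants below depend on the data alone. *)
have [/(_ 1%N isT)[CP [CP0 HP]] _] := hPh.
pose S := @stab_const R d CP; pose Gc := growth_const D g kappa1.
(* [S * Gc] bounds E(P_h g(u)); the extra 1 pays for E(u) when |B(P_h g(u), u)| is bounded by
   Young. *)
pose Kc := S * Gc + 1; pose c := @step_const R d D.
pose K0 := S * (ip D u0 u0 + ip_grad D u0 u0).
have S0 : 0 <= S by exact: stab_const_ge0.
have G0 : 0 <= Gc by exact: growth_const_ge0.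
have SG0 : 0 <= S * Gc by rewrite mulr_ge0.
have Kc0 : 0 <= Kc by rewrite addr_ge0.
have c0 : 0 <= c by exact: step_const_ge0.
have K00 : 0 <= K0 by rewrite mulr_ge0// addr_ge0 ?ip_ge0 ?ip_grad_ge0.
pose B := gronwall_const T Kc c K0.
have B0 : 0 <= B.
  by rewrite mulr_ge0 ?expR_ge0// addr_ge0// mulr_ge0 ?(ltW hT)// addr_ge0// mulr_ge0.
(* The 3 is that of [sup_add_sums_le]; the 1 keeps the constant positive if [B] is 0. *)
exists (3 * B + 1); split; first by rewrite ltr_wpDl// mulr_ge0.
move=> i N N0 u; move: (Th i) (hTh i) (hmesh i) (HP i) => M tM hM HPi [uV uM u00 sch].
pose tau := T / N%:R.
have tau0 : 0 < tau by rewrite divr_gt0// ltr0n.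
have t0 n : 0 <= n%:R * tau by rewrite mulr_ge0// ltW.
have pu n w : (n <= N)%N -> piecewise_affine M (u n w) by move=> nN; apply/(VhP d0 tM bD)/uV.
(* Adaptedness is known for point values; every process below is written as a measurable function of
   this vector. *)
pose U n w : 'rV[R]_(nb_nodes M) := \row_k u n w (node k).
have UE n w k : U n w ord0 k = u n w (node k) by rewrite mxE.
have uE n w (k : 'I_(nb_nodes M)) : u n w (node k) = fe (fun k => U n w ord0 k) (node k).
  by rewrite (fe_node tM) UE.
have mU n k : (n <= N)%N -> measurable_wrt (F (n%:R * tau)) (fun w => U n w ord0 k).
  move=> nN; rewrite (_ : (fun w => _) = fun w => u n w (node k)); last by apply/funext => w; rewrite UE.
  by apply: uM => //; exact: (node_closure tM).
have sF n : sigma_algebra setT (F (n%:R * tau)) by case: hF => + _ _; exact.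
have mUf n : (n <= N)%N -> measurable_fun setT (U n).
  move=> nN; apply: measurable_fun_rV => k; apply: (measurable_wrt_fun hF (t0 n)); exact: mU.
pose X n w := en M (u n w) (u n w).
have XE n : X n = (fun V : 'rV[R]_(nb_nodes M) => en M (fe (fun k => V ord0 k)) (fe (fun k => V ord0 k))) \o U n.
  apply/funext => w /=; rewrite /X (en_node _ (uE n w)) enC (en_node _ (uE n w)); exact: enC.
have mX n : (n <= N)%N -> measurable_wrt (F (n%:R * tau)) (X n).
  move=> nN; rewrite XE; apply: (measurable_wrt_rV (sF n) (fun k => mU n k nN)).
  exact: (measurable_en_fn tM).
pose Z n w := en M (L2_projection D M (g \o u n w)) (u n w).
have [r [pr rE]] := noise_nodal d0 tM bD hg hkappa1 hglip.
have mZ n : (n < N)%N -> measurable_wrt (F (n%:R * tau)) (Z n).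
  move=> /ltnW nN.
  rewrite (_ : Z n = (fun V : 'rV[R]_(nb_nodes M) => \sum_(k : 'I_(nb_nodes M)) ip D (g \o fe (fun k => V ord0 k)) (r k) * en M (hat k) (fe (fun k => V ord0 k))) \o U n).
    apply: (measurable_wrt_rV (sF n) (fun k => mU n k nN)).
    apply: measurable_sum => k; apply: measurable_funM.
      exact: (measurable_ip_comp tM bD hg hkappa1 hglip (pr k)).
    by under eq_fun do rewrite enC; exact: (measurable_en_fnl tM).
  apply/funext => w /=; rewrite /Z rE; last exact: pu.
  apply: eq_bigr => k _; rewrite enC (en_node _ (uE n w)) enC; congr (_ * _).
  apply: ip_eq => // x Dx /=; congr g.
  apply: (pw_affine_node tM (pu n w nN) (pw_affine_comb tM (fun k => U n w ord0 k)) (uE n w)).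
  exact: subset_closure.
pose dl n w x := u n.+1 w x - u n w x.
pose l n w := discrete_laplacian D M (u n.+1 w).
pose V n w := 2^-1 * en M (dl n w) (dl n w) + tau / 2 * ip D (l n w) (l n w).
have mdU n : (n < N)%N -> measurable_fun setT (fun w => U n.+1 w - U n w).
  move=> nN; apply: measurable_fun_rV => k.
  rewrite (_ : (fun w => _) = fun w => U n.+1 w ord0 k - U n w ord0 k); last by apply/funext => w; rewrite !mxE.
  by apply: measurable_funB; [exact: (measurable_wrt_fun hF (t0 n.+1) (mU _ _ nN))|exact: (measurable_wrt_fun hF (t0 n) (mU _ _ (ltnW nN)))].
have dlE n w (k : 'I_(nb_nodes M)) : dl n w (node k) = fe (fun k => (U n.+1 w - U n w) ord0 k) (node k).
  by rewrite (fe_node tM) !mxE.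
have mdl n : (n < N)%N -> measurable_fun setT (fun w => en M (dl n w) (dl n w)).
  move=> nN; have := measurableT_comp (measurable_en_fn tM) (mdU n nN); congr (measurable_fun _ _).
  by apply/funext => w /=; rewrite [RHS](en_node _ (dlE n w)) [RHS]enC [RHS](en_node _ (dlE n w)).
have mdg n : (n < N)%N -> measurable_fun setT (fun w => gr M (dl n w) (dl n w)).
  move=> nN; have := measurableT_comp (measurable_grr_fn tM) (mdU n nN); congr (measurable_fun _ _).
  by apply/funext => w /=; rewrite [RHS](gr_node _ (dlE n w)) [RHS]grC [RHS](gr_node _ (dlE n w)).
have [r' lapE] := laplacian_nodal d0 tM bD.
have ml n : (n < N)%N -> measurable_fun setT (fun w => ip D (l n w) (l n w)).
  move=> nN; rewrite (_ : (fun w => _) = (fun V : 'rV[R]_(nb_nodes M) => \sum_(k : 'I_(nb_nodes M)) gr M (fe (fun k => V ord0 k)) (r' k) * gr M (fe (fun k => V ord0 k)) (hat k)) \o U n.+1).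
    apply: measurableT_comp (mUf _ nN).
    by apply: measurable_sum => k; apply: measurable_funM; exact: (measurable_gr_fn tM).
  apply/funext => w /=; rewrite /l lapE; last exact: pu.
  by apply: eq_bigr => k _; rewrite !(gr_node _ (uE n.+1 w)).
have X0 n w : 0 <= X n w by exact: (en_ge0 tM bD).
have V0 n w : 0 <= V n w.
  by rewrite addr_ge0// mulr_ge0 ?ip_ge0 ?(en_ge0 tM bD)// ?divr_ge0// ltW.
have zz n w : (n <= N)%N -> en M (L2_projection D M (g \o u n w)) (L2_projection D M (g \o u n w)) <= S * Gc * (1 + X n w).
  move=> nN; have Hg := comp_Hs1 d0 tM hD hg hg' hkappa1 hglip (pu n w nN).
  apply: le_trans (projection_en d0 tM hD HPi Hg) _; rewrite -mulrA ler_wpM2l//.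
  exact: (comp_growth d0 tM hD hg hg' hkappa1 hglip (pu n w nN)).
have ZX n w : (n < N)%N -> `|Z n w| <= Kc * (1 + X n w).
  move=> /ltnW nN; have H := zz n w nN; have x0 := X0 n w.
  set z := L2_projection D M (g \o u n w) in H.
  have Y1 := en_young tM bD z (u n w) ltr01.
  (* The same inequality for -z bounds [Z] from below. *)
  have Y2 := en_young tM bD (fun x => -1 * z x) (u n w) ltr01.
  have S1 := en_scale M (-1) z (u n w); have S2 : en M (fun x => -1 * z x) (fun x => -1 * z x) = en M z z.
    by rewrite (en_scale M (-1) z) enC (en_scale M (-1) z) mulrA mulN1r opprK mul1r.
  rewrite S1 S2 in Y2.
  have e0 := en_ge0 tM bD z.
  rewrite invr1 !mul1r -/(X n w) in Y1 Y2; rewrite ler_norml /Kc /Z -/z.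
  by apply/andP; split; lra.
(* The initial energy is deterministic and bounded uniformly in the mesh by the same stability of
   the projection. *)
have X00 w : X 0%N w <= K0.
  have E (k : 'I_(nb_nodes M)) : u 0%N w (node k) = L2_projection D M u0 (node k) by apply: u00; exact: (node_closure tM).
  rewrite /X (en_node _ E) enC (en_node _ E); exact: (projection_en d0 tM hD HPi hu0).
have step : {ae P, forall w n, (n < N)%N -> X n.+1 w + V n w <= X n w + tau * c
    + 2 * (W (n.+1%:R * tau) w - W (n%:R * tau) w) * Z n w
    + 2 * (W (n.+1%:R * tau) w - W (n%:R * tau) w) ^+ 2 * (Kc * (1 + X n w))}.
  apply: filterS sch => w H n nN; have {}H := H n nN.
  have nN' := ltnW nN; have LG := comp_L2 tM bD hg hkappa1 hglip (pu n w nN').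
  have := energy_step d0 tM bD hM hq3 hqodd (pu n w nN') (pu n.+1 w nN) LG (ltW tau0) H.
  rewrite -/tau -/(dl n w) -/(l n w) -/(X n w) -/(X n.+1 w) -/(Z n w) -/c addrA -/(V n w).
  set om := W _ w - W _ w; set z2 := en M (L2_projection _ _ _) _ => E.
  have : om ^+ 2 * z2 <= om ^+ 2 * (Kc * (1 + X n w)).
    rewrite ler_wpM2l ?sqr_ge0//; apply: le_trans (zz n w nN') _.
    by apply: ler_wpM2r; [exact: addr_ge0|rewrite /Kc lerDl].
  lra.
have GR n nN := @stochastic_gronwall _ _ _ P F W hF hW T N X V Z Kc c K0 hT N0 Kc0 c0 K00 mX mZ
  (fun n nN => measurable_funD (measurable_funM (measurable_cst _) (mdl n nN)) (measurable_funM (measurable_cst _) (ml n nN)))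
  (fun n w _ => X0 n w) (fun n w _ => V0 n w) ZX X00 step n nN.
have mXf n : (n <= N)%N -> measurable_fun setT (X n).
  by move=> nN; apply: (measurable_wrt_fun hF (t0 n)); exact: mX.
have SV0 n : (0 <= \sum_(0 <= k < n) \int[P]_w (V k w)%:E)%E.
  by apply: sume_ge0 => k _; apply: mean_ge0.
have XB n : (n <= N)%N -> (\int[P]_w (X n w)%:E <= B%:E)%E.
  by move=> nN; apply: le_trans (GR n nN); rewrite leeDl.
have VB : (\sum_(0 <= k < N) \int[P]_w (V k w)%:E <= B%:E)%E.
  by apply: le_trans (GR N (leqnn N)); rewrite leeDr// mean_ge0.
have gradE v : normL2_grad D v ^+ 2 = ip_grad D v v by rewrite sqr_sqrtr// ip_grad_ge0.
have grle v : gr M v v <= en M v v by rewrite lerDl (lump_ge0 tM bD).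
have pdl n w : (n < N)%N -> piecewise_affine M (dl n w).
  move=> nN; apply: (pw_affine_cl tM (v := fun x => -1 * u n w x + u n.+1 w x)).
    by move=> x _; rewrite /dl mulN1r addrC.
  by apply: pw_affine_lin; apply: pu => //; exact: ltnW.
apply: (@le_trans _ _ (3 * B)%:E); last by rewrite lee_fin lerDl.
apply: (sup_add_sums_le (v := fun k => (\int[P]_w (V k w)%:E)%E)) => //.
- apply: ge_ereal_sup => _ [n nN <-]; rewrite unlock; apply: le_trans (XB n nN).
  under eq_integral do rewrite gradE (gr_pw d0 tM bD (pu n _ nN) (pu n _ nN)).
  apply: mean_le => //; [|exact: mXf|by move=> w; exact: (gr_ge0 tM bD)].
  have := measurableT_comp (measurable_grr_fn tM) (mUf n nN); congr (measurable_fun _ _).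
  by apply/funext => w /=; rewrite [RHS](gr_node _ (uE n w)) [RHS]grC [RHS](gr_node _ (uE n w)).
- exact: ltW.
- by move=> k kN; rewrite unlock; apply: mean_ge0 => w; exact: sqr_ge0.
- by move=> k kN; rewrite unlock; apply: mean_ge0 => w; exact: sqr_ge0.
move=> k kN; rewrite !unlock.
have e20 w : 0 <= 2^-1 * en M (dl k w) (dl k w) by rewrite mulr_ge0// (en_ge0 tM bD).
have l20 w : 0 <= tau / 2 * ip D (l k w) (l k w) by rewrite mulr_ge0 ?ip_ge0// divr_ge0// ltW.
have half0 : 0 <= 2^-1 :> R by [].
have tau20 : 0 <= tau / 2 by rewrite divr_ge0// ltW.
rewrite (mean_add P (measurable_funM (measurable_cst _) (mdl k kN)) (measurable_funM (measurable_cst _) (ml k kN)) e20 l20).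
rewrite (mean_scale P half0 (mdl k kN) (fun w => en_ge0 tM bD _)) (mean_scale P tau20 (ml k kN) (fun w => ip_ge0 D _)).
apply: leeD.
  rewrite lee_wpmul2l//; under eq_integral do rewrite gradE -/(dl k _) (gr_pw d0 tM bD (pdl k _ kN) (pdl k _ kN)).
  by apply: mean_le => //; [exact: mdg|exact: mdl|move=> w; exact: (gr_ge0 tM bD)].
rewrite lee_wpmul2l//; apply: mean_le => //.
- have := ml k kN; congr (measurable_fun _ _); apply/funext => w.
  by rewrite sqr_sqrtr// ip_ge0.
- exact: ml.
- by move=> w; exact: sqr_ge0.
- by move=> w; rewrite sqr_sqrtr// ip_ge0.
Qed.
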